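(* Let $\phi$ be a Pisot substitution on a finite alphabet $\mathcal{A}$ whose incidence matrix has characteristic polynomial irreducible over $\mathbb{Q}$, and let $\Phi$ be the associated one-dimensional geometric substitution. If there are letters $a\neq b$ in $\mathcal{A}$ such that the balanced pair algorithm for $(ab,ba)$ terminates with coincidence, then the $\mathbb{R}$-action on $\Omega_\Phi$ has pure discrete spectrum.
   Context: Symbolic substitutions. $\mathcal{A}=\{1,\ldots,k\}$, $\mathcal{A}^*$ is the set of finite words, and $\phi:\mathcal{A}\to\mathcal{A}^*$ is extended to words by concatenation. The incidence matrix $M_\phi$ is the $k\times k$ matrix whose $(i,j)$ entry is the number of $i$'s in $\phi(j)$. $\phi$ is primitive if some power of $M_\phi$ has all positive entries; then $\omega=(\omega_1,\ldots,\omega_k)$ is a positive left eigenvector for the Perron–Frobenius eigenvalue $\lambda$ of $M_\phi$. $\phi$ is a Pisot substitution if it is primitive and $\lambda$ is a Pisot number. The abelianization $[u]\in\mathbb{Z}^k$ of a word $u$ has $i$-th entry equal to the number of $i$'s in $u$. Geometric substitution. The prototiles are $\rho_i=([0,\omega_i],i)$; a tile is a translate $\rho_i+t=([t,t+\omega_i],i)$, $t\in\mathbb{R}$. $\Phi(\rho_i)$ is the collection of consecutive tiles filling $[0,\lambda\omega_i]$ whose types, read left to right, spell $\phi(i)$; $\Phi(\rho_i+t)=\Phi(\rho_i)+\lambda t$, and $\Phi(P)=\bigcup_{\tau\in P}\Phi(\tau)$ for a collection $P$ of tiles with pairwise disjoint interiors. The tiling space $\Omega_\Phi$ is the set of tilings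 of $\mathbb{R}$ all of whose finite patches are contained in translates of patches $\Phi^m(\rho_i)$. In its topology two tilings are close if a small translate of one agrees with the other on a large neighborhood of the origin. $\mathbb{R}$ acts by $(T,t)\mapsto T-t$. It is assumed throughout that $\Phi$ is aperiodic ($T\in\Omega_\Phi$, $T-t=T$ imply $t=0$); the action is then minimal and uniquely ergodic, with invariant probability measure $\mu$. The action has pure discrete spectrum if the linear span of the eigenfunctions ($f\in L^2(\Omega_\Phi,\mu)$ with $f(T-t)=e^{2\pi ibt}f(T)$ for all $t\in\mathbb{R}$ and almost all $T$, for some $b\in\mathbb{R}$) is dense in $L^2(\Omega_\Phi,\mu)$. Balanced pairs. $(u,v)\in\mathcal{A}^*\times\mathcal{A}^*$ is a balanced pair if $[u]=[v]$. Write $(u_1,v_1)(u_2,v_2)=(u_1u_2,v_1v_2)$ and call $(u_1,v_1),(u_2,v_2)$ factors of the product. A balanced pair is irreducible if it has no non-trivial factors; every balanced pair is uniquely a product of irreducible balanced pairs, its irreducible factors. A coincidence is a balanced pair $(a,a)$ with $a\in\mathcal{A}$. The balanced pair algorithm for $(u,v)$ terminates with coincidence if (1) the collection of all irreducible factors of $(\phi^m(u),\phi^m(v))$, $m\in\mathbb{N}$, is finite; and (2) for each such irreducible factor $(x,y)$ there is $k\in\mathbb{N}$ such that $(\phi^k(x),\phi^k(y))$ has a coincidence as a factor. *)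

(* Defs.v *)
From HB Require Import structures.
From mathcomp Require Import all_boot all_order all_algebra.
From mathcomp Require Import all_classical all_reals all_analysis.
From mathcomp Require Import complex.

Set Implicit Arguments.
Unset Strict Implicit.
Unset Printing Implicit Defensive.

Import Order.TTheory GRing.Theory Num.Theory.
Import numFieldNormedType.Exports.

Local Open Scope classical_set_scope.
Local Open Scope ring_scope.

Section Substitutions.
Context {k : nat}.
Implicit Types (phi : 'I_k -> seq 'I_k) (u v : seq 'I_k).

Definition extend_subst phi u : seq 'I_k := flatten [seq phi a | a <- u].

Definition abelianization u : 'cV[int]_k := \col_i (count_mem i u)%:Z.

Definition incidence_mx phi : 'M[int]_k :=
  \matrix_(i, j) (count_mem i (phi j))%:Z.

Definition primitive_subst phi : Prop :=
  exists2 n, (0 < n)%N & forall i j, 0 < (incidence_mx phi ^+ n) i j.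

(* The Perron-Frobenius eigenvalue of the incidence matrix: the positive
   eigenvalue that strictly dominates every other complex eigenvalue. *)
Definition PF_eigenvalue (R : realType) phi (lam : R) : Prop :=
  [/\ 0 < lam,
      eigenvalue (map_mx intr (incidence_mx phi) : 'M[R]_k) lam &
      forall z : R[i],
        eigenvalue (map_mx intr (incidence_mx phi) : 'M[R[i]]_k) z ->
        z != lam%:C%C -> `|z| < lam%:C%C].

Definition positive_left_eigenvector (R : realType) phi (lam : R)
    (omega : 'rV[R]_k) : Prop :=
  (forall i, 0 < omega 0 i) /\
  omega *m map_mx intr (incidence_mx phi) = lam *: omega.

(* [p] is the minimal polynomial of [x] over Q; its having integer coefficients
   says that [x] is an algebraic integer, and its other complex roots are the
   other algebraic conjugates of [x]. *)
Definition Pisot_number (R : realType) (x : R) : Prop :=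
  1 < x /\
  exists p : {poly int},
    [/\ p \is monic,
        irreducible_poly (map_poly intr p : {poly rat}),
        root (map_poly intr p) x &
        forall z : R[i], root (map_poly intr p) z -> z != x%:C%C -> `|z| < 1].

Definition Pisot_subst (R : realType) phi : Prop :=
  primitive_subst phi /\
  exists2 lam : R, PF_eigenvalue phi lam & Pisot_number lam.

End Substitutions.

Section BalancedPairs.
Context {k : nat}.
Let word_pair := (seq 'I_k * seq 'I_k)%type.
Implicit Types (phi : 'I_k -> seq 'I_k) (p q : word_pair).

Definition balanced p : Prop := abelianization p.1 = abelianization p.2.

Definition pair_mul p q : word_pair := (p.1 ++ q.1, p.2 ++ q.2).

(* The cofactors [l] and [r] must be balanced too, and may be empty. *)
Definition pair_factor q p : Prop :=
  exists l r : word_pair,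
    [/\ balanced l, balanced q, balanced r & p = pair_mul (pair_mul l q) r].

Definition irreducible_pair p : Prop :=
  [/\ balanced p, p <> ([::], [::]) &
      forall q, pair_factor q p -> q = ([::], [::]) \/ q = p].

Definition irreducible_factor q p : Prop := irreducible_pair q /\ pair_factor q p.

Definition has_coincidence p : Prop := exists a, pair_factor ([:: a], [:: a]) p.

Definition pair_iter phi m p : word_pair :=
  (iter m (extend_subst phi) p.1, iter m (extend_subst phi) p.2).

Definition bpa_factors phi p : set word_pair :=
  [set q | exists m, irreducible_factor q (pair_iter phi m p)].

Definition terminates_with_coincidence phi p : Prop :=
  finite_set (bpa_factors phi p) /\
  forall q, bpa_factors phi p q -> exists n, has_coincidence (pair_iter phi n q).

End BalancedPairs.

Section TilingSpace.
Context {R : realType} {k : nat}.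
Implicit Types (phi : 'I_k -> seq 'I_k) (lam t : R) (omega : 'rV[R]_k).

(* The pair [(t, i)] stands for the tile ([t, t + omega_i], i). *)
Definition tile : Type := (R * 'I_k)%type.

(* Collections of tiles. The lengths [omega] are a parameter of the type because
   the topology below depends on them. *)
Definition tiles omega : Type := set tile.

HB.instance Definition _ omega := Pointed.copy (tiles omega) (set tile).

Definition tile_support omega (x : tile) : set R :=
  [set` `[x.1, x.1 + omega 0 x.2]].

Definition translate omega (T : tiles omega) t : tiles omega :=
  [set (x.1 + t, x.2) | x in T].

Fixpoint layout omega (t : R) (w : seq 'I_k) : seq tile :=
  if w is j :: w' then (t, j) :: layout omega (t + omega 0 j) w' else [::].

Definition inflate phi lam omega (P : tiles omega) : tiles omega :=
  \bigcup_(x in P) [set y | y \in layout omega (lam * x.1) (phi x.2)].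

Definition supertile phi lam omega (m : nat) (i : 'I_k) : tiles omega :=
  iter m (inflate phi lam (omega := omega)) [set (0, i)].

Definition is_tiling omega (T : tiles omega) : Prop :=
  \bigcup_(x in T) tile_support omega x = setT /\
  trivIset T (fun x => (tile_support omega x)^°).

Definition tiling_space phi lam omega : set (tiles omega) :=
  [set T | is_tiling T /\
    forall P : tiles omega, finite_set P -> P `<=` T ->
      exists m i t, P `<=` translate (supertile phi lam omega m i) t].

Definition aperiodic phi lam omega : Prop :=
  forall T t, tiling_space phi lam (omega := omega) T ->
    translate T (- t) = T -> t = 0.

Definition window omega (r : R) (T : tiles omega) : set tile :=
  [set x | T x /\ tile_support omega x `&` `[- r, r] !=set0].

(* [T'] is eps-close to [T]: up to a translation by less than eps, it agrees
   with [T] on [-1/eps, 1/eps]. *)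
Definition eps_close omega (eps : R) (T T' : tiles omega) : Prop :=
  exists2 t, `|t| < eps &
    window eps^-1 (translate T' (- t)) = window eps^-1 T.

Definition tiles_open omega : set_system (tiles omega) :=
  [set U | forall T, U T -> exists2 eps, 0 < eps & eps_close eps T `<=` U].

Lemma eps_close_le omega (e e' : R) (T T' : tiles omega) :
  0 < e -> e <= e' -> eps_close e T T' -> eps_close e' T T'.
Proof.
move=> e0 ee' [t te TT']; exists t; first exact: lt_le_trans te ee'.
have e'0 : 0 < e' by exact: lt_le_trans ee'.
have sub x : tile_support omega x `&` `[- e'^-1, e'^-1] !=set0 ->
    tile_support omega x `&` `[- e^-1, e^-1] !=set0.
  move=> [y [xy]]; rewrite /= in_itv /= => /andP[y1 y2].
  have ie : e'^-1 <= e^-1 by rewrite lef_pV2.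
  exists y; split=> //=; rewrite in_itv /= (le_trans y2 ie) andbT.
  by rewrite (le_trans _ y1) // lerN2.
apply/seteqP; split=> x [Tx xe]; have xe' := sub _ xe; split=> //.
- suff : window e^-1 T x by case.
  by rewrite -TT'; split.
- suff : window e^-1 (translate T' (- t)) x by case.
  by rewrite TT'; split.
Qed.

Lemma tiles_openT omega : tiles_open (omega := omega) setT.
Proof. by move=> T _; exists 1. Qed.

Lemma tiles_openI omega : setI_closed (tiles_open (omega := omega)).
Proof.
move=> U V oU oV T [/oU[e e0 eU] /oV[f f0 fV]].
have ef0 : 0 < Num.min e f by rewrite lt_min e0.
exists (Num.min e f) => // T' TT'; split.
- by apply: eU; apply: eps_close_le TT' => //; rewrite ge_min lexx.
- by apply: fV; apply: eps_close_le TT' => //; rewrite ge_min lexx orbT.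
Qed.

Lemma tiles_open_bigU omega (I : Type) (U : I -> set (tiles omega)) :
  (forall i, tiles_open (U i)) -> tiles_open (\bigcup_i U i).
Proof.
move=> oU T [i _ /(oU i)[e e0 eU]]; exists e => // T' /eU UT'.
by exists i.
Qed.

HB.instance Definition _ omega := isOpenTopological.Build (tiles omega)
  (@tiles_openT omega) (@tiles_openI omega) (@tiles_open_bigU omega).

(* Open subsets of the tiling space. Measurable types must be inhabited, which
   the tiling space need not be for arbitrary parameters; we therefore equip the
   ambient type [tiles omega] with the sigma-algebra generated by these sets.
   Its trace on the tiling space is the Borel sigma-algebra, the complement of
   the tiling space being an atom. A Borel probability measure on the tiling
   space is then the same as a probability measure [mu] on this sigma-algebra
   with [mu (tiling_space phi lam) = 1]. *)
Definition tiling_space_open phi lam omega : set_system (tiles omega) :=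
  [set tiling_space phi lam (omega := omega) `&` U | U in open].

End TilingSpace.
Arguments tile : clear implicits.
Arguments tiling_space {R k} phi lam omega.
Arguments tiling_space_open {R k} phi lam omega.

Notation borel_tiles phi lam omega :=
  (g_sigma_algebraType (tiling_space_open phi lam omega)).

Section L2.
Context {d : measure_display} {T : measurableType d} {R : realType}.
Variable mu : {measure set T -> \bar R}.
Implicit Types f g : T -> R[i].

Definition L2norm f : \bar R :=
  Lnorm mu 2%:E (fun x => (ComplexField.Normc.normc (f x))%:E).

Definition L2 : set (T -> R[i]) :=
  [set f | [/\ measurable_fun setT (fun x => complex.Re (f x)),
               measurable_fun setT (fun x => complex.Im (f x)) &
               (L2norm f < +oo)%E]].

Definition span_dense (E : set (T -> R[i])) : Prop :=
  forall g, L2 g -> forall eps : R, 0 < eps ->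
    exists (n : nat) (c : 'I_n -> R[i]) (f : 'I_n -> T -> R[i]),
      (forall i, E (f i)) /\
      (L2norm (fun x => g x - \sum_(i < n) c i * f i x)%R < eps%:E)%E.

End L2.

Section Spectrum.
Context {R : realType} {k : nat} {phi : 'I_k -> seq 'I_k} {lam : R}
  {omega : 'rV[R]_k}.
Variable mu : {measure set (borel_tiles phi lam omega) -> \bar R}.

Definition translation_invariant : Prop :=
  forall (t : R) (A : set (borel_tiles phi lam omega)), measurable A ->
    mu [set T | A (translate T (- t))] = mu A.

Definition eigenfunction (f : borel_tiles phi lam omega -> R[i]) : Prop :=
  L2 mu f /\
  exists b : R, forall t : R,
    {ae mu, forall T : borel_tiles phi lam omega, f (translate T (- t)) =
      (cos (2 * pi * b * t) +i* sin (2 * pi * b * t))%C * f T}.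

Definition pure_discrete_spectrum : Prop := span_dense mu [set f | eigenfunction f].

End Spectrum.

(* Main.v *)
Require Import Defs.
From HB Require Import structures.
From mathcomp Require Import all_boot all_order all_algebra.
From mathcomp Require Import all_classical all_reals all_analysis.
From mathcomp Require Import measurable_realfun separable qpoly complex.
From mathcomp Require Import ring lra zify.

Set Implicit Arguments.
Unset Strict Implicit.
Unset Printing Implicit Defensive.

Import Order.TTheory GRing.Theory Num.Theory.

Local Open Scope classical_set_scope.
Local Open Scope ring_scope.

(* Termination of the balanced pair algorithm for (ab, ba) means that the tiles of
   the two patches spelled by ab and ba coincide, after enough inflations, on a
   dense set of places. Rotating through the lengths of a and b, the same holds for
   a tile of type b and its translates by Z omega_a + Z omega_b, hence, after an
   inflation making all letters appear, for every tile and its translates by the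
   sums of the dense groups lam^(N+j) (Z omega_a + Z omega_b): short translations
   from two dense groups can be interleaved so as to stay near a given place.
   If such a translation x comes from an integer vector with small contracted
   coordinates, the Pisot property leaves finitely many types of overlaps between
   tiles of T and T - x. They all reach a coincidence, so the density of the places
   where T and T - lam^n x disagree tends to 0, uniformly in T and x. Up to a small
   error, the numbers lam^n x contain all times at which finitely many given
   characters e(beta t) are close to 1. By invariance of mu, the Borel sets A are
   therefore almost periodic: mu (A + A_t) is small (symmetric difference with the
   translate by t) at all such times t. Averaging the translates of the indicator of
   A against a Fejer kernel concentrated on these times approximates it by
   combinations of eigenfunctions, where the eigenfunction of frequency b is the
   norm-minimal limit of the averages of e(-bt) 1_A(T - t). *)

(** * Inflated patches and coincidences *)

(** The main obstacle is that agreement of tiles is not transitive: tiles that do not overlap agree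
    vacuously, so a chain of coincidences is of use only while all its tiles cover a common
    interval. Hence coincidences are demanded over every subinterval of a given interval, and long
    translations are split into short ones taken from dense groups. Irreducibility over Q makes the
    iterates of every nonzero integer vector a basis. So the lengths of a and b are incommensurable,
    which gives density, and the eigenvalues are distinct; those other than lam are its conjugates,
    which the Pisot property makes contracting. On the analytic side, Fejer kernels have nonnegative
    coefficients, so a product of them has constant term at least 1 even when its frequencies are
    rationally dependent: no independence has to be arranged. Averages over finitely many times
    replace integrals over the line throughout. *)

Lemma exprn_unbounded (R : realType) (l C : R) : 1 < l -> exists n, C < l ^+ n.
Proof.
move=> l1; have bern n : 1 + n%:R * (l - 1) <= l ^+ n.
  elim: n => [|n IH]; first by rewrite mul0r addr0 expr0.
  rewrite exprS; apply: (@le_trans _ _ (l * (1 + n%:R * (l - 1)))).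
    have : 0 <= n%:R * (l - 1) ^+ 2 by rewrite mulr_ge0 // sqr_ge0.
    by rewrite -natr1; lra.
  by rewrite ler_wpM2l //; lra.
have l0 : 0 < l - 1 by lra.
exists (Num.bound (C / (l - 1))).
apply: lt_le_trans (bern _).
have : C / (l - 1) < (Num.bound (C / (l - 1)))%:R by exact: unstable.ltr_bound.
by rewrite ltr_pdivrMr //; lra.
Qed.

Section Layout.
Context {R : realType} {k : nat} (omega : 'rV[R]_k).
Implicit Types (t r s : R) (w u v : seq 'I_k) (x y z : tile R k).

Definition wlen w : R := \sum_(i <- w) omega 0 i.
Definition shift_tile s x : tile R k := (x.1 + s, x.2).
Definition tend x : R := x.1 + omega 0 x.2.

Lemma wlen_nil : wlen [::] = 0. Proof. exact: big_nil. Qed.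

Lemma wlen_cons i w : wlen (i :: w) = omega 0 i + wlen w.
Proof. exact: big_cons. Qed.

Lemma wlen_cat u v : wlen (u ++ v) = wlen u + wlen v.
Proof. exact: big_cat. Qed.

Lemma wlen_count w : wlen w = \sum_i (count_mem i w)%:R * omega 0 i.
Proof.
elim: w => [|j w IH].
  by rewrite wlen_nil big1 // => i _; rewrite mul0r.
rewrite wlen_cons IH (bigD1 j) //= [in RHS](bigD1 j) //= eqxx natrD mulrDl mul1r addrA.
by congr (_ + _); apply: eq_bigr => i ij; rewrite eq_sym (negbTE ij).
Qed.

Lemma layout_cat t u v :
  layout omega t (u ++ v) = layout omega t u ++ layout omega (t + wlen u) v.
Proof.
elim: u t => [|i u IH] t /=; first by rewrite wlen_nil addr0.
by rewrite IH wlen_cons addrA.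
Qed.

Lemma layout_shift s t w :
  layout omega (t + s) w = [seq shift_tile s x | x <- layout omega t w].
Proof. by elim: w t => //= i w IH t; rewrite -IH addrAC. Qed.

Lemma mem_layout t w x : x \in layout omega t w <->
  exists u v, w = u ++ x.2 :: v /\ x.1 = t + wlen u.
Proof.
split.
  elim: w t => //= i w IH t; rewrite inE => /orP[/eqP->/=|/IH[u [v [-> xE]]]].
    by exists [::], w; rewrite wlen_nil addr0.
  by exists (i :: u), v; rewrite xE wlen_cons addrA.
move=> [u [v [-> xE]]]; rewrite layout_cat mem_cat /= inE -xE.
by rewrite -surjective_pairing eqxx orbT.
Qed.

Hypothesis om0 : forall i, 0 < omega 0 i.

Lemma wlen_ge0 w : 0 <= wlen w.
Proof. by apply: sumr_ge0 => i _; exact: ltW. Qed.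

Lemma layout_bounds t w x : x \in layout omega t w ->
  t <= x.1 /\ tend x <= t + wlen w.
Proof.
move=> /mem_layout[u [v [-> xE]]]; rewrite /tend xE wlen_cat wlen_cons.
by have := wlen_ge0 u; have := wlen_ge0 v; split; lra.
Qed.

Lemma layout_disj t w x y : x \in layout omega t w -> y \in layout omega t w ->
  x.1 < tend y -> y.1 < tend x -> x = y.
Proof.
elim: w t => //= i w IH t; rewrite !inE => /orP[/eqP->|xw] /orP[/eqP->|yw] //.
- by have [+ _] := layout_bounds yw; rewrite /tend/= => ? ? ?; exfalso; lra.
- by have [+ _] := layout_bounds xw; rewrite /tend/= => ? ? ?; exfalso; lra.
- exact: IH xw yw.
Qed.

Lemma layout_cover t w r : t <= r < t + wlen w ->
  exists2 x, x \in layout omega t w & x.1 <= r < tend x.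
Proof.
elim: w t => [|i w IH] t; first by rewrite wlen_nil; lra.
rewrite wlen_cons => H.
have [rt|rt] := ltP r (t + omega 0 i).
  exists (t, i); first by rewrite /= inE eqxx.
  by rewrite /tend/=; lra.
have [|x xw xr] := IH (t + omega 0 i); first by lra.
by exists x => //=; rewrite inE xw orbT.
Qed.

Lemma ltW_ord i : 0 <= omega 0 i. Proof. exact: ltW. Qed.

(** Any common upper bound of the tile lengths serves; the sum avoids a maximum over a possibly
    empty alphabet. *)
Definition ommax : R := \sum_i omega 0 i.

Lemma le_ommax i : omega 0 i <= ommax.
Proof.
rewrite /ommax (bigD1 i) //= ler_wpDr //.
by apply: sumr_ge0 => j _; exact: ltW_ord.
Qed.

End Layout.

Section Inflation.
Context {R : realType} {k : nat} (phi : 'I_k -> seq 'I_k) (lam : R)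
  (omega : 'rV[R]_k).
Implicit Types (t r s : R) (w u v : seq 'I_k) (x y z : tile R k).

Notation wlen := (wlen omega).
Notation tend := (tend omega).
Notation layout := (layout omega).

Definition subst_iter n w : seq 'I_k := iter n (extend_subst phi) w.

Lemma extend_cat u v :
  extend_subst phi (u ++ v) = extend_subst phi u ++ extend_subst phi v.
Proof. by rewrite /extend_subst map_cat flatten_cat. Qed.

Lemma subst_iter_cat n u v : subst_iter n (u ++ v) = subst_iter n u ++ subst_iter n v.
Proof. by elim: n => //= n IH; rewrite IH extend_cat. Qed.

Lemma subst_iter_nil n : subst_iter n [::] = [::].
Proof. by elim: n => //= n ->. Qed.

Lemma subst_iter_add m n w : subst_iter (m + n) w = subst_iter m (subst_iter n w).
Proof. exact: iterD. Qed.

Hypothesis om0 : forall i, 0 < omega 0 i.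
Hypothesis lam1 : 1 < lam.
Hypothesis eig : omega *m map_mx intr (incidence_mx phi) = lam *: omega.

Let lam0 : 0 < lam. Proof. exact: lt_trans lam1. Qed.
Let lamn0 n : 0 < lam ^+ n. Proof. exact: exprn_gt0. Qed.

Lemma wlen_phi j : wlen (phi j) = lam * omega 0 j.
Proof.
have /rowP/(_ j) := eig; rewrite !mxE => <-; rewrite wlen_count.
by apply: eq_bigr => i _; rewrite !mxE mulrC.
Qed.

Lemma wlen_extend w : wlen (extend_subst phi w) = lam * wlen w.
Proof.
elim: w => [|j w IH]; first by rewrite /extend_subst/= wlen_nil mulr0.
have -> : extend_subst phi (j :: w) = phi j ++ extend_subst phi w by [].
by rewrite wlen_cat wlen_cons IH wlen_phi mulrDr.
Qed.

Lemma wlen_subst_iter n w : wlen (subst_iter n w) = lam ^+ n * wlen w.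
Proof.
elim: n => [|n IH]; first by rewrite expr0 mul1r.
by rewrite /= wlen_extend -/(subst_iter n w) IH exprS mulrA.
Qed.

(* The patch [Phi^n(x)], listed from left to right. *)
Definition supertiles n x : seq (tile R k) := layout (lam ^+ n * x.1) (subst_iter n [:: x.2]).

Lemma layout_supertiles n t w :
  layout (lam ^+ n * t) (subst_iter n w) = flatten [seq supertiles n x | x <- layout t w].
Proof.
elim: w t => [|i w IH] t; first by rewrite subst_iter_nil.
by rewrite -cat1s subst_iter_cat layout_cat wlen_subst_iter -mulrDr IH wlen_cons wlen_nil addr0.
Qed.

Lemma supertiles_add m n x : supertiles (m + n) x = flatten [seq supertiles m y | y <- supertiles n x].
Proof. by rewrite /supertiles subst_iter_add exprD -mulrA layout_supertiles. Qed.

Lemma supertiles0 x : supertiles 0 x = [:: x].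
Proof. by rewrite /supertiles expr0 mul1r /= -surjective_pairing. Qed.

Lemma supertiles_shift n s x : supertiles n (shift_tile s x) = [seq shift_tile (lam ^+ n * s) y | y <- supertiles n x].
Proof. by rewrite /supertiles /= mulrDr layout_shift. Qed.

Lemma mem_supertiles_trans m n x y z : y \in supertiles n x -> z \in supertiles m y -> z \in supertiles (m + n) x.
Proof.
by move=> yx zy; rewrite supertiles_add; apply/flatten_mapP; exists y.
Qed.

Lemma supertiles_bounds n x y : y \in supertiles n x ->
  lam ^+ n * x.1 <= y.1 /\ tend y <= lam ^+ n * tend x.
Proof.
move=> /layout_bounds -/(_ om0); rewrite wlen_subst_iter wlen_cons wlen_nil addr0.
by rewrite -mulrDr.
Qed.

Lemma tend_gt x : x.1 < tend x.
Proof. by rewrite /tend ltrDl. Qed.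

Lemma supertiles_locate n t w x z : x \in layout t w ->
  z \in layout (lam ^+ n * t) (subst_iter n w) ->
  lam ^+ n * x.1 < tend z -> z.1 < lam ^+ n * tend x -> z \in supertiles n x.
Proof.
move=> xw; rewrite layout_supertiles => /flatten_mapP[y yw zy] xz zx.
have [yz zy'] := supertiles_bounds zy.
suff -> : x = y by [].
apply: (layout_disj om0 xw yw).
- by rewrite -(ltr_pM2l (lamn0 n)); exact: lt_le_trans zy'.
- by rewrite -(ltr_pM2l (lamn0 n)); exact: le_lt_trans zx.
Qed.

Lemma supertiles_locate_add m n x y z : y \in supertiles n x -> z \in supertiles (m + n) x ->
  lam ^+ m * y.1 < tend z -> z.1 < lam ^+ m * tend y -> z \in supertiles m y.
Proof.
by move=> yx zx; apply: (supertiles_locate yx); rewrite /supertiles subst_iter_add exprD -mulrA in zx.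
Qed.

Lemma supertiles_disj n x y z : y \in supertiles n x -> z \in supertiles n x ->
  y.1 < tend z -> z.1 < tend y -> y = z.
Proof. exact: layout_disj. Qed.

Lemma supertiles_cover n x r : lam ^+ n * x.1 <= r < lam ^+ n * tend x ->
  exists2 y, y \in supertiles n x & y.1 <= r < tend y.
Proof.
move=> H; apply: (layout_cover (omega := omega)).
by rewrite wlen_subst_iter wlen_cons wlen_nil addr0 -mulrDr.
Qed.

Lemma supertiles_nonempty n x : exists y, y \in supertiles n x.
Proof.
have [|y] := @supertiles_cover n x (lam ^+ n * x.1); last by exists y.
by rewrite lexx ltr_pM2l // tend_gt.
Qed.

Lemma om_le_ommax i : omega 0 i <= ommax omega.
Proof. exact: le_ommax. Qed.

Definition coincide x y c d := exists n z,
  [/\ z \in supertiles n x, z \in supertiles n y, lam ^+ n * c <= z.1 & tend z <= lam ^+ n * d].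

Lemma coincide_sym x y c d : coincide x y c d -> coincide y x c d.
Proof. by move=> [n [z [? ? ? ?]]]; exists n, z. Qed.

Lemma coincide_widen x y c d c' d' : c' <= c -> d <= d' ->
  coincide x y c d -> coincide x y c' d'.
Proof.
move=> cc dd [n [z [zx zy zc zd]]]; exists n, z; split => //.
- by apply: le_trans zc; rewrite ler_pM2l.
- by apply: le_trans zd _; rewrite ler_pM2l.
Qed.

Lemma coincide_shift s x y c d : coincide x y c d ->
  coincide (shift_tile s x) (shift_tile s y) (c + s) (d + s).
Proof.
move=> [n [z [zx zy zc zd]]]; exists n, (shift_tile (lam ^+ n * s) z).
rewrite !supertiles_shift !map_f //; split => //; rewrite /tend/=.
- by rewrite mulrDr lerD2r.
- by rewrite mulrDr addrAC lerD2r.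
Qed.

Lemma coincide_later m x y c d : coincide x y c d ->
  exists n z, [/\ (m <= n)%N, z \in supertiles n x, z \in supertiles n y,
    lam ^+ n * c <= z.1 & tend z <= lam ^+ n * d].
Proof.
move=> [n [z [zx zy zc zd]]].
have [z' z'z] := supertiles_nonempty m z.
have [z1 z2] := supertiles_bounds z'z.
exists (m + n)%N, z'; rewrite leq_addr !exprD -!mulrA; split => //.
- exact: mem_supertiles_trans z'z.
- exact: mem_supertiles_trans z'z.
- by apply: le_trans z1; rewrite ler_pM2l.
- by apply: le_trans z2 _; rewrite ler_pM2l.
Qed.

(** Asking for a common tile over every subinterval makes the relation transitive on a fixed
    interval: a single coincidence of [x] and [y] need not lie where [y] and [z] coincide. *)
Definition dense_coincide x y c d := forall c' d',
  c <= c' -> c' < d' -> d' <= d -> coincide x y c' d'.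

Lemma dense_coincideE x y c d : dense_coincide x y c d -> c < d -> coincide x y c d.
Proof. by move=> H cd; apply: H. Qed.

Lemma dense_coincide_trans x y z c d : dense_coincide x y c d ->
  dense_coincide y z c d -> dense_coincide x z c d.
Proof.
move=> xy yz c' d' cc cd dd.
have [n [p [px py pc pd]]] := xy _ _ cc cd dd.
(* The second coincidence is sought inside the place of the common tile [p] of [x] and [y], at a
   later level; by disjointness it descends from [p], hence from [x]. *)
have /(@coincide_later n)[m [q [nm qy qz qc qd]]] :
    coincide y z (p.1 / lam ^+ n) (tend p / lam ^+ n).
  apply: yz.
  - by apply: le_trans cc _; rewrite ler_pdivlMr // mulrC.
  - by rewrite ltr_pM2r ?invr_gt0 // tend_gt.
  - by apply: le_trans dd; rewrite ler_pdivrMr // mulrC.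
have mE : m = ((m - n) + n)%N by rewrite subnK.
have lE a : lam ^+ m * (a / lam ^+ n) = lam ^+ (m - n) * a.
  by rewrite {1}mE exprD -mulrA [lam ^+ n * _]mulrCA divff ?mulr1 // gt_eqF.
rewrite !lE in qc qd.
have qp : q \in supertiles (m - n) p.
  apply: (@supertiles_locate_add _ n y) => //; first by rewrite -mE.
  - exact: le_lt_trans qc (tend_gt _).
  - exact: lt_le_trans (tend_gt _) qd.
exists m, q; split => //.
- by rewrite mE; apply: mem_supertiles_trans qp.
- by apply: le_trans qc; rewrite {1}mE exprD -mulrA ler_pM2l.
- by apply: le_trans qd _; rewrite {2}mE exprD -mulrA ler_pM2l.
Qed.

Lemma coincide_refl x c d : x.1 <= c -> c < d -> d <= tend x -> coincide x x c d.
Proof.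
move=> xc cd dx.
have cd0 : 0 < d - c by lra.
(* The inflated interval is longer than two tiles, so the tile following the one over its left end
   lies inside it. *)
have [n Hn] := exprn_unbounded (2 * ommax omega / (d - c)) lam1.
rewrite ltr_pdivrMr // in Hn.
have l1 := ler_wpM2l (ltW (lamn0 n)) xc.
have l2 := ler_wpM2l (ltW (lamn0 n)) dx.
have [|y yx yr] := @supertiles_cover n x (lam ^+ n * c).
  rewrite l1 /= (lt_le_trans _ l2) // ltr_pM2l //.
have y2 := om_le_ommax y.2.
have ye : tend y = y.1 + omega 0 y.2 by [].
have yy := tend_gt y.
have [|z zx zr] := @supertiles_cover n x (tend y); first by lra.
have z2 := om_le_ommax z.2.
have ze : tend z = z.1 + omega 0 z.2 by [].
have yz : tend y <= z.1.
  rewrite leNgt; apply/negP => zy.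
  have E : y = z.
    apply: (supertiles_disj yx zx) => //; lra.
  by move: zr; rewrite E ltxx andbF.
by exists n, z; split => //; lra.
Qed.

(** A coincidence of the ancestors that sits over the common place of [x'] and [y'] must descend
    from these two tiles, because tiles of a patch are disjoint. *)
Lemma coincide_descend n x y x' y' c d : x' \in supertiles n x -> y' \in supertiles n y ->
  x'.1 <= c -> d <= tend x' -> y'.1 <= c -> d <= tend y' ->
  coincide x y (c / lam ^+ n) (d / lam ^+ n) -> coincide x' y' c d.
Proof.
move=> x'x y'y xc xd yc yd /(@coincide_later n)[m [z [nm zx zy zc zd]]].
have mE : m = ((m - n) + n)%N by rewrite subnK.
have lE a : lam ^+ m * (a / lam ^+ n) = lam ^+ (m - n) * a.
  by rewrite {1}mE exprD -mulrA [lam ^+ n * _]mulrCA divff ?mulr1 // gt_eqF.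
rewrite !lE in zc zd.
have L a b : a <= b -> lam ^+ (m - n) * a <= lam ^+ (m - n) * b.
  by move=> ab; rewrite ler_pM2l.
exists (m - n)%N, z; split => //.
- apply: (supertiles_locate_add x'x); first by rewrite -mE.
  + exact: le_lt_trans (le_trans (L _ _ xc) zc) (tend_gt _).
  + exact: lt_le_trans (tend_gt _) (le_trans zd (L _ _ xd)).
- apply: (supertiles_locate_add y'y); first by rewrite -mE.
  + exact: le_lt_trans (le_trans (L _ _ yc) zc) (tend_gt _).
  + exact: lt_le_trans (tend_gt _) (le_trans zd (L _ _ yd)).
Qed.

End Inflation.

(** * Balanced cuts and the balanced pair algorithm *)

Section Balanced.
Context {k : nat}.
Implicit Types (u v : seq 'I_k).

Lemma balancedP (p : seq 'I_k * seq 'I_k) : balanced p <-> perm_eq p.1 p.2.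
Proof.
split=> [/colP ab|/permP ab].
  by apply/allP => i _; have := ab i; rewrite !mxE => -[/= ->].
by apply/colP => i; rewrite !mxE ab.
Qed.

Definition segment l l' u := take (l' - l) (drop l u).

Lemma take_segment l l' u : (l <= l')%N -> take l' u = take l u ++ segment l l' u.
Proof. by move=> ll; rewrite /segment -takeD subnKC. Qed.

Lemma segment_drop l l' u : (l <= l')%N -> u = take l u ++ segment l l' u ++ drop l' u.
Proof. by move=> ll; rewrite catA -take_segment // cat_take_drop. Qed.

Lemma size_segment l l' u : (l' <= size u)%N -> size (segment l l' u) = (l' - l)%N.
Proof. by move=> lu; rewrite size_takel // size_drop leq_sub2r. Qed.

(** The segment up to the least balanced cut after [l] is irreducible by minimality. Walking from
    cut to cut replaces the factorization into irreducible pairs. *)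
Lemma next_cut u v l : perm_eq u v -> perm_eq (take l u) (take l v) ->
  (l < size u)%N -> exists l', [/\ (l < l' <= size u)%N,
    perm_eq (take l' u) (take l' v) &
    irreducible_factor (segment l l' u, segment l l' v) (u, v)].
Proof.
move=> uv cl lu.
have suv := perm_size uv.
have exP : exists m, (l < m)%N && perm_eq (take m u) (take m v).
  by exists (size u); rewrite lu /= take_size suv take_size.
case: (ex_minnP exP) => m /andP[lm cm] mmin.
have mu : (m <= size u)%N.
  by apply: mmin; rewrite lu /= take_size suv take_size.
have ll := ltnW lm.
have bseg : perm_eq (segment l m u) (segment l m v).
  by rewrite -(perm_cat2l (take l u)) -take_segment // (permPr (_ : perm_eq _ (take m v))) //
    (take_segment v ll) perm_cat2r.
have su : size (segment l m u) = (m - l)%N by rewrite size_segment.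
have sv : size (segment l m v) = (m - l)%N by rewrite size_segment // -suv.
exists m; split; [by rewrite lm| by []|split; last first].
  exists (take l u, take l v), (drop m u, drop m v); split.
  - exact/balancedP.
  - exact/balancedP.
  - apply/balancedP => /=.
    by rewrite -(perm_cat2l (take m u)) (permPl (_ : perm_eq _ u)) ?cat_take_drop //
      (permPr (_ : perm_eq _ v)) // -{2}(cat_take_drop m v) perm_cat2r.
  - by rewrite /pair_mul /= -!take_segment // !cat_take_drop.
split; first exact/balancedP.
  by move=> [sg _]; move: su; rewrite sg /= => /esym/eqP; rewrite subn_eq0 leqNgt lm.
(* a balanced prefix of the segment would be an earlier cut *)
have early w w' r r' : segment l m u = w ++ r -> segment l m v = w' ++ r' ->
    perm_eq w w' -> w = [::] \/ r = [::].
  move=> Eu Ev ww.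
  have [->|w0] := eqVneq w [::]; first by left.
  right; have sw : (0 < size w)%N by rewrite lt0n size_eq0.
  have : (m <= l + size w)%N.
    apply: mmin; rewrite -[X in (X < _)%N]addn0 ltn_add2l sw /=.
    rewrite !takeD -/(segment _ _ _).
    have tu : take (size w) (drop l u) = w.
      have -> : take (size w) (drop l u) = take (size w) (segment l m u).
        rewrite /segment take_takel //.
        by rewrite -su Eu size_cat leq_addr.
      by rewrite Eu take_size_cat.
    have tv : take (size w) (drop l v) = w'.
      have -> : take (size w) (drop l v) = take (size w) (segment l m v).
        rewrite /segment take_takel //.
        by rewrite -sv Ev (perm_size ww) size_cat leq_addr.
      by rewrite Ev take_size_cat // (perm_size ww).
    by rewrite tu tv perm_cat.
  have := su; rewrite Eu size_cat => sE ml.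
  by apply/nilP; rewrite /nilp; apply/eqP; lia.
move=> [q1 q2] [[x1 x2] [[y1 y2] [/balancedP/= bx /balancedP/= bq /balancedP/= bY [Eu Ev]]]].
move: (Eu) (Ev); rewrite -!catA => Eu' Ev'.
have [x10|r0] := early _ _ _ _ Eu' Ev' bx.
  have x20 : x2 = [::] by apply: size0nil; rewrite -(perm_size bx) x10.
  rewrite x10 x20 /= in Eu Ev.
  have [q0|y0] := early _ _ _ _ Eu Ev bq.
    by left; rewrite q0; congr (_, _); apply: size0nil; rewrite -(perm_size bq) q0.
  right; rewrite Eu Ev y0 cats0; congr (_, _).
  have -> : y2 = [::] by apply: size0nil; rewrite -(perm_size bY) y0.
  by rewrite cats0.
left; have [q0 y0] : q1 = [::] /\ y1 = [::] by case: (q1) (y1) r0 => [|? ?] [].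
by rewrite q0; congr (_, _); apply: size0nil; rewrite -(perm_size bq) q0.
Qed.

End Balanced.

Section Swap.
Context {R : realType} {k : nat} (phi : 'I_k -> seq 'I_k) (lam : R)
  (omega : 'rV[R]_k).
Implicit Types (t r s : R) (w u v : seq 'I_k) (x y z : tile R k).

Notation wlen := (wlen omega).
Notation tend := (tend omega).
Notation layout := (layout omega).
Notation subst_iter := (subst_iter phi).
Notation coincide := (coincide phi lam omega).

Hypothesis om0 : forall i, 0 < omega 0 i.
Hypothesis lam1 : 1 < lam.
Hypothesis eig : omega *m map_mx intr (incidence_mx phi) = lam *: omega.

Let lam0 : 0 < lam. Proof. exact: lt_trans lam1. Qed.
Let lamn0 n : 0 < lam ^+ n. Proof. exact: exprn_gt0. Qed.

Lemma wlen_perm u v : perm_eq u v -> wlen u = wlen v.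
Proof. by move=> uv; apply: perm_big. Qed.

Lemma wlen_le_size w : wlen w <= (size w)%:R * ommax omega.
Proof.
elim: w => [|i w IH]; first by rewrite wlen_nil mul0r.
rewrite wlen_cons /= -natr1 mulrDl mul1r addrC lerD //.
exact: le_ommax.
Qed.

Lemma bpa_factors_bound p : finite_set (bpa_factors phi p) ->
  exists B, forall q, bpa_factors phi p q -> (size q.1 <= B)%N.
Proof.
move=> /finite_seqP[s sE]; exists (\max_(q <- s) size q.1) => q.
by rewrite sE /= => qs; apply: leq_bigmax_seq.
Qed.

(** Irreducible factors have bounded length, so a sufficiently inflated interval contains a whole
    one. Its coincidence is a common tile, since the two prefixes before it are balanced and thus
    equally long. *)
Lemma terminates_common_tile u v c d : perm_eq u v ->
  terminates_with_coincidence phi (u, v) ->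
  0 <= c -> c < d -> d <= wlen u ->
  exists n z, [/\ z \in layout 0 (subst_iter n u), z \in layout 0 (subst_iter n v),
    lam ^+ n * c <= z.1 & tend z <= lam ^+ n * d].
Proof.
move=> uv [/bpa_factors_bound[B HB] coin] c0 cd du.
have cd0 : 0 < d - c by lra.
(* Room for two factors: one may straddle the left end, the next one then lies inside. *)
have [n Hn] := exprn_unbounded (2 * B%:R * ommax omega / (d - c)) lam1.
rewrite ltr_pdivrMr // in Hn.
set U := subst_iter n u; set V := subst_iter n v; set X := lam ^+ n * c.
have UV : perm_eq U V.
  have : perm_eq u v by [].
  rewrite /U /V; elim: (n) => //= m IH /IH h.
  by rewrite /extend_subst; apply: perm_flatten; apply: perm_map.
have wU : wlen U = lam ^+ n * wlen u by rewrite (wlen_subst_iter eig).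
have dU : lam ^+ n * d <= wlen U by rewrite wU ler_pM2l.
pose P l := [&& (l <= size U)%N, perm_eq (take l U) (take l V) & wlen (take l U) <= X].
have P0 : exists l, P l.
  by exists 0%N; rewrite /P !take0 /= wlen_nil mulr_ge0 // ltW.
have Pb l : P l -> (l <= size U)%N by move=> /and3P[].
(* [l0] is the last cut not to the right of the interval's left end; the factor between the next two
   cuts [l1] and [l2] is the one used. *)
case: (ex_maxnP P0 Pb) => l0 /and3P[l0U cut0 pos0] max0.
have l0lt : (l0 < size U)%N.
  rewrite ltn_neqAle l0U andbT; apply/eqP => l0E.
  by move: pos0; rewrite l0E take_size /X leNgt (lt_le_trans _ dU) // ltr_pM2l.
have bnd l l' : perm_eq (take l U) (take l V) ->
    irreducible_factor (segment l l' U, segment l l' V) (U, V) ->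
    wlen (segment l l' U) <= B%:R * ommax omega.
  move=> _ irr; apply: le_trans (wlen_le_size _) _.
  have om_ge0 : 0 <= ommax omega by apply: sumr_ge0 => i _; exact: ltW.
  by rewrite ler_wpM2r // ler_nat (HB (segment l l' U, segment l l' V)) //; exists n.
have [l1 [/andP[l01 l1U] cut1 irr1]] := next_cut UV cut0 l0lt.
have pos1 : wlen (take l1 U) <= X + B%:R * ommax omega.
  by rewrite (take_segment _ (ltnW l01)) wlen_cat lerD // (bnd _ _ cut0).
have pos1' : X < wlen (take l1 U).
  rewrite ltNge; apply/negP => p1.
  have := max0 l1; rewrite /P l1U cut1 p1 leqNgt l01 => /(_ isT).
  by [].
have l1lt : (l1 < size U)%N.
  rewrite ltn_neqAle l1U andbT; apply/eqP => l1E.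
  move: pos1; rewrite l1E take_size; apply/negP; rewrite -ltNge.
  apply: lt_le_trans dU; rewrite /X; move: Hn.
  have : 0 <= B%:R * ommax omega.
    by rewrite mulr_ge0 // sumr_ge0 // => i _; exact: ltW.
  by lra.
have [l2 [/andP[l12 l2U] cut2 irr2]] := next_cut UV cut1 l1lt.
have pos2 : wlen (take l2 U) <= lam ^+ n * d.
  rewrite (take_segment _ (ltnW l12)) wlen_cat; move: Hn.
  by have := bnd _ _ cut1 irr2; rewrite /X in pos1; lra.
have [n' [i [[l l'] [[r r'] [/balancedP/= bl _ _ [E1 E2]]]]]] :
    exists n', has_coincidence (pair_iter phi n' (segment l1 l2 U, segment l1 l2 V)).
  by apply: coin; exists n.
pose z : tile R k := (lam ^+ n' * wlen (take l1 U) + wlen l, i).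
have zU W ll rr : subst_iter n' (segment l1 l2 W) = (ll ++ [:: i]) ++ rr ->
    wlen (take l1 W) = wlen (take l1 U) -> wlen ll = wlen l ->
    z \in layout 0 (subst_iter n' W).
  move=> E EU El; apply/mem_layout.
  exists (subst_iter n' (take l1 W) ++ ll), (rr ++ subst_iter n' (drop l2 W)).
  split; last by rewrite wlen_cat (wlen_subst_iter eig) // EU El add0r.
  by rewrite {1}(segment_drop W (ltnW l12)) !subst_iter_cat E -!catA.
have seg2 : lam ^+ n' * wlen (segment l1 l2 U) = wlen l + (omega 0 i + wlen r).
  by rewrite -(wlen_subst_iter eig) /subst_iter E1 !wlen_cat wlen_cons wlen_nil addr0 addrA.
exists (n' + n)%N, z; rewrite !subst_iter_add; split.
- exact: zU E1 _ _.
- apply: zU E2 _ _; first exact/esym/wlen_perm.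
  exact/esym/wlen_perm.
- rewrite exprD -mulrA -/X /z /=.
  rewrite ler_wpDr ?wlen_ge0 // ler_pM2l //; exact: ltW.
- rewrite exprD -mulrA; apply: (@le_trans _ _ (lam ^+ n' * wlen (take l2 U))).
    rewrite (take_segment _ (ltnW l12)) wlen_cat mulrDr seg2 /tend /z /=.
    by have := wlen_ge0 om0 r; lra.
  by rewrite ler_pM2l.
Qed.

Lemma terminates_coincide u v x y c d : perm_eq u v ->
  terminates_with_coincidence phi (u, v) ->
  x \in layout 0 u -> y \in layout 0 v -> c < d ->
  x.1 <= c -> d <= tend x -> y.1 <= c -> d <= tend y -> coincide x y c d.
Proof.
move=> uv term xu yv cd xc dx yc dy.
have [x0 x1] := layout_bounds om0 xu.
rewrite add0r in x1.
have [n [z [zu zv zc zd]]] := terminates_common_tile uv term (le_trans x0 xc) cd (le_trans dx x1).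
have L s t : s <= t -> lam ^+ n * s <= lam ^+ n * t by move=> st; rewrite ler_pM2l.
have zz : z.1 < tend z by rewrite ltrDl.
exists n, z; split => //.
- apply: (supertiles_locate om0 lam1 eig xu); first by rewrite mulr0.
  + exact: le_lt_trans (le_trans (L _ _ xc) zc) zz.
  + exact: lt_le_trans zz (le_trans zd (L _ _ dx)).
- apply: (supertiles_locate om0 lam1 eig yv); first by rewrite mulr0.
  + exact: le_lt_trans (le_trans (L _ _ yc) zc) zz.
  + exact: lt_le_trans zz (le_trans zd (L _ _ dy)).
Qed.

End Swap.

(** * Dense subgroups of the line *)

(** If no positive element of the group were below [eps], one within [eps] of the infimum of the
    positive elements would divide all of them, as a nonzero remainder would give a difference below
    [eps]; then [al] and [be] would be commensurable. *)
Lemma two_generated_dense (R : realType) (al be : R) : 0 < al -> 0 < be ->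
  (forall p q : int, p%:~R * al = q%:~R * be -> p = 0) ->
  forall eps : R, 0 < eps -> exists p q : int, 0 < p%:~R * al + q%:~R * be < eps.
Proof.
move=> al0 be0 ind eps e0; apply/not_existsP => H.
pose E := [set x : R | 0 < x /\ exists p q : int, x = p%:~R * al + q%:~R * be].
have Eal : E al by split=> //; exists 1, 0; rewrite mul1r mul0r addr0.
have Ebe : E be by split=> //; exists 0, 1; rewrite mul1r mul0r add0r.
have infE : has_inf E by split; [exists al|exists 0 => x [/ltW]].
have [x [x0 [p [q xE]]] xe] := inf_adherent e0 infE.
have mult y : E y -> exists n : int, y = n%:~R * x.
  move=> Ey; exists (Num.floor (y / x)).
  have [y0 [p' [q' yE]]] := Ey.
  set n := Num.floor _.
  have /andP[n1 n2] : (n%:~R <= y / x < (n + 1)%:~R) by exact: floor_itv.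
  have r0 : 0 <= y - n%:~R * x by rewrite subr_ge0 -ler_pdivlMr.
  have rx : y - n%:~R * x < x.
    by rewrite ltrBlDl -{2}[x]mul1r -mulrDl -ltr_pdivrMr // -[1]/(1%:~R) -intrD.
  move: r0; rewrite le_eqVlt => /orP[/eqP/esym/eqP|r0].
    by rewrite subr_eq0 => /eqP.
  have Er : E (y - n%:~R * x).
    split=> //; exists (p' - n * p), (q' - n * q).
    by rewrite yE xE !intrB !intrM; ring.
  have infr : inf E <= y - n%:~R * x by apply: ge_inf => //; case: infE.
  case: (H (p - (p' - n * p))); exists (q - (q' - n * q)).
  have -> : (p - (p' - n * p))%:~R * al + (q - (q' - n * q))%:~R * be =
      x - (y - n%:~R * x) by rewrite yE {1}xE xE !intrB !intrM; ring.
  by apply/andP; split; lra.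
have [n nE] := mult _ Eal; have [m mE] := mult _ Ebe.
have m0 : m = 0 by apply: (ind m n); rewrite nE mE; ring.
by move: be0; rewrite mE m0 mul0r ltxx.
Qed.

Section DenseGroup.
Context {R : realType} (J : R -> Prop).
Hypothesis JB : forall x y, J x -> J y -> J (x - y).
Hypothesis Jsmall : forall eps, 0 < eps -> exists2 g, J g & 0 < g < eps.

Lemma group_mulz g (n : int) : J g -> J (n%:~R * g).
Proof.
move=> Jg.
have J0 : J 0 by rewrite -(subrr g); exact: JB.
have JN x : J x -> J (- x) by rewrite -sub0r; exact: JB.
have Jn m : J (m%:R * g).
  elim: m => [|m IH]; first by rewrite mul0r.
  by rewrite -natr1 mulrDl mul1r -[g in _ + g]opprK; apply/JB => //; exact: JN.
case: n => m; first exact: Jn.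
by rewrite NegzE mulrNz mulNr; apply: JN; exact: Jn.
Qed.

Lemma dense_group_approx x eps : 0 < eps -> exists2 g, J g & x - eps < g <= x.
Proof.
move=> e0; have [g Jg /andP[g0 ge]] := Jsmall e0.
exists ((Num.floor (x / g))%:~R * g); first exact: group_mulz.
have /andP[n1 n2] : ((Num.floor (x / g))%:~R <= x / g < (Num.floor (x / g) + 1)%:~R).
  exact: floor_itv.
rewrite ler_pdivlMr // in n1; rewrite ltr_pdivrMr // in n2.
by rewrite n1 andbT; move: n2; rewrite intrD mulrDl mul1r; lra.
Qed.

End DenseGroup.

(** * Translations under which tiles agree *)

Section Agreement.
Context {R : realType} {k : nat} (phi : 'I_k -> seq 'I_k) (lam : R)
  (omega : 'rV[R]_k).
Implicit Types (t r s g h : R) (w u v : seq 'I_k) (x y z : tile R k).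

Notation tend := (tend omega).
Notation subst_iter := (subst_iter phi).
Notation supertiles := (supertiles phi lam omega).
Notation coincide := (coincide phi lam omega).
Notation dense_coincide := (dense_coincide phi lam omega).

Hypothesis om0 : forall i, 0 < omega 0 i.
Hypothesis lam1 : 1 < lam.
Hypothesis eig : omega *m map_mx intr (incidence_mx phi) = lam *: omega.

Let lam0 : 0 < lam. Proof. exact: lt_trans lam1. Qed.
Let lamn0 n : 0 < lam ^+ n. Proof. exact: exprn_gt0. Qed.

(** This is vacuous for tiles that do not overlap, which is why agreements can be composed only over
    a common interval. *)
Definition agree x y := forall c d, c < d ->
  x.1 <= c -> d <= tend x -> y.1 <= c -> d <= tend y -> coincide x y c d.

Lemma agree_sym x y : agree x y -> agree y x.
Proof. by move=> A c d cd xc dx yc dy; apply: coincide_sym; apply: A. Qed.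

Lemma agree_shift s x y : agree x y -> agree (shift_tile s x) (shift_tile s y).
Proof.
move=> A c d cd xc dx yc dy; rewrite -(subrK s c) -(subrK s d).
by apply: coincide_shift => //; apply: A; move: xc dx yc dy; rewrite /tend /=; lra.
Qed.

Lemma agree_dense x y c d : agree x y ->
  x.1 <= c -> d <= tend x -> y.1 <= c -> d <= tend y -> dense_coincide x y c d.
Proof. by move=> A xc dx yc dy c' d' cc cd dd; apply: A => //; lra. Qed.

Lemma agree_descend n i j g : agree (0, i) (g, i) -> j \in subst_iter n [:: i] ->
  agree (0, j) (lam ^+ n * g, j).
Proof.
move=> A ji.
have [t tj] : exists t, (t, j) \in supertiles n (0, i).
  have [u [v Euv]] : exists u v, subst_iter n [:: i] = u ++ j :: v.
    by case/path.splitPr: ji => u v; exists u, v.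
  exists (wlen omega u).
  rewrite /supertiles mulr0; apply/mem_layout.
  by exists u, v; rewrite add0r.
suff : agree (t, j) (t + lam ^+ n * g, j).
  by move=> /(@agree_shift (- t) _ _); rewrite /shift_tile /= subrr addrAC subrr add0r.
move=> c d cd xc dx yc dy.
have tj' : (t + lam ^+ n * g, j) \in supertiles n (g, i).
  rewrite -[(g, i)](_ : shift_tile g (0, i) = _) ?supertiles_shift; last first.
    by rewrite /shift_tile /= add0r.
  by apply/mapP; exists (t, j).
have B1 := supertiles_bounds om0 eig tj.
have B2 := supertiles_bounds om0 eig tj'.
rewrite /tend /= in B1 B2 dx dy xc yc.
have L r : lam ^+ n * (r / lam ^+ n) = r by rewrite mulrCA divff ?mulr1 // gt_eqF.
apply: (coincide_descend om0 lam1 eig tj tj'); rewrite /tend //=.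
apply: A; rewrite /tend /=.
- by rewrite ltr_pM2r ?invr_gt0.
- by rewrite -(ler_pM2l (lamn0 n)) L; lra.
- by rewrite -(ler_pM2l (lamn0 n)) L; lra.
- by rewrite -(ler_pM2l (lamn0 n)) L; lra.
- by rewrite -(ler_pM2l (lamn0 n)) L; lra.
Qed.

(** The three hypotheses are the overlaps between the patches spelled by ab and ba. Over a given
    place, they move a tile of type [b] by [omega 0 a] or by [omega 0 a - omega 0 b]: this is the
    rotation by [omega 0 a] on a circle of length [omega 0 b]. *)
Lemma rotation_agree a b : omega 0 a < omega 0 b ->
  agree (0, a) (0, b) -> agree (omega 0 a, b) (0, b) ->
  agree (omega 0 a, b) (omega 0 b, a) ->
  forall (p q : int) t, agree (t, b) (t + p%:~R * omega 0 a + q%:~R * omega 0 b, b).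
Proof.
move=> ab F1 F2 F3.
have nat_case (p : nat) (q : int) t :
    agree (t, b) (t + p%:R * omega 0 a + q%:~R * omega 0 b, b).
  elim: p q t => [|p IH] q t c d cd /=.
    rewrite mul0r addr0 /tend /= => xc dx yc dy.
    have b0 := om0 b.
    (* Two tiles of type [b] whose distance is a multiple of their length overlap only if they are
       equal. *)
    have q0 : q = 0.
      have : `|q%:~R * omega 0 b| < 1 * omega 0 b by rewrite ltr_norml; lra.
      rewrite normrM (gtr0_norm b0) ltr_pM2r // -intr_norm -[1]/(1%:~R) ltr_int.
      by lia.
    by rewrite q0 mul0r addr0; apply: coincide_refl.
  move=> xc dx yc dy.
  have a0 := om0 a; have b0 := om0 b.
  rewrite /tend /= in dx dy.
  (* One half of the interval lies entirely on one side of the break point [t + omega 0 a], and a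
     coincidence over that half is enough. *)
  have [mid|mid] := leP (t + omega 0 a) ((c + d) / 2).
    apply: (@coincide_widen _ _ _ _ _ lam1 _ _ ((c + d) / 2) d); [lra|lra|].
    apply: (@dense_coincideE _ _ _ _ _ _ _ _ _ _); last lra.
    apply: (@dense_coincide_trans _ _ _ _ _ om0 lam1 eig _ (t + omega 0 a, b)).
      have := @agree_shift t _ _ F2; rewrite /shift_tile/= add0r addrC => /agree_sym A.
      by apply: agree_dense => //; rewrite /tend /=; lra.
    apply: agree_dense; rewrite /tend /=; [|lra..].
    have := IH q (t + omega 0 a).
    by rewrite -natr1 mulrDl mul1r [in X in _ -> X]addrA [in X in _ -> X]addrAC.
  apply: (@coincide_widen _ _ _ _ _ lam1 _ _ c ((c + d) / 2)); [lra|lra|].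
  apply: (@dense_coincideE _ _ _ _ _ _ _ _ _ _); last lra.
  apply: (@dense_coincide_trans _ _ _ _ _ om0 lam1 eig _ (t, a)).
    have := @agree_shift t _ _ F1; rewrite /shift_tile/= add0r => /agree_sym A.
    by apply: agree_dense => //; rewrite /tend /=; lra.
  apply: (@dense_coincide_trans _ _ _ _ _ om0 lam1 eig _ (t + omega 0 a - omega 0 b, b)).
    have := @agree_shift (t - omega 0 b) _ _ F3; rewrite /shift_tile/=.
    rewrite [omega 0 b + _]addrC subrK addrA [omega 0 a + t]addrC => /agree_sym A.
    by apply: agree_dense => //; rewrite /tend /=; lra.
  apply: agree_dense; rewrite /tend /=; [|lra..].
  have := IH (q + 1) (t + omega 0 a - omega 0 b).
  rewrite -natr1 intrD.
  by congr (agree _ (_, _)); lra.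
move=> [p|p] q t; first exact: nat_case.
(* For negative [p] the translation is read backwards, starting from the other tile. *)
rewrite NegzE; set y := (t + _ + _, b); apply: agree_sym.
have -> : (t, b) = (y.1 + p.+1%:R * omega 0 a + (- q)%:~R * omega 0 b, b).
  by rewrite /y /= !mulrNz /intmul; congr (_, _); ring.
exact: nat_case.
Qed.

End Agreement.

Section GoodGroup.
Context {R : realType} {k : nat} (phi : 'I_k -> seq 'I_k) (lam : R)
  (omega : 'rV[R]_k).
Implicit Types (t r s g h : R) (w u v : seq 'I_k) (x y z : tile R k).

Notation tend := (tend omega).
Notation subst_iter := (subst_iter phi).
Notation supertiles := (supertiles phi lam omega).
Notation coincide := (coincide phi lam omega).
Notation dense_coincide := (dense_coincide phi lam omega).
Notation agree := (agree phi lam omega).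

Hypothesis om0 : forall i, 0 < omega 0 i.
Hypothesis lam1 : 1 < lam.
Hypothesis eig : omega *m map_mx intr (incidence_mx phi) = lam *: omega.

Let lam0 : 0 < lam. Proof. exact: lt_trans lam1. Qed.
Let lamn0 n : 0 < lam ^+ n. Proof. exact: exprn_gt0. Qed.

Definition good g := forall i, agree (0, i) (g, i).

Lemma good_at g t i : good g -> agree (t, i) (t + g, i).
Proof.
move=> /(_ i) A; have := @agree_shift _ _ _ _ _ t _ _ A.
by rewrite /shift_tile /= add0r addrC.
Qed.

Lemma good_dense g p q i c d : good g -> q = p + g ->
  p <= c -> d <= p + omega 0 i -> q <= c -> d <= q + omega 0 i ->
  dense_coincide (p, i) (q, i) c d.
Proof. by move=> gg -> *; apply: agree_dense => //; exact: good_at. Qed.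

(* A translate by [h1 + h2] is reached through short translations, alternately
   in [J2] and [J1], that keep all intermediate tiles over a given short
   interval. *)
Lemma good_sum (J1 J2 : R -> Prop) :
  (forall g h, J1 g -> J1 h -> J1 (g - h)) ->
  (forall g h, J2 g -> J2 h -> J2 (g - h)) ->
  (forall eps, 0 < eps -> exists2 g, J1 g & 0 < g < eps) ->
  (forall eps, 0 < eps -> exists2 g, J2 g & 0 < g < eps) ->
  (forall g, J1 g -> good g) -> (forall g, J2 g -> good g) ->
  forall h1 h2, J1 h1 -> J2 h2 -> good (h1 + h2).
Proof.
move=> B1 B2 S1 S2 G1 G2 h1 h2 J1h J2h i.
have w0 := om0 i; set w := omega 0 i in w0.
(* If [d - c] is at most [4 * del], half the tile length, the left ends of tiles covering [[c, d]]
   fill an interval with half-width at least [2 * del], so a move by [del] from near its centre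
   stays admissible. *)
pose del := w / 8.
have del0 : 0 < del by rewrite /del; lra.
have wE : w = 8 * del by rewrite /del; lra.
have recenter p c d : c < d -> d - c <= 4 * del -> p <= c -> d <= p + w ->
    exists g, [/\ J2 g, (d - w + c) / 2 - del < p + g <= (d - w + c) / 2 &
      dense_coincide (p, i) (p + g, i) c d].
  move=> cd dc pc dp; have [g J2g /andP[ga gb]] :=
    dense_group_approx B2 S2 ((d - w + c) / 2 - p) del0.
  exists g; split => //; first lra.
  by apply: (good_dense (G2 _ J2g)) => //; rewrite -/w; lra.
have base g1 g2 p c d : J1 g1 -> J2 g2 -> `|g1| <= del ->
    c < d -> d - c <= 4 * del -> p <= c -> d <= p + w ->
    p + (g1 + g2) <= c -> d <= p + (g1 + g2) + w ->
    dense_coincide (p, i) (p + (g1 + g2), i) c d.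
  move=> Jg1 Jg2 + cd dc pc dp qc dq; rewrite ler_norml => /andP[ha hb].
  have [g [J2g /andP[ga gb] D1]] := recenter _ _ _ cd dc pc dp.
  apply: (dense_coincide_trans om0 lam1 eig D1).
  apply: (@dense_coincide_trans _ _ _ _ _ om0 lam1 eig _ (p + g + g1, i)).
    by apply: (good_dense (G1 _ Jg1)) => //; rewrite -/w; lra.
  by apply: (good_dense (G2 _ (B2 _ _ Jg2 J2g))); rewrite -/w; lra.
(* Each round recentres the tile by an element of [J2] and then moves it by an element of [J1] of
   size between [del / 2] and [del] towards [g1]; the number of rounds is bounded by [n]. *)
have claim n : forall g1 g2 p c d, J1 g1 -> J2 g2 -> `|g1| <= del + n%:R * (del / 2) ->
    c < d -> d - c <= 4 * del -> p <= c -> d <= p + w ->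
    p + (g1 + g2) <= c -> d <= p + (g1 + g2) + w ->
    dense_coincide (p, i) (p + (g1 + g2), i) c d.
  elim: n => [|n IH] g1 g2 p c d Jg1 Jg2 hn cd dc pc dp qc dq.
    by apply: base => //; rewrite mul0r addr0 in hn.
  have [hd|hd] := leP `|g1| del; first exact: base.
  have [g [J2g /andP[ga gb] D1]] := recenter _ _ _ cd dc pc dp.
  apply: (dense_coincide_trans om0 lam1 eig D1).
  have [u0 J1u0 /andP[ua ub]] : exists2 u, J1 u & del - del / 2 < u <= del.
    by apply: dense_group_approx => //; lra.
  have [u J1u [ur hu]] : exists2 u, J1 u &
      - del <= u <= del /\ `|g1 - u| <= del + n%:R * (del / 2).
    rewrite -natr1 in hn; move: hd hn; case: (ger0P g1) => g10 hd hn.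
      by exists u0 => //; split; [lra|rewrite ler_norml; lra].
    (* This is [- u0], written so that closure under differences applies. *)
    exists (u0 - u0 - u0); first exact: (B1 _ _ (B1 _ _ J1u0 J1u0) J1u0).
    by split; [lra|rewrite ler_norml; lra].
  apply: (@dense_coincide_trans _ _ _ _ _ om0 lam1 eig _ (p + g + u, i)).
    by apply: (good_dense (G1 _ J1u)) => //; rewrite -/w; lra.
  have E : p + (g1 + g2) = p + g + u + ((g1 - u) + (g2 - g)) by ring.
  by rewrite E; apply: IH => //; [exact: B1|exact: B2|lra..].
move=> c d cd; rewrite /tend /= -/w => xc dx yc dy.
(* A coincidence over an initial piece of length at most [4 * del] is enough. *)
pose e := Num.min d (c + 4 * del).
have [ed ec ce] : [/\ e <= d, e <= c + 4 * del & c < e].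
  by rewrite /e ge_min lexx ge_min lexx orbT lt_min cd; split => //; lra.
apply: (@coincide_widen _ _ _ _ _ lam1 _ _ c e) => //.
apply: (@dense_coincideE _ _ _ _ _ _ _ _ _ _) => //.
rewrite -[h1 + h2]add0r.
apply: (claim (Num.bound (`|h1| / (del / 2)))) => //; [|lra..].
have := unstable.ltr_bound (`|h1| / (del / 2)).
by rewrite ltr_pdivrMr; lra.
Qed.

Context (a b : 'I_k) (N : nat).
Hypothesis ab_letters : forall j, j \in subst_iter N [:: b].
Hypothesis all_letters : forall j, exists i, j \in phi i.
Hypothesis ab_agree : forall p q : int,
  agree (0, b) (p%:~R * omega 0 a + q%:~R * omega 0 b, b).
Hypothesis ab_small : forall eps : R, 0 < eps ->
  exists p q : int, 0 < p%:~R * omega 0 a + q%:~R * omega 0 b < eps.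

(** The factor [lam ^+ N] is the price of passing from the letter [b] to all letters, which occur in
    its [N]-th inflation. *)
Definition translates0 g := exists p q : int,
  g = lam ^+ N * (p%:~R * omega 0 a + q%:~R * omega 0 b).

(* [translates n] is the sum of the groups [lam^j translates0] with [j <= n]. *)
Fixpoint translates n g := if n is m.+1 then
  exists h g0, [/\ translates m h, translates0 g0 & g = lam * h + g0]
  else translates0 g.

Lemma translates0_sub g h : translates0 g -> translates0 h -> translates0 (g - h).
Proof.
move=> [p [q ->]] [p' [q' ->]]; exists (p - p'), (q - q').
by rewrite !intrB; ring.
Qed.

Lemma translates_sub n g h : translates n g -> translates n h -> translates n (g - h).
Proof.
elim: n g h => [|n IH] g h; first exact: translates0_sub.
move=> [g1 [g0 [G1 G0 ->]]] [h1 [h0 [H1 H0 ->]]].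
exists (g1 - h1), (g0 - h0); split; [exact: IH|exact: translates0_sub|ring].
Qed.

Lemma translates_0 n g : translates n g -> translates n 0.
Proof. by move=> tg; rewrite -(subrr g); exact: translates_sub. Qed.

Lemma translates0_small eps : 0 < eps -> exists2 g, translates0 g & 0 < g < eps.
Proof.
move=> e0; have [|p [q H]] := @ab_small (eps / lam ^+ N); first by rewrite divr_gt0.
exists (lam ^+ N * (p%:~R * omega 0 a + q%:~R * omega 0 b)); first by exists p, q.
by case/andP: H => h1 h2; rewrite mulr_gt0 //= mulrC -ltr_pdivlMr.
Qed.

Lemma translates0_in n g : translates0 g -> translates n g.
Proof.
elim: n g => // n IH g tg; exists 0, g; split => //; last by rewrite mulr0 add0r.
exact: (translates_0 (IH _ tg)).
Qed.

Lemma translates_small n eps : 0 < eps -> exists2 g, translates n g & 0 < g < eps.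
Proof.
by move=> /translates0_small[g tg ge]; exists g; first exact: translates0_in.
Qed.

Lemma translates0_good g : translates0 g -> good g.
Proof. by move=> [p [q ->]] i; exact: (agree_descend om0 lam1 eig (@ab_agree p q)).
Qed.

(** Every letter occurs in the inflation of some letter, and inflating multiplies the distance of
    two tiles by [lam]. *)
Lemma good_scale g : good g -> good (lam * g).
Proof.
move=> gg j; have [i ji] := all_letters j.
rewrite -[lam]expr1; apply: (agree_descend om0 lam1 eig (gg i)).
by rewrite /= /extend_subst /= cats0.
Qed.

Lemma translates_good n g : translates n g -> good g.
Proof.
elim: n g => [|n IH] g; first exact: translates0_good.
move=> [h [g0 [th tg0 ->]]].
refine (@good_sum (fun s => exists2 r, translates n r & s = lam * r) translates0
  _ _ _ _ _ _ _ _ _ _) => //.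
- move=> x y [x' tx ->] [y' ty ->]; exists (x' - y'); last by rewrite mulrBr.
  exact: translates_sub.
- exact: translates0_sub.
- move=> eps e0; have [|y ty /andP[y0 ye]] := @translates_small n (eps / lam).
    by rewrite divr_gt0.
  exists (lam * y); first by exists y.
  by rewrite mulr_gt0 //= mulrC -ltr_pdivlMr.
- exact: translates0_small.
- by move=> x [y ty ->]; apply: good_scale; exact: IH.
- exact: translates0_good.
- by exists h.
Qed.

(** The union is taken because it is a group that is stable under multiplication by [lam], which no
    single [translates n] need be. *)
Definition translation g := exists n, translates n g.

Lemma translates_le m n g : translates m g -> translates (n + m) g.
Proof.
move=> tg; elim: n => // n.
have step p : forall g, translates p g -> translates p.+1 g.
  elim: p => [|p IH] {tg}g.
    by move=> tg; apply: translates0_in.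
  move=> [h [g0 [th tg0 ->]]]; exists h, g0; split => //.
  exact: IH.
exact: step.
Qed.

Lemma translation_sub g h : translation g -> translation h -> translation (g - h).
Proof.
move=> [m tg] [n th]; exists (n + m)%N.
by apply: translates_sub; [|rewrite addnC]; exact: translates_le.
Qed.

Lemma translation_small eps : 0 < eps -> exists2 g, translation g & 0 < g < eps.
Proof.
by move=> /translates0_small[g tg ge]; exists g => //; exists 0%N.
Qed.

Lemma translation_scale n g : translation g -> translation (lam ^+ n * g).
Proof.
move=> tg; elim: n => [|n [m IH]]; first by rewrite mul1r.
exists m.+1, (lam ^+ n * g), 0; split => //; last by rewrite addr0 exprS mulrA.
by exists 0, 0; rewrite !mul0r addr0 mulr0.
Qed.

Lemma translation_good g : translation g -> good g.
Proof. by move=> [n]; exact: translates_good. Qed.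

(* Approximate [g] by [lam^p h]: the copy of the supertile shifted by [lam^p h]
   agrees with the original because [h] is good, and with the one shifted by [g]
   because the difference is good. *)
Lemma supertile_translation_agree p i x y g : x \in supertiles p (0, i) ->
  y \in supertiles p (0, i) -> translation g -> agree x (shift_tile g y).
Proof.
move=> xp yp tg c d cd xc dx yc dy.
rewrite /tend /= in dx dy yc.
(* [lam ^+ p * h] falls short of [g] by less than half the length of [[c, d]], so [y] shifted by it
   still covers the left half of that interval. *)
have [|h th /andP[h1 h2]] := dense_group_approx translation_sub translation_small
    (g / lam ^+ p) (_ : 0 < (d - c) / 2 / lam ^+ p).
  by rewrite divr_gt0 //; lra.
rewrite ler_pdivlMr // [h * _]mulrC in h2.
rewrite -mulrBl ltr_pdivrMr // [h * _]mulrC in h1.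
set h' := lam ^+ p * h in h1 h2.
apply: (@coincide_widen _ _ _ _ _ lam1 _ _ c ((c + d) / 2)); [lra|lra|].
apply: (@dense_coincideE _ _ _ _ _ _ _ _ _ _); last lra.
apply: (@dense_coincide_trans _ _ _ _ _ om0 lam1 eig _ (shift_tile h' y)).
  have yp' : shift_tile h' y \in supertiles p (h, i).
    have -> : (h, i) = shift_tile h (0, i) by rewrite /shift_tile /= add0r.
    by rewrite supertiles_shift; apply: map_f.
  move=> c' d' cc cd' dd.
  apply: (coincide_descend om0 lam1 eig xp yp'); rewrite /tend /=; [lra..|].
  have B1 := supertiles_bounds om0 eig xp.
  have B2 := supertiles_bounds om0 eig yp'.
  rewrite /tend /= in B1 B2.
  have h'E : h' = lam ^+ p * h by [].
  have L r : lam ^+ p * (r / lam ^+ p) = r by rewrite mulrCA divff ?mulr1 // gt_eqF.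
  apply: (translation_good th); rewrite /tend /=.
  - by rewrite ltr_pM2r ?invr_gt0.
  - by rewrite -(ler_pM2l (lamn0 p)) L; lra.
  - by rewrite -(ler_pM2l (lamn0 p)) L; lra.
  - by rewrite -(ler_pM2l (lamn0 p)) L; lra.
  - by rewrite -(ler_pM2l (lamn0 p)) L; lra.
have tgh : translation (g - h').
  by apply: translation_sub => //; exact: translation_scale.
rewrite [y]surjective_pairing.
by apply: (good_dense (translation_good tgh)) => /=; lra.
Qed.

End GoodGroup.

(** * Linear algebra of the incidence matrix *)

Lemma irreducible_rat_separable (p : {poly rat}) :
  irreducible_poly p -> separable_poly p.
Proof.
move=> irr; rewrite unlock irreducible_poly_coprime //.
have sp : (1 < size p)%N by case: irr.
have p0 : p != 0 by rewrite -size_poly_gt0 ltnW.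
have d0 : p^`() != 0.
  apply/eqP => /polyP/(_ (size p).-2); rewrite coef_deriv coef0.
  have -> : (size p).-2.+1 = (size p).-1 by case: (size p) sp => [|[]].
  move=> /eqP; rewrite mulrn_eq0 -lead_coefE lead_coef_eq0 (negbTE p0) orbF.
  by case: (size p) sp => [|[]].
by apply/negP => /(dvdp_leq d0); rewrite leqNgt lt_size_deriv.
Qed.

Lemma irreducible_common_root (F : fieldType) (f : {rmorphism rat -> F})
    (p q : {poly rat}) (x : F) : irreducible_poly p -> irreducible_poly q ->
  p \is monic -> q \is monic ->
  root (map_poly f p) x -> root (map_poly f q) x -> p = q.
Proof.
move=> ip iq mp mq px qx.
suff pq r s : irreducible_poly r -> root (map_poly f r) x -> root (map_poly f s) x ->
    r %| s.
  by apply/eqP; rewrite -eqp_monic // /eqp !pq.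
move=> ir rx sx; apply/negPn; rewrite -irreducible_poly_coprime //.
apply/negP => /Bezout_eq1_coprimepP[[u v] /= uv].
have : (map_poly f 1).[x] = 0.
  by rewrite -uv rmorphD !rmorphM !hornerE (rootP rx) (rootP sx) !mulr0 addr0.
by rewrite rmorph1 hornerE => /eqP; rewrite oner_eq0.
Qed.

Section Cyclic.
Context (n' : nat).
Let n := n'.+1.
Context (M : 'M[int]_n).
Let Mq : 'M[rat]_n := map_mx intr M.
Hypothesis irr : irreducible_poly (char_poly Mq).

Definition iter_mx j (v : 'cV[int]_n) : 'cV[int]_n := iter j (mulmx M) v.

Lemma map_iter_mx (F : comNzRingType) j (v : 'cV[int]_n) :
  map_mx intr (iter_mx j v) = (map_mx intr M : 'M[F]_n) ^+ j *m map_mx intr v.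
Proof.
elim: j => [|j IH]; first by rewrite mul1mx.
by rewrite /= map_mxM IH mulmxA exprS.
Qed.

Definition krylov (v : 'cV[int]_n) : 'M[int]_n := \matrix_(i, j) iter_mx j v i 0.

(** A linear relation between the iterates is a polynomial of degree below [n] that annihilates [v].
    It is coprime to the irreducible characteristic polynomial, so Bezout and Cayley-Hamilton give
    [v = 0]. *)
Lemma krylov_unit (F : numFieldType) (v : 'cV[int]_n) :
  v != 0 -> map_mx intr (krylov v) \in @unitmx F n.
Proof.
move=> v0.
(* Irreducibility is available over Q; invertibility then transfers to [F]. *)
suff Ku : map_mx intr (krylov v) \in @unitmx rat n.
  have -> : map_mx intr (krylov v) = map_mx (@ratr F) (map_mx intr (krylov v)).
    by apply/matrixP => i j; rewrite !mxE ratr_int.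
  by rewrite map_unitmx.
rewrite -unitmx_tr -row_free_unit; apply: inj_row_free => c cK.
pose q : {poly rat} := \sum_(j < n) c 0 j *: 'X^j.
have qv : horner_mx Mq q *m map_mx intr v = 0.
  rewrite /q linear_sum mulmx_suml /=.
  apply/colP => i; rewrite summxE [RHS]mxE; have /rowP/(_ i) := cK; rewrite !mxE => cKi; rewrite -[RHS]cKi.
  apply: eq_bigr => j _.
  rewrite linearZ /= rmorphXn /= horner_mx_X -scalemxAl -map_iter_mx.
  by rewrite !mxE.
have qE (j : 'I_n) : q`_j = c 0 j.
  rewrite /q coef_sum (bigD1 j) //= coefZ coefXn eqxx mulr1 big1 ?addr0 // => i ij.
  by rewrite coefZ coefXn eq_sym (inj_eq val_inj) (negbTE ij) mulr0.
have sq : (size q <= n)%N.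
  apply: (leq_trans (size_sum _ _ _)); apply/bigmax_leqP => j _.
  by apply: leq_trans (size_scale_leq _ _) _; rewrite size_polyXn.
have [q0|q0] := eqVneq q 0.
  by apply/rowP => j; rewrite -qE q0 coef0 mxE.
have : coprimep (char_poly Mq) q.
  rewrite irreducible_poly_coprime //; apply/negP => /dvdp_leq -/(_ q0).
  by rewrite size_char_poly leqNgt ltnS sq.
move=> /Bezout_eq1_coprimepP[[u w] /= uw].
have : horner_mx Mq 1 *m map_mx intr v = 0.
  rewrite -uw rmorphD !rmorphM /= Cayley_Hamilton mulr0 add0r.
  by rewrite -[_ * _]/(_ *m _) -mulmxA qv mulmx0.
rewrite rmorph1 mul1mx => vq0; case/negP: v0; apply/eqP/colP => i.
have /colP/(_ i) := vq0; rewrite !mxE => /eqP.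
by rewrite intr_eq0 => /eqP.
Qed.

(** Being an eigenvector, [u] vanishes on all iterates of [v] once it vanishes on [v], and these
    iterates form a basis. *)
Lemma left_eigen_eq0 (F : numFieldType) (u : 'rV[F]_n) (l : F) (v : 'cV[int]_n) :
  u *m map_mx intr M = l *: u -> v != 0 -> u *m map_mx intr v = 0 -> u = 0.
Proof.
move=> ul v0 uv.
have Ku := krylov_unit F v0.
suff uK : u *m map_mx intr (krylov v) = 0.
  by rewrite -[u](mulmxK Ku) uK mul0mx.
have uj j : u *m map_mx intr M ^+ j = l ^+ j *: u.
  elim: j => [|j IH]; first by rewrite mulmx1 scale1r.
  by rewrite exprSr mulmxA IH -scalemxAl ul scalerA exprSr.
apply/rowP => j.
have -> : (u *m map_mx intr (krylov v)) 0 j = (u *m map_mx intr (iter_mx j v)) 0 0.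
  by rewrite !mxE; apply: eq_bigr => i _; rewrite !mxE.
by rewrite map_iter_mx mulmxA uj -scalemxAl uv scaler0 !mxE.
Qed.

End Cyclic.

Lemma normc_lt1 (R : realType) (z : R[i]) : `|z| < 1 -> ComplexField.Normc.normc z < 1.
Proof. by rewrite -ltcR. Qed.

(* In the coordinates [P], the matrix acts diagonally, contracting all coordinates
   but [i0], which records positions. The real combination with coefficients [c]
   of the iterates of [v] is the eigenvector for [lam] above position [1]. *)
Lemma Pisot_splitting (R : realType) (k : nat) (phi : 'I_k -> seq 'I_k)
    (lam : R) (omega : 'rV[R]_k) (v : 'cV[int]_k) :
  irreducible_poly (char_poly (map_mx intr (incidence_mx phi) : 'M[rat]_k)) ->
  Pisot_number lam -> positive_left_eigenvector phi lam omega -> v != 0 ->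
  let M := incidence_mx phi in
  let iota := map_mx intr : 'cV[int]_k -> 'cV[R[i]]_k in
  let pos := fun z : 'cV[int]_k => \sum_i omega 0 i * (z i 0)%:~R in
  exists (P : 'M[R[i]]_k) (d : 'I_k -> R[i]) (i0 : 'I_k) (s : R[i]) (c : 'I_k -> R),
  [/\ P \in unitmx,
      forall z i, (P *m iota (M *m z)) i 0 = d i * (P *m iota z) i 0,
      forall i, i != i0 -> ComplexField.Normc.normc (d i) < 1,
      forall z, (P *m iota z) i0 0 = s * (pos z)%:C%C &
      (forall i, i != i0 ->
        \sum_j (c j)%:C%C * (P *m iota (iter j (mulmx M) v)) i 0 = 0) /\
      \sum_j c j * pos (iter j (mulmx M) v) = 1].
Proof.
case: k phi omega v => [|n'] phi omega v.
  by move=> _ _ _ /negP; case; apply/eqP/colP; case.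
move=> irr [lam1 [p [pmon pirr proot pconj]]] [om0 eig] v0 M iota pos.
pose C : numClosedFieldType := R[i].
set Mq := map_mx intr M : 'M[rat]_n'.+1 in irr *.
pose MR := map_mx intr M : 'M[R]_n'.+1.
pose MC := map_mx intr M : 'M[C]_n'.+1.
have MCq : MC = map_mx ratr Mq by apply/matrixP => i j; rewrite !mxE ratr_int.
have MRq : MR = map_mx ratr Mq by apply/matrixP => i j; rewrite !mxE ratr_int.
have om_neq0 : omega != 0.
  by apply/eqP => /rowP/(_ ord0); rewrite mxE => h; have := om0 ord0; rewrite h ltxx.
have chiR : root (map_poly ratr (char_poly Mq)) lam.
  rewrite map_char_poly /= -MRq -eigenvalue_root_char; apply/eigenvalueP.
  by exists omega.
(* Two monic irreducible polynomials with the common root [lam] are equal; so all eigenvalues other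
   than [lam] are subject to the Pisot bound. *)
have pE : char_poly Mq = map_poly intr p.
  apply: (irreducible_common_root (f := @ratr R)) chiR _ => //.
  - exact: char_poly_monic.
  - exact: monic_map.
  - rewrite -map_poly_comp (eq_map_poly (g := intr)) // => z /=.
    by rewrite ratr_int.
have chiC : char_poly MC = map_poly intr p.
  rewrite MCq -map_char_poly pE -map_poly_comp; apply: eq_map_poly => z /=.
  by rewrite ratr_int.
have [P0 P0u /(diagonalizable_forPex)[D PD]] : diagonalizable MC.
  apply/diagonalizableP.
  have [rs rsE] := closed_field_poly_normal (char_poly MC).
  rewrite (monicP (char_poly_monic _)) scale1r in rsE.
  exists rs; last by rewrite -rsE; exact: mxminpoly_dvd_char.
  rewrite -separable_prod_XsubC -rsE MCq -map_char_poly separable_map.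
  exact: irreducible_rat_separable.
have {}PD : P0 *m MC = diag_mx D *m P0 by apply/(simmxP P0u).
have rowP0 i : row i P0 *m MC = D 0 i *: row i P0.
  by apply/rowP => j; rewrite -row_mul PD mul_diag_mx !mxE.
have rowP0_neq0 i : row i P0 != 0.
  apply/eqP => r0; have := P0u; rewrite -row_free_unit -kermx_eq0 => /eqP/matrixP K.
  have : (delta_mx 0 i : 'rV[C]_n'.+1) *m P0 = 0 by rewrite -rowE.
  move=> /eqP; rewrite mulmx_free_eq0 ?row_free_unit //.
  by move=> /eqP/rowP/(_ i); rewrite !mxE !eqxx => /eqP; rewrite oner_eq0.
have rowv i : row i P0 *m iota v != 0.
  apply: contra (rowP0_neq0 i) => /eqP r0; apply/eqP.
  exact: (left_eigen_eq0 irr (rowP0 i) v0 r0).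
have D_root i : root (map_poly intr p) (D 0 i).
  rewrite -chiC -eigenvalue_root_char; apply/eigenvalueP.
  by exists (row i P0).
(* Two independent rows with the same eigenvalue would have a nonzero combination vanishing on [v],
   against [left_eigen_eq0]. *)
have D_inj i j : D 0 i = D 0 j -> i = j.
  move=> Dij; apply/eqP/negPn/negP => ij.
  pose w := (row j P0 *m iota v) 0 0 *: (delta_mx 0 i : 'rV[C]_n'.+1)
     - (row i P0 *m iota v) 0 0 *: delta_mx 0 j.
  have wP : w *m P0 = (row j P0 *m iota v) 0 0 *: row i P0
     - (row i P0 *m iota v) 0 0 *: row j P0.
    by rewrite /w mulmxBl -!scalemxAl -!rowE.
  have w0 : w = 0.
    apply/eqP; rewrite -(mulmx_free_eq0 _ (_ : row_free P0)) ?row_free_unit //.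
    rewrite wP; apply/eqP; apply: (left_eigen_eq0 irr (l := D 0 i) _ v0).
      by rewrite mulmxBl -!scalemxAl !rowP0 -Dij scalerBr !scalerA ![D 0 i * _]mulrC.
    apply/rowP => l; rewrite ord1 mulmxBl -!scalemxAl !mxE.
    by rewrite mulrC subrr.
  have key (x y : C) : x *: (delta_mx 0 i : 'rV[C]_n'.+1) - y *: delta_mx 0 j = 0 ->
      x = 0.
    move=> /rowP/(_ i); rewrite !mxE !eqxx (negbTE ij) mulr1 mulr0 subr0.
    exact.
  case/negP: (rowv j); apply/eqP/rowP => l; rewrite ord1 (key _ _ w0).
  by rewrite mxE.
(* Since the eigenvalues are distinct, expanding [omega] in the rows of [P0] leaves a single row. *)
have [i0 [s [s0 Di0 omP]]] : exists i0 s, [/\ s != 0, D 0 i0 = lam%:C%C &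
    row i0 P0 = s *: map_mx (fun x => x%:C%C) omega].
  pose omC : 'rV[C]_n'.+1 := map_mx (fun x => x%:C%C) omega.
  have omC_eig : omC *m MC = lam%:C%C *: omC.
    have -> : MC = map_mx (fun x => x%:C%C) MR.
      by apply/matrixP => i j; rewrite !mxE rmorph_int.
    by rewrite -map_mxM /= eig map_mxZ.
  have [x xP] : exists x : 'rV[C]_n'.+1, x *m P0 = omC.
    by exists (omC *m invmx P0); rewrite mulmxKV.
  have xD : x *m diag_mx D = lam%:C%C *: x.
    apply: (can_inj (mulmxK P0u)).
    by rewrite -mulmxA -PD mulmxA xP omC_eig -scalemxAl xP.
  have xi i : x 0 i * D 0 i = lam%:C%C * x 0 i.
    by have /rowP/(_ i) := xD; rewrite mul_mx_diag !mxE.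
  have omC0 : omC != 0.
    apply: contra om_neq0 => /eqP/rowP o0; apply/eqP/rowP => i.
    by have := o0 i; rewrite !mxE => -[].
  have [i0 xi0] : exists i0, x 0 i0 != 0.
    apply/not_existsP => x0; case/eqP: omC0.
    rewrite -xP; suff -> : x = 0 by rewrite mul0mx.
    by apply/rowP => i; rewrite [RHS]mxE; apply/eqP/negPn/negP; exact: x0.
  have Di0 : D 0 i0 = lam%:C%C.
    by apply: (mulfI xi0); rewrite xi mulrC.
  exists i0, (x 0 i0)^-1; split => //; first by rewrite invr_eq0.
  have -> : map_mx (fun x => x%:C%C) omega = x 0 i0 *: row i0 P0.
    have xE : x = x 0 i0 *: delta_mx 0 i0.
      apply/rowP => i; rewrite !mxE eqxx /=.
      have [->|ii0] := eqVneq i i0; first by rewrite mulr1.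
      rewrite mulr0; apply/eqP/negPn/negP => xi_neq0.
      case/eqP: ii0; apply: D_inj; rewrite Di0.
      by apply: (mulfI xi_neq0); rewrite xi mulrC.
    by rewrite -/omC -xP {1}xE -scalemxAl -rowE.
  by rewrite scalerA mulVf // scale1r.
have posE z : (omega *m map_mx intr z) 0 0 = pos z.
  by rewrite mxE; apply: eq_bigr => i _; rewrite mxE.
have [e [e0 eE]] : exists e : 'cV[R]_n'.+1, e != 0 /\ MR *m e = lam *: e.
  have : \det (lam%:M - MR)^T == 0.
    rewrite det_tr; apply/det0P; exists omega => //.
    by rewrite mulmxBr eig mul_mx_scalar subrr.
  move=> /det0P[u u0 uM]; exists u^T; split.
    by rewrite -trmx_eq0 trmxK.
  apply/eqP; rewrite -subr_eq0 -oppr_eq0 opprB -mul_scalar_mx -mulmxBl.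
  by rewrite -trmx_eq0 trmx_mul trmxK uM.
(* Left and right eigenvectors for different eigenvalues are orthogonal, so the right eigenvector
   [e] has no contracted coordinates. *)
pose eC : 'cV[C]_n'.+1 := map_mx (fun x => x%:C%C) e.
have PeC i : i != i0 -> (P0 *m eC) i 0 = 0.
  move=> ii0.
  have : P0 *m (MC *m eC) = diag_mx D *m (P0 *m eC) by rewrite mulmxA PD mulmxA.
  have -> : MC *m eC = lam%:C%C *: eC.
    have -> : MC = map_mx (fun x => x%:C%C) MR.
      by apply/matrixP => l j; rewrite !mxE rmorph_int.
    by rewrite -map_mxM /= eE map_mxZ.
  rewrite -scalemxAr mul_diag_mx => /colP/(_ i); rewrite [LHS]mxE [RHS]mxE.
  move=> /eqP; rewrite -subr_eq0 -mulrBl mulf_eq0 subr_eq0 -Di0.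
  by case/orP => /eqP // /D_inj ii; rewrite ii eqxx in ii0.
have ome : (omega *m e) 0 0 != 0.
  apply/eqP => oe0.
  have PeC0 : P0 *m eC = 0.
    apply/colP => i; rewrite [RHS]mxE; have [->|] := eqVneq i i0; last exact: PeC.
    have -> : (P0 *m eC) i0 0 = (row i0 P0 *m eC) 0 0 by rewrite -row_mul !mxE.
    rewrite omP -scalemxAl -map_mxM mxE.
    by rewrite [X in _ * X]mxE oe0 mulr0.
  case/eqP: e0; have : eC = 0 by rewrite -(mulKmx P0u eC) PeC0 mulmx0.
  move=> /colP eC0; apply/colP => i.
  by have := eC0 i; rewrite !mxE => -[].
(* Normalized to position 1; the coefficients [c] are its coordinates in the basis of iterates of
   [v]. *)
pose e1 := ((omega *m e) 0 0)^-1 *: e.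
have KR := krylov_unit irr R v0.
pose c := invmx (map_mx intr (krylov M v)) *m e1.
have cE : \sum_j c j 0 *: map_mx intr (iter j (mulmx M) v) = e1.
  rewrite -(mulKVmx KR e1) -/c; apply/colP => i.
  rewrite summxE mxE; apply: eq_bigr => j _; rewrite !mxE.
  by rewrite mulrC.
have Mv z i : (P0 *m iota (M *m z)) i 0 = D 0 i * (P0 *m iota z) i 0.
  rewrite /iota map_mxM mulmxA -/MC PD -mulmxA mul_diag_mx.
  by rewrite mxE.
exists P0, (fun i => D 0 i), i0, s, (fun j => c j 0); split => //.
- move=> i ii0; apply: normc_lt1; apply: pconj; first exact: D_root.
  by rewrite -Di0; apply: contra ii0 => /eqP/D_inj ->.
- move=> z.
  have -> : (P0 *m iota z) i0 0 = (row i0 P0 *m iota z) 0 0 by rewrite -row_mul !mxE.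
  have -> : iota z = map_mx (fun x => x%:C%C) (map_mx intr z : 'cV[R]_n'.+1).
    by apply/colP => i; rewrite !mxE rmorph_int.
  by rewrite omP -scalemxAl -map_mxM mxE -posE [X in _ * X]mxE.
- split.
    move=> i ii0.
    transitivity ((P0 *m map_mx (fun x => x%:C%C) e1) i 0); last first.
      by rewrite map_mxZ -scalemxAr mxE PeC // mulr0.
    have -> : map_mx (fun x => x%:C%C) e1 =
        \sum_j (c j 0)%:C%C *: iota (iter j (mulmx M) v).
      apply/colP => l; rewrite -cE mxE !summxE rmorph_sum; apply: eq_bigr => j _.
      by rewrite !mxE rmorphM /= rmorph_int.
    rewrite mulmx_sumr summxE; apply: eq_bigr => j _.
    by rewrite -scalemxAr [RHS]mxE.
  transitivity ((omega *m e1) 0 0); last by rewrite -scalemxAr mxE mulVf.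
  rewrite -cE mulmx_sumr summxE; apply: eq_bigr => j _.
  by rewrite -posE -scalemxAr [RHS]mxE.
Qed.

(** Needed because [Pisot_subst] asserts the existence of its own eigenvalue, which has to be
    identified with the given [lam]. *)
Lemma PF_eigenvalue_uniq (R : realType) (k : nat) (phi : 'I_k -> seq 'I_k)
    (l l' : R) : PF_eigenvalue phi l -> PF_eigenvalue phi l' -> l = l'.
Proof.
have eigC (x : R) : eigenvalue (map_mx intr (incidence_mx phi) : 'M[R]_k) x ->
    eigenvalue (map_mx intr (incidence_mx phi) : 'M[R[i]]_k) x%:C%C.
  rewrite !eigenvalue_root_char => rx.
  have -> : map_mx intr (incidence_mx phi) =
      map_mx (fun x => x%:C%C) (map_mx intr (incidence_mx phi) : 'M[R]_k).
    by apply/matrixP => i j; rewrite !mxE rmorph_int.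
  by rewrite -map_char_poly; apply/rootP; rewrite horner_map (rootP rx) rmorph0.
move=> [l0 le ldom] [l'0 l'e l'dom]; apply/eqP/negPn/negP => ll.
have := ldom _ (eigC _ l'e); have := l'dom _ (eigC _ le).
rewrite !(inj_eq (@complexI R)) ll eq_sym ll => /(_ isT) h1 /(_ isT) h2.
move: h1 h2; rewrite !ger0_norm ?lecR ?ler0c ?ltW // !ltcR => h1 h2.
by have := lt_trans h1 h2; rewrite ltxx.
Qed.

(** * Decay of the discrepancy *)

Section OverlapLength.
Context {R : realType}.
Implicit Types a b c d : R.

(** The length of the intersection of [[a, b]] and [[c, d]], as a formula open to case analysis by
    linear arithmetic. *)
Definition meet_length a b c d : R := Num.max 0 (Num.min b d - Num.max a c).

Lemma meet_length_ge0 a b c d : 0 <= meet_length a b c d.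
Proof. by rewrite le_max lexx. Qed.

Lemma meet_lengthC a b c d : meet_length a b c d = meet_length c d a b.
Proof. by rewrite /meet_length minC [Num.max a c]maxC. Qed.

Lemma meet_length_cat a b c d e : c <= d -> d <= e -> a <= b ->
  meet_length a b c d + meet_length a b d e = meet_length a b c e.
Proof.
rewrite /meet_length !maxEle !minEle => cd de ab.
by do ?case: ifP => /=; lra.
Qed.

Lemma meet_length_scale l a b c d : 0 < l ->
  meet_length (l * a) (l * b) (l * c) (l * d) = l * meet_length a b c d.
Proof.
move=> l0; rewrite /meet_length -minr_pMr ?ltW // -maxr_pMr ?ltW //.
by rewrite -mulrBr -{1}[0](mulr0 l) -maxr_pMr ?ltW.
Qed.

Lemma meet_length_gt0 a b c d : (0 < meet_length a b c d) ->
  [/\ a < d, c < b, a < b & c < d].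
Proof.
rewrite /meet_length lt_max ltxx /= subr_gt0 lt_min !gt_max.
by move=> /andP[/andP[? ?] /andP[? ?]].
Qed.

Lemma meet_length_id a b : a <= b -> meet_length a b a b = b - a.
Proof. by rewrite /meet_length minxx maxxx maxEle subr_ge0 => ->. Qed.

Lemma meet_length_le a b c d : a <= b -> meet_length a b c d <= b - a.
Proof.
rewrite /meet_length !maxEle !minEle => ab.
by do ?case: ifP => /=; lra.
Qed.

Lemma meet_length_sub a b c d : a <= c -> c <= d -> d <= b ->
  meet_length a b c d = d - c.
Proof.
rewrite /meet_length !maxEle !minEle => ac cd db.
by do ?case: ifP => /=; lra.
Qed.

End OverlapLength.

Section Discrepancy.
Context {R : realType} {k : nat} (phi : 'I_k -> seq 'I_k) (lam : R)
  (omega : 'rV[R]_k).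
Implicit Types (t r s : R) (w u v : seq 'I_k) (x y : tile R k).

Notation wlen := (wlen omega).
Notation tend := (tend omega).
Notation supertiles := (supertiles phi lam omega).

Hypothesis om0 : forall i, 0 < omega 0 i.
Hypothesis lam1 : 1 < lam.
Hypothesis eig : omega *m map_mx intr (incidence_mx phi) = lam *: omega.

Let lam0 : 0 < lam. Proof. exact: lt_trans lam1. Qed.
Let lamn0 n : 0 < lam ^+ n. Proof. exact: exprn_gt0. Qed.

Definition overlap x y : R := meet_length x.1 (tend x) y.1 (tend y).

Lemma overlap_ge0 x y : 0 <= overlap x y. Proof. exact: meet_length_ge0. Qed.

Let tend_ge x : x.1 <= tend x.
Proof. by rewrite lerDl ltW. Qed.

Lemma overlap_id x : overlap x x = omega 0 x.2.
Proof. by rewrite /overlap meet_length_id // /tend addrC addKr. Qed.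

Lemma overlap_le x y : overlap x y <= omega 0 x.2.
Proof.
by apply: le_trans (meet_length_le _ _ (tend_ge x)) _; rewrite /tend addrC addKr.
Qed.

Lemma sum_overlap_layout a b t w : a <= b ->
  \sum_(y <- layout omega t w) meet_length a b y.1 (tend y) =
  meet_length a b t (t + wlen w).
Proof.
move=> ab; elim: w t => [|i w IH] t.
  rewrite big_nil wlen_nil addr0 /meet_length.
  by rewrite !maxEle !minEle; do ?case: ifP => /=; lra.
rewrite big_cons IH /tend /= wlen_cons addrA meet_length_cat //.
- by rewrite lerDl ltW.
- by rewrite lerDl wlen_ge0.
Qed.

Lemma sum_overlap_supertiles n x y :
  \sum_(x' <- supertiles n x) \sum_(y' <- supertiles n y) overlap x' y' =
  lam ^+ n * overlap x y.
Proof.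
have E a b z : a <= b -> \sum_(z' <- supertiles n z) meet_length a b z'.1 (tend z') =
    meet_length a b (lam ^+ n * z.1) (lam ^+ n * tend z).
  move=> ab; rewrite sum_overlap_layout // (wlen_subst_iter eig).
  by rewrite wlen_cons wlen_nil addr0 -mulrDr.
under eq_bigr => x' _.
  rewrite /overlap E // meet_lengthC.
  over.
rewrite E; last by rewrite ler_pM2l.
by rewrite meet_length_scale // meet_lengthC.
Qed.

(** The total length, within the inflated overlap of [x] and [y], of the places where the two
    inflated patches carry different tiles. *)
Definition discrepancy n x y : R :=
  \sum_(x' <- supertiles n x) \sum_(y' <- supertiles n y | x' != y') overlap x' y'.

Lemma discrepancy_ge0 n x y : 0 <= discrepancy n x y.
Proof. by apply: sumr_ge0 => x' _; apply: sumr_ge0 => y' _; exact: overlap_ge0. Qed.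

Lemma discrepancyE n x y : discrepancy n x y = lam ^+ n * overlap x y -
  \sum_(x' <- supertiles n x) \sum_(y' <- supertiles n y | x' == y') overlap x' y'.
Proof.
rewrite -sum_overlap_supertiles -sumrB; apply: eq_bigr => x' _.
rewrite [X in _ = X - _](bigID (fun y' => x' == y')) /= [X in X - _]addrC addrK.
by [].
Qed.

Lemma discrepancy_le n x y : discrepancy n x y <= lam ^+ n * overlap x y.
Proof.
rewrite discrepancyE gerBl sumr_ge0 // => x' _.
by apply: sumr_ge0 => y' _; exact: overlap_ge0.
Qed.

Lemma discrepancy_id n x : discrepancy n x x = 0.
Proof.
rewrite /discrepancy big_seq_cond big1 // => x' /andP[xx _].
rewrite big_seq_cond big1 // => y' /andP[yx ne].
apply/eqP/negPn/negP => ov0.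
have /meet_length_gt0[h1 h2 _ _] : 0 < overlap x' y'.
  by rewrite lt_neqAle overlap_ge0 eq_sym ov0.
by case/eqP: ne; apply: (supertiles_disj om0 xx yx).
Qed.

(** Tiles that coincide at level [n] coincide for ever, so only the disagreeing pairs have to be
    inflated further. *)
Lemma discrepancy_add m n x y : discrepancy (m + n) x y =
  \sum_(x' <- supertiles n x) \sum_(y' <- supertiles n y | x' != y') discrepancy m x' y'.
Proof.
rewrite {1}/discrepancy (supertiles_add eig) big_flatten big_map.
apply: eq_bigr => x' _.
transitivity (\sum_(y' <- supertiles n y) discrepancy m x' y'); last first.
  rewrite (bigID (fun y' => x' == y')) /= big1 ?add0r // => y' /eqP <-.
  exact: discrepancy_id.
rewrite /discrepancy exchange_big /=; apply: eq_bigr => x'' _.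
by rewrite (supertiles_add eig) big_flatten big_map.
Qed.

Lemma discrepancy_overlap0 n x y : overlap x y = 0 -> discrepancy n x y = 0.
Proof.
move=> ov0; apply: le_anti; rewrite discrepancy_ge0 andbT.
by rewrite (le_trans (discrepancy_le _ _ _)) // ov0 mulr0.
Qed.

Lemma discrepancy_coincidence n x y z : z \in supertiles n x ->
  z \in supertiles n y -> discrepancy n x y <= lam ^+ n * overlap x y - omega 0 z.2.
Proof.
move=> zx zy; rewrite discrepancyE lerB // (big_rem z) //=.
rewrite (big_rem z zy) /= eqxx overlap_id -addrA lerDl addr_ge0 //.
  by apply: sumr_ge0 => y' _; exact: overlap_ge0.
by apply: sumr_ge0 => x' _; apply: sumr_ge0 => y' _; exact: overlap_ge0.
Qed.

(** A positive lower bound of the tile lengths that needs no minimum over a possibly empty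
    alphabet. *)
Definition ommin : R := (\sum_i (omega 0 i)^-1)^-1.

Lemma ommin_gt0 (i : 'I_k) : 0 < ommin.
Proof.
rewrite invr_gt0 (bigD1 i) //= ltr_pwDl ?invr_gt0 //.
by apply: sumr_ge0 => j _; rewrite invr_ge0 ltW.
Qed.

Lemma ommin_le i : ommin <= omega 0 i.
Proof.
rewrite -[omega 0 i]invrK lef_pV2 ?posrE ?invr_gt0 //; last first.
  by rewrite -invr_gt0; exact: ommin_gt0 i.
rewrite (bigD1 i) //= lerDl.
by apply: sumr_ge0 => j _; rewrite invr_ge0 ltW.
Qed.

(** Every [n0] inflations remove at least a fixed proportion of each disagreeing overlap. The
    disagreeing pairs remain legal, so the proportion left decays geometrically. *)
Lemma discrepancy_decay (legal : tile R k -> tile R k -> Prop) (n0 : nat) :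
  (forall x y n x' y', legal x y -> x' \in supertiles n x -> y' \in supertiles n y ->
    legal x' y') ->
  (forall x y, legal x y -> 0 < overlap x y ->
    exists2 z, z \in supertiles n0 x & z \in supertiles n0 y) ->
  forall eps, 0 < eps -> exists n, forall x y, legal x y ->
    discrepancy n x y <= eps * (lam ^+ n * overlap x y).
Proof.
move=> stable coin eps e0.
have [[i _]|noi] := pselect (exists i : 'I_k, true); last first.
  by exists 0%N => x; case: noi; exists x.2.
(* A common tile has length at least [ommin] and an overlap at most [ommax omega], so one
   coincidence removes at least the proportion [m]. *)
pose m := ommin / (lam ^+ n0 * ommax omega).
have M0 : 0 < ommax omega.
  by apply: lt_le_trans (om0 i) _; exact: le_ommax.
have m0 : 0 < m.
  by rewrite divr_gt0 ?(ommin_gt0 i) // mulr_gt0.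
(* The second entry keeps [q] positive, so that its inverse can be used. *)
pose q := Num.max (1 - m) (1 / 2).
have q1 : q < 1 by rewrite gt_max; apply/andP; split; lra.
have q0 : 0 < q by rewrite lt_max; apply/orP; right; lra.
have step x y : legal x y -> discrepancy n0 x y <= q * (lam ^+ n0 * overlap x y).
  move=> xy; have [ov0|] := ltP 0 (overlap x y); last first.
    move=> ov; have {}ov : overlap x y = 0.
      by apply: le_anti; rewrite ov overlap_ge0.
    by rewrite discrepancy_overlap0 // ov !mulr0.
  have [z zx zy] := coin _ _ xy ov0.
  apply: le_trans (discrepancy_coincidence zx zy) _.
  apply: (@le_trans _ _ ((1 - m) * (lam ^+ n0 * overlap x y))).
    rewrite mulrBl mul1r lerB // (le_trans _ (ommin_le _)) //.
    have -> : m * (lam ^+ n0 * overlap x y) = ommin * (overlap x y / ommax omega).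
      by rewrite /m; field; rewrite !gt_eqF.
    rewrite ger_pMr ?(ommin_gt0 z.2) //.
    by rewrite ler_pdivrMr // mul1r (le_trans (overlap_le _ _)) // le_ommax.
  by rewrite ler_wpM2r ?mulr_ge0 ?overlap_ge0 ?(ltW (lamn0 n0)) // le_max lexx.
have iter j x y : legal x y ->
    discrepancy (j * n0) x y <= q ^+ j * (lam ^+ (j * n0) * overlap x y).
  elim: j x y => [|j IH] x y xy.
    by rewrite mul1r; exact: discrepancy_le.
  rewrite mulSn addnC discrepancy_add.
  apply: (@le_trans _ _ (q ^+ j * lam ^+ (j * n0) * discrepancy n0 x y)); last first.
    rewrite exprS exprD [q * _]mulrC -!mulrA ler_pM2l ?exprn_gt0 //.
    by rewrite mulrCA ler_pM2l // step.
  rewrite /discrepancy mulr_sumr big_seq_cond [X in _ <= X]big_seq_cond.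
  apply: ler_sum => x' /andP[xx _].
  rewrite mulr_sumr big_seq_cond [X in _ <= X]big_seq_cond.
  apply: ler_sum => y' /andP[yy _].
  by rewrite -mulrA; apply: IH; exact: stable xx yy.
have [j qj] : exists j, q ^+ j < eps.
  have [|j hj] := @exprn_unbounded R q^-1 eps^-1; first by rewrite invf_gt1.
  by exists j; rewrite exprVn ltf_pV2 ?posrE ?exprn_gt0 // in hj.
exists (j * n0)%N => x y xy; apply: le_trans (iter _ _ _ xy) _.
by rewrite ler_wpM2r ?mulr_ge0 ?overlap_ge0 ?(ltW (lamn0 _)) // ltW.
Qed.

End Discrepancy.

Lemma absz_shift_lt (m : int) (B : nat) : `|m| <= B%:Z -> (absz (m + B%:Z)%R < (B + B).+1)%N.
Proof. by lia. Qed.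

Lemma absz_shiftK (m : int) (B : nat) : `|m| <= B%:Z -> (absz (m + B%:Z)%R)%:Z - B%:Z = m.
Proof. by lia. Qed.

(** * Overlaps of bounded type *)

Section LegalOverlaps.
Context {R : realType} {k : nat} (phi : 'I_k -> seq 'I_k) (lam : R)
  (omega : 'rV[R]_k).
Implicit Types (t r : R) (w u v : seq 'I_k) (x y : tile R k) (z : 'cV[int]_k).

Notation wlen := (wlen omega).
Notation tend := (tend omega).
Notation subst_iter := (subst_iter phi).
Notation supertiles := (supertiles phi lam omega).
Notation overlap := (overlap omega).
Notation normc := ComplexField.Normc.normc.
Notation M := (incidence_mx phi).

Hypothesis om0 : forall i, 0 < omega 0 i.
Hypothesis lam1 : 1 < lam.
Hypothesis eig : omega *m map_mx intr (incidence_mx phi) = lam *: omega.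

Let lam0 : 0 < lam. Proof. exact: lt_trans lam1. Qed.
Let lamn0 n : 0 < lam ^+ n. Proof. exact: exprn_gt0. Qed.

Definition pos z : R := \sum_i omega 0 i * (z i 0)%:~R.

Lemma posE z : pos z = (omega *m map_mx intr z) 0 0.
Proof. by rewrite mxE; apply: eq_bigr => i _; rewrite mxE. Qed.

Lemma posD z z' : pos (z + z') = pos z + pos z'.
Proof. by rewrite !posE map_mxD mulmxDr mxE. Qed.

Lemma posB z z' : pos (z - z') = pos z - pos z'.
Proof. by rewrite !posE map_mxB mulmxBr !mxE. Qed.

Lemma posM n z : pos (iter n (mulmx M) z) = lam ^+ n * pos z.
Proof.
elim: n => [|n IH]; first by rewrite mul1r.
rewrite /= posE map_mxM mulmxA eig -scalemxAl mxE -posE IH.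
by rewrite mulrA -exprS.
Qed.

Lemma wlen_pos w : wlen w = pos (abelianization w).
Proof.
by rewrite wlen_count; apply: eq_bigr => i _; rewrite mxE mulrC.
Qed.

Lemma abelianization_cat u v :
  abelianization (u ++ v) = abelianization u + abelianization v :> 'cV_k.
Proof. by apply/colP => i; rewrite !mxE count_cat PoszD. Qed.

Lemma extend_cons j u : extend_subst phi (j :: u) = phi j ++ extend_subst phi u.
Proof. by []. Qed.

Lemma abelianization_extend u :
  abelianization (extend_subst phi u) = M *m abelianization u.
Proof.
elim: u => [|j u IH].
  by apply/colP => i; rewrite !mxE big1 // => l _; rewrite !mxE mulr0.
rewrite extend_cons -cat1s !abelianization_cat IH mulmxDr; congr (_ + _).
apply/colP => i; rewrite !mxE (bigD1 j) //= big1 => [|l lj]; rewrite !mxE /=.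
  by rewrite eqxx addr0 mulr1.
by rewrite eq_sym (negbTE lj) mulr0.
Qed.

Context (P : 'M[R[i]]_k) (d : 'I_k -> R[i]) (i0 : 'I_k) (s : R[i]).
Let coord z i := (P *m map_mx intr z) i 0.
Hypothesis Punit : P \in unitmx.
Hypothesis coordM : forall z i, coord (M *m z) i = d i * coord z i.
Hypothesis d_lt1 : forall i, i != i0 -> normc (d i) < 1.
Hypothesis coord_pos : forall z, coord z i0 = s * (pos z)%:C%C.

Let coordD z z' i : coord (z + z') i = coord z i + coord z' i.
Proof. by rewrite /coord map_mxD mulmxDr mxE. Qed.

Let coordN z i : coord (- z) i = - coord z i.
Proof. by rewrite /coord map_mxN mulmxN mxE. Qed.

Lemma normc_ge0 (c : R[i]) : 0 <= normc c.
Proof. by case: c => a b; exact: sqrtr_ge0. Qed.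

Lemma le_normcB (c c' : R[i]) : normc (c - c') <= normc c + normc c'.
Proof. by rewrite -(normcN c'); exact: le_normcD. Qed.

Let C0 : R := \sum_i \sum_j normc (P i j).

Let coord_word w i : normc (coord (abelianization w) i) <= (size w)%:R * C0.
Proof.
elim: w => [|j w IH].
  have -> : abelianization [::] = 0 :> 'cV[int]_k by apply/colP => l; rewrite !mxE.
  by rewrite /coord map_mx0 mulmx0 mxE mul0r ComplexField.Normc.normc0.
rewrite -cat1s abelianization_cat coordD size_cat natrD mulrDl mul1r.
apply: le_trans (le_normcD _ _) _; rewrite lerD //.
have -> : coord (abelianization [:: j]) i = P i j.
  rewrite /coord mxE (bigD1 j) //= big1 => [|l lj]; rewrite !mxE /=.
    by rewrite eqxx addr0 mulr1.
  by rewrite eq_sym (negbTE lj) mulr0.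
rewrite /C0 (bigD1 i) //= (bigD1 j) //= -addrA lerDl addr_ge0 //.
  by apply: sumr_ge0 => *; exact: normc_ge0.
by apply: sumr_ge0 => *; apply: sumr_ge0 => *; exact: normc_ge0.
Qed.

Let S : nat := \max_i size (phi i).

(** The cut may fall inside the image of one letter, whose initial piece is the rest [u']; this is
    the recursive structure of prefixes of inflated words. *)
Lemma prefix_extend w u v : extend_subst phi w = u ++ v ->
  exists w1 w2 u', [/\ w = w1 ++ w2, u = extend_subst phi w1 ++ u' & (size u' <= S)%N].
Proof.
elim: w u v => [|i w IH] u v.
  by case: u => // _; exists [::], [::], [::].
rewrite extend_cons => E.
have [su|su] := leqP (size u) (size (phi i)).
  by exists [::], (i :: w), u; split => //; apply: leq_trans su (leq_bigmax i).
have Eu : u = phi i ++ drop (size (phi i)) u.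
  rewrite -{1}(cat_take_drop (size (phi i)) u); congr (_ ++ _).
  have := congr1 (take (size (phi i))) E.
  by rewrite take_size_cat // takel_cat // ltnW.
have [w1 [w2 [u' [-> E2 su']]]] : exists w1 w2 u', [/\ w = w1 ++ w2,
    drop (size (phi i)) u = extend_subst phi w1 ++ u' & (size u' <= S)%N].
  apply: (IH _ v); move: E; rewrite {1}Eu -catA => /eqP.
  by rewrite eqseq_cat // => /andP[_ /eqP].
exists (i :: w1), w2, u'; split => //.
by rewrite extend_cons -catA -E2.
Qed.

Let C0_ge0 : 0 <= C0.
Proof. by apply: sumr_ge0 => *; apply: sumr_ge0 => *; exact: normc_ge0. Qed.

(** The fixed point of the recursion in [prefix_coord]: contraction by [d i] plus a bounded rest.
    [S.+1] also covers the words of length at most 1 at level 0. *)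
Let Cpre i : R := (S.+1)%:R * C0 / (1 - normc (d i)).

Lemma prefix_coord p l u v i : i != i0 -> subst_iter p [:: l] = u ++ v ->
  normc (coord (abelianization u) i) <= Cpre i.
Proof.
move=> ii0; have d1 := d_lt1 ii0; have d1' : 0 < 1 - normc (d i) by lra.
have CE : Cpre i * (1 - normc (d i)) = S.+1%:R * C0 by rewrite mulfVK ?gt_eqF.
have base w : (size w <= S.+1)%N -> normc (coord (abelianization w) i) <= S.+1%:R * C0.
  by move=> sw; apply: le_trans (coord_word _ _) _; rewrite ler_wpM2r // ler_nat.
have dge := normc_ge0 (d i).
elim: p u v => [|p IH] u v E.
  have su : (size u <= S.+1)%N.
    by have := congr1 size E; rewrite /= size_cat; lia.
  apply: le_trans (base _ su) _; rewrite -CE ler_piMr //; last lra.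
  by rewrite divr_ge0 ?mulr_ge0 // ltW.
have [w1 [w2 [u' [E1 E2 su']]]] := prefix_extend E.
have IH1 := IH _ _ E1.
rewrite E2 abelianization_cat coordD abelianization_extend coordM.
apply: le_trans (le_normcD _ _) _; rewrite ComplexField.Normc.normcM.
have := base _ (leqW su'); have := ler_wpM2l dge IH1.
by move: CE; rewrite mulrBr mulr1 [Cpre i * _]mulrC; lra.
Qed.

(** Inverting [P] bounds the integer entries themselves; this is where discreteness of the lattice
    turns bounds into finiteness. *)
Lemma bounded_int_vectors (K : 'I_k -> R) : exists B : nat,
  forall z, (forall i, normc (coord z i) <= K i) -> forall l, `|z l 0| <= B%:Z.
Proof.
pose B0 := \sum_l \sum_i normc (invmx P l i) * K i.
exists (Num.bound B0) => z zK l.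
have K0 i : 0 <= K i by apply: le_trans (zK i); exact: normc_ge0.
have zE : map_mx intr z = invmx P *m (P *m map_mx intr z) :> 'cV[R[i]]_k.
  by rewrite mulKmx.
have zlE : (z l 0)%:~R = \sum_i invmx P l i * coord z i :> R[i].
  by have /colP/(_ l) := zE; rewrite mxE => ->; rewrite mxE.
have : normc ((z l 0)%:~R : R[i]) <= B0.
  rewrite zlE.
  apply: (@le_trans _ _ (\sum_i normc (invmx P l i) * K i)).
    elim/big_ind2: _ => [|x1 x2 y1 y2 h1 h2|i _].
    - by rewrite ComplexField.Normc.normc0.
    - by apply: le_trans (le_normcD _ _) _; exact: lerD.
    - by rewrite ComplexField.Normc.normcM ler_wpM2l ?normc_ge0.
  rewrite /B0 [leRHS](bigD1 l) //= lerDl.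
  by apply: sumr_ge0 => j _; apply: sumr_ge0 => i _; rewrite mulr_ge0 ?normc_ge0.
have -> : normc ((z l 0)%:~R : R[i]) = `|(z l 0)%:~R|.
  rewrite -(rmorph_int (real_complex R)) /= expr0n /= addr0.
  exact: sqrtr_sqr.
rewrite -intr_norm => zB.
have := le_lt_trans zB (unstable.ltr_bound B0).
by rewrite -[(Num.bound _)%:R]/((Num.bound B0)%:Z%:~R) ltr_int => /ltW.
Qed.

Context (T : R -> Prop).
Hypothesis T_scale : forall n g, T g -> T (lam ^+ n * g).
Hypothesis T_agree : forall p i x y g, x \in supertiles p (0, i) ->
  y \in supertiles p (0, i) -> T g -> agree phi lam omega x (shift_tile g y).

(** The bound 1 survives inflation because these coordinates are contracted. *)
Definition small_translation z := T (pos z) /\ forall i, i != i0 -> normc (coord z i) <= 1.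

Lemma small_translationM n z : small_translation z ->
  small_translation (iter n (mulmx M) z).
Proof.
move=> [Tz cz]; split=> [|i ii0]; first by rewrite posM; exact: T_scale.
have d1 := d_lt1 ii0; have dge := normc_ge0 (d i).
elim: n => [|n IH] /=; first exact: cz.
by rewrite coordM ComplexField.Normc.normcM mulr_ile1 ?normc_ge0 // ltW.
Qed.

(** Both tiles come from the same supertile, up to the translations [t] and [t + pos z]; so their
    offset is a difference of two prefixes plus [z]. The form is stable under inflation, and the
    tiles may be disjoint. *)
Definition legal x y := exists p l t z x0 y0,
  [/\ x0 \in supertiles p (0, l), y0 \in supertiles p (0, l), small_translation z,
    x = shift_tile t x0 & y = shift_tile (t + pos z) y0].

Lemma legal_stable x y n x' y' : legal x y -> x' \in supertiles n x ->
  y' \in supertiles n y -> legal x' y'.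
Proof.
move=> [p [l [t [z [x0 [y0 [x0p y0p zs -> ->]]]]]]].
rewrite !supertiles_shift => /mapP[x1 x1x ->] /mapP[y1 y1y ->].
exists (n + p)%N, l, (lam ^+ n * t), (iter n (mulmx M) z), x1, y1; split => //.
- exact: (mem_supertiles_trans eig x0p).
- exact: (mem_supertiles_trans eig y0p).
- exact: small_translationM.
- by rewrite posM mulrDr.
Qed.

Lemma legal_coincidence x y : legal x y -> 0 < overlap x y ->
  exists n (z : tile R k), z \in supertiles n x /\ z \in supertiles n y.
Proof.
move=> [p [l [t [z [x0 [y0 [x0p y0p [zT _] -> ->]]]]]]] /meet_length_gt0[h1 h2 _ _].
have A := @agree_shift _ _ _ _ _ t _ _ (T_agree x0p y0p zT).
have yE : shift_tile t (shift_tile (pos z) y0) = shift_tile (t + pos z) y0.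
  by rewrite /shift_tile /=; congr (_, _); ring.
move: A h1 h2; rewrite yE /agree /shift_tile /tend /= => A h1 h2.
have y0l := om0 y0.2; have x0l := om0 x0.2.
have [||||| n [z' [z'x z'y _ _]]] := A (Num.max (x0.1 + t) (y0.1 + (t + pos z)))
    (Num.min (x0.1 + t + omega 0 x0.2) (y0.1 + (t + pos z) + omega 0 y0.2)).
- by rewrite lt_min !gt_max; apply/andP; split; apply/andP; split; lra.
- by rewrite le_max lexx.
- by rewrite ge_min lexx.
- by rewrite le_max; apply/orP; right; lra.
- by rewrite ge_min; apply/orP; right; lra.
by exists n, z'; split.
Qed.

Lemma coincidence_later n m x y : (n <= m)%N ->
  (exists z : tile R k, z \in supertiles n x /\ z \in supertiles n y) ->
  exists z : tile R k, z \in supertiles m x /\ z \in supertiles m y.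
Proof.
move=> nm [z [zx zy]].
have [z' z'z] := supertiles_nonempty om0 lam1 eig (m - n) z.
by exists z'; split; rewrite -(subnK nm); [exact: (mem_supertiles_trans eig zx)|
  exact: (mem_supertiles_trans eig zy)].
Qed.

(* The offset of a legal overlap is the position of an integer vector all of whose
   coordinates are bounded, so that there are finitely many overlaps up to
   translation. *)
Lemma legal_uniform_coincidence : exists n0, forall x y, legal x y ->
  0 < overlap x y -> exists2 z : tile R k, z \in supertiles n0 x & z \in supertiles n0 y.
Proof.
(* Coordinate [i0] is controlled by the distance of overlapping tiles; each other one by 1 for the
   translation and [Cpre i] for either prefix. *)
pose K i := if i == i0 then normc s * ommax omega else 1 + (Cpre i + Cpre i).
have [B HB] := bounded_int_vectors K.
pose vec (f : {ffun 'I_k -> 'I_(B + B).+1}) : 'cV[int]_k := \col_l ((f l)%:Z - B%:Z).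
pose common n (f : {ffun 'I_k -> 'I_(B + B).+1}) (i j : 'I_k) :=
  exists z : tile R k, z \in supertiles n (0, i) /\ z \in supertiles n (pos (vec f), j).
have [N HN] : {N : {ffun 'I_k -> 'I_(B + B).+1} * ('I_k * 'I_k) -> nat &
    forall o n, common n o.1 o.2.1 o.2.2 -> common (N o) o.1 o.2.1 o.2.2}.
  (* A type of overlap that never reaches a coincidence gets level 0, where the implication is
     vacuous. As coincidences persist, the maximum of the levels serves all types. *)
  apply: (@choice _ _ (fun o m => forall n, common n o.1 o.2.1 o.2.2 ->
    common m o.1 o.2.1 o.2.2)) => o.
  have [[n cn]|nn] := pselect (exists n, common n o.1 o.2.1 o.2.2); first by exists n.
  by exists 0%N => n cn; case: nn; exists n.
pose n0 := \max_o N o.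
exists n0 => x y xy ov0.
have [n [z [zx zy]]] := legal_coincidence xy ov0.
move: xy => [p [l [t [v [x0 [y0 [x0p y0p [vT vs] xE yE]]]]]]].
have prefix x1 : x1 \in supertiles p (0, l) ->
    exists2 c : 'cV[int]_k, x1.1 = pos c &
      forall i, i != i0 -> normc (coord c i) <= Cpre i.
  move=> /mem_layout[u [u' [E ->]]]; exists (abelianization u).
    by rewrite mulr0 add0r wlen_pos.
  by move=> i ii0; apply: prefix_coord ii0 E.
have [cx cxE cxb] := prefix _ x0p.
have [cy cyE cyb] := prefix _ y0p.
pose c := v + (cy - cx).
have yx : y.1 - x.1 = pos c.
  by rewrite xE yE /shift_tile /= cxE cyE posD posB; ring.
have cK i : normc (coord c i) <= K i.
  rewrite /K; case: eqVneq => [->|ii0].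
    rewrite coord_pos ComplexField.Normc.normcM ler_wpM2l ?normc_ge0 // -yx.
    have [h1 h2 _ _] := meet_length_gt0 ov0.
    rewrite /= expr0n /= addr0 sqrtr_sqr ler_norml.
    have := le_ommax om0 x.2; have := le_ommax om0 y.2.
    by move: h1 h2; rewrite /tend; lra.
  rewrite /c coordD coordD coordN.
  apply: le_trans (le_normcD _ _) _; rewrite lerD ?vs //.
  by apply: le_trans (le_normcB _ _) _; rewrite lerD ?cyb ?cxb.
have [f fE] : exists f, vec f = c.
  have cB i : (absz (c i 0 + B%:Z)%R < (B + B).+1)%N.
    exact: (absz_shift_lt (HB c cK i)).
  exists [ffun i => Ordinal (cB i)]; apply/colP => i; rewrite mxE ffunE /=.
  exact: (absz_shiftK (HB c cK i)).
have transl m : (exists z : tile R k, z \in supertiles m x /\ z \in supertiles m y) <->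
    common m f x.2 y.2.
  have xS : x = shift_tile x.1 (0, x.2) by rewrite /shift_tile /= add0r -surjective_pairing.
  have yS : y = shift_tile x.1 (pos (vec f), y.2).
    by rewrite /shift_tile /= fE -yx subrK -surjective_pairing.
  have xm : supertiles m x = [seq shift_tile (lam ^+ m * x.1) a | a <- supertiles m (0, x.2)].
    by rewrite {1}xS supertiles_shift.
  have ym : supertiles m y =
      [seq shift_tile (lam ^+ m * x.1) a | a <- supertiles m (pos (vec f), y.2)].
    by rewrite {1}yS supertiles_shift.
  rewrite xm ym; split=> [[z' [/mapP[a aS ->] /mapP[b bS ab]]]|[z' [z'x z'y]]].
    exists a; split => //; suff -> : a = b by [].
    move: ab; rewrite /shift_tile => -[/addIr a1 a2].
    by rewrite [a]surjective_pairing a1 a2 -surjective_pairing.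
  by exists (shift_tile (lam ^+ m * x.1) z'); rewrite !map_f.
have /transl/(HN (f, (x.2, y.2)))/transl :
  exists z : tile R k, z \in supertiles n x /\ z \in supertiles n y by exists z.
move=> /(@coincidence_later _ n0)[|z' [z'x z'y]]; last by exists z'.
exact: leq_bigmax.
Qed.

Lemma legal_discrepancy eps : 0 < eps -> exists n, forall x y, legal x y ->
  discrepancy phi lam omega n x y <= eps * (lam ^+ n * overlap x y).
Proof.
have [n0 H0] := legal_uniform_coincidence.
by apply: (discrepancy_decay om0 lam1 eig _ H0) => x y n x' y'; exact: legal_stable.
Qed.
End LegalOverlaps.

(** * Tilings and their topology *)

Section TilingPatches.
Import numFieldNormedType.Exports.
Context {R : realType} {k : nat} (phi : 'I_k -> seq 'I_k) (lam : R)
  (omega : 'rV[R]_k).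
Implicit Types (t r : R) (w u v : seq 'I_k) (x y : tile R k) (T : tiles omega).

Notation wlen := (wlen omega).
Notation tend := (tend omega).
Notation subst_iter := (subst_iter phi).
Notation supertiles := (supertiles phi lam omega).
Notation layout := (layout omega).

Hypothesis om0 : forall i, 0 < omega 0 i.
Hypothesis lam1 : 1 < lam.
Hypothesis eig : omega *m map_mx intr (incidence_mx phi) = lam *: omega.

Let lam0 : 0 < lam. Proof. exact: lt_trans lam1. Qed.
Let lamn0 n : 0 < lam ^+ n. Proof. exact: exprn_gt0. Qed.

Lemma supertileE m i : supertile phi lam omega m i = [set x | x \in supertiles m (0, i)].
Proof.
rewrite /supertile; elim: m => [|m IH].
  by apply/seteqP; split => x /=; rewrite supertiles0 inE => /eqP.
rewrite /= IH /inflate; apply/seteqP; split => y /=.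
  move=> [x xm yx]; rewrite -add1n (supertiles_add eig); apply/flatten_mapP.
  by exists x => //; rewrite /supertiles expr1 /= /extend_subst /= cats0.
rewrite -add1n (supertiles_add eig) => /flatten_mapP[x xm yx]; exists x => //=.
by move: yx; rewrite /supertiles expr1 /= /extend_subst /= cats0.
Qed.

Lemma translateE T t x : translate T t x <-> T (shift_tile (- t) x).
Proof.
split=> [[y Ty <-]|Tx].
  by rewrite /shift_tile /= addrK -surjective_pairing.
by exists (shift_tile (- t) x) => //; rewrite /shift_tile /= subrK -surjective_pairing.
Qed.

Lemma translateD T s t : translate (translate T s) t = translate T (s + t).
Proof.
apply/seteqP; split => x /translateE.
  by move=> /translateE Tx; apply/translateE; move: Tx; rewrite /shift_tile /= opprD addrA addrAC.
by move=> Tx; do 2!apply/translateE; move: Tx; rewrite /shift_tile /= opprD addrA addrAC.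
Qed.

Lemma translate0 T : translate T 0 = T.
Proof.
by apply/seteqP; split => x; rewrite translateE /shift_tile oppr0 addr0 -surjective_pairing.
Qed.

Lemma tiling_disj T x y : is_tiling T -> T x -> T y ->
  x.1 < tend y -> y.1 < tend x -> x = y.
Proof.
move=> [_ triv] Tx Ty xy yx; apply: triv => //.
have xt := tend_gt om0 x; have yt := tend_gt om0 y.
pose a := Num.max x.1 y.1; pose b := Num.min (tend x) (tend y).
have ab : a < b by rewrite /a /b lt_min !gt_max xt xy yx yt.
have int z : z.1 <= a -> b <= tend z -> (tile_support omega z)^° ((a + b) / 2).
  move=> za bz; suff /(_ ((a + b) / 2)) : `]a, b[ `<=` (tile_support omega z)^°.
    by apply; rewrite /= in_itv /=; apply/andP; split; lra.
  rewrite -open_subsetE; last exact: itv_open.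
  move=> r; rewrite /tile_support /= !in_itv /= => /andP[ar rb].
  by move: bz; rewrite /tend => bz; apply/andP; split; lra.
exists ((a + b) / 2); split; apply: int.
- by rewrite le_max lexx.
- by rewrite ge_min lexx.
- by rewrite le_max lexx orbT.
- by rewrite ge_min lexx orbT.
Qed.

Lemma tiling_cover T r : is_tiling T -> exists2 x, T x & x.1 <= r <= tend x.
Proof.
move=> [cov _]; have : [set: R] r by [].
by rewrite -cov => -[x Tx]; rewrite /tile_support /= in_itv /=; exists x.
Qed.

(** Each cell of length [ommin omega] contains at most one left end of a tile, so the index of the
    cell injects the window into a finite set. *)
Lemma finite_window T A : is_tiling T -> finite_set (window A T).
Proof.
move=> tT; have [[i _]|noi] := pselect (exists i : 'I_k, true); last first.
  rewrite (_ : window A T = set0) //; apply/seteqP; split => // x.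
  by case: noi; exists x.2.
have m0 := ommin_gt0 om0 i; set m := ommin omega in m0.
pose g x := Num.floor ((x.1 + (A + ommax omega)) / m).
have g0 x : window A T x -> (0 <= g x)%R /\ (g x <= Num.floor ((A + (A + ommax omega)) / m))%R.
  move=> [Tx [r []]]; rewrite /tile_support /= !in_itv /= => xr Ar.
  have := le_ommax om0 x.2 => xM; split.
    by rewrite floor_ge0; apply: divr_ge0; [lra|exact: ltW].
  by apply: le_floor; rewrite ler_pdivrMr // mulfVK ?gt_eqF //; lra.
pose f x := absz (g x).
have finj : {in window A T &, injective f}.
  move=> x y /set_mem wx /set_mem wy fxy.
  have [Tx _] := wx; have [Ty _] := wy.
  have gxy : g x = g y by have [? _] := g0 _ wx; have [? _] := g0 _ wy; rewrite /f in fxy; lia.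
  have /andP[x1 x2] := floor_itv ((x.1 + (A + ommax omega)) / m).
  have /andP[y1 y2] := floor_itv ((y.1 + (A + ommax omega)) / m).
  rewrite -/(g _) ler_pdivlMr // in x1; rewrite -/(g _) ler_pdivlMr // in y1.
  rewrite -/(g _) ltr_pdivrMr // in x2; rewrite -/(g _) ltr_pdivrMr // in y2.
  rewrite -gxy in y1 y2; rewrite intrD mulrDl mul1r in x2 y2.
  have := ommin_le om0 x.2; have := ommin_le om0 y.2; rewrite -/m => ym xm.
  by apply: (tiling_disj tT) => //; rewrite /tend; lra.
have fin : finite_set (f @` window A T).
  apply: (@sub_finite_set _ _ `I_(absz (Num.floor ((A + (A + ommax omega)) / m))).+1).
    by move=> _ [x /g0[h1 h2] <-] /=; rewrite /f; lia.
  exact: finite_II.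
by rewrite -(eq_finite_set (inj_card_eq finj)).
Qed.

(** Gives a layout that lists all tiles of [T] over [[- A, A]] from left to right, so that the
    results on lists apply to tilings. *)
Lemma tiling_patch T (A : R) : tiling_space phi lam omega T -> 0 <= A ->
  exists m i t, [/\ t <= - A, A <= t + lam ^+ m * omega 0 i &
    forall r, - A <= r <= A ->
      exists x, [/\ x \in layout t (subst_iter m [:: i]), T x & x.1 <= r < tend x]].
Proof.
move=> [tT pat] A0.
pose B := A + 1.
have [||m [i [t sub]]] := pat (window B T); first exact: finite_window.
  by move=> x [].
set w := subst_iter m [:: i].
have inW x : window B T x -> x \in layout t w.
  move=> /sub /translateE; rewrite supertileE /= /supertiles mulr0 => xw.
  have -> : x = shift_tile t (shift_tile (- t) x).
    by rewrite /shift_tile /= subrK -surjective_pairing.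
  by rewrite -[t in layout t]add0r layout_shift map_f.
have inwin r : - B <= r <= B -> exists x, [/\ x \in layout t w, T x & x.1 <= r <= tend x].
  move=> rB; have [x Tx xr] := tiling_cover r tT; exists x; split => //.
  by apply: inW; split => //; exists r; rewrite /tile_support /= !in_itv.
have B0 : 0 <= B by rewrite /B; lra.
have [x1 [x1w _ /andP[x1l _]]] := inwin (- B) ltac:(lra).
have [x2 [x2w _ /andP[_ x2r]]] := inwin B ltac:(lra).
have [tx1 _] := layout_bounds om0 x1w.
have [_ x2t] := layout_bounds om0 x2w.
have wE : wlen w = lam ^+ m * omega 0 i.
  by rewrite (wlen_subst_iter eig) wlen_cons wlen_nil addr0.
have BE : B = A + 1 by [].
exists m, i, t; split; [lra|by rewrite -wE; lra|].
move=> r rA.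
have [|x xw xr] := @layout_cover _ _ omega t w r; first lra.
exists x; split => //.
(* Coverage by closed tiles may return the left neighbour of [x] at [r]. A place slightly to the
   right of [r] lies inside [x]; the margin 1 in [B] leaves room for it. *)
pose r' := r + Num.min ((tend x - r) / 2) 1.
have [r1 r2 r3] : [/\ r < r', r' <= r + 1 & r' < tend x].
  have h1 : Num.min ((tend x - r) / 2) 1 <= (tend x - r) / 2 by rewrite ge_min lexx.
  have h2 : Num.min ((tend x - r) / 2) 1 <= 1 by rewrite ge_min lexx orbT.
  have h3 : 0 < Num.min ((tend x - r) / 2) 1 by rewrite lt_min; apply/andP; split; lra.
  by rewrite /r'; split; lra.
have [y [yw Ty yr]] := inwin r' ltac:(lra).
suff -> : x = y by [].
by apply: (layout_disj om0 xw yw); lra.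
Qed.
End TilingPatches.

Lemma count_grid (R : realType) (s a b : R) (m : nat) : 0 < s ->
  \sum_(j < m) (a <= j%:R * s < b)%R%:R <= Num.max 0 (b - a) / s + 1 :> R.
Proof.
move=> s0.
(* Strengthened for induction on [m]: only the part of the interval already swept is counted, with a
   cap that allows for the last point before [b]. *)
have H : (\sum_(j < m) (a <= j%:R * s < b)%R%:R) * s <=
    Num.max 0 (Num.min (m%:R * s) (b + s) - a).
  elim: m => [|m IH]; first by rewrite big_ord0 mul0r le_max lexx.
  rewrite big_ord_recr /= mulrDl -natr1 mulrDl mul1r.
  move: IH; set c := \sum_(i < m) _ => IH.
  have [/andP[h1 h2]|_] := boolP (a <= m%:R * s < b).
    rewrite mul1r; move: IH; rewrite !maxEle !minEle.
    by do ?case: ifP => /=; lra.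
  rewrite mul0r addr0; apply: le_trans IH _.
  rewrite !maxEle !minEle.
  by do ?case: ifP => /=; lra.
rewrite -(ler_pM2r s0); apply: le_trans H _.
rewrite mulrDl mulfVK ?gt_eqF // mul1r !maxEle !minEle.
by do ?case: ifP => /=; lra.
Qed.

(** * Counting mismatches along a tiling *)

Section Mismatch.
Context {R : realType} {k : nat} (phi : 'I_k -> seq 'I_k) (lam : R)
  (omega : 'rV[R]_k).
Implicit Types (t r : R) (w u v : seq 'I_k) (x y : tile R k) (T : tiles omega).

Notation wlen := (wlen omega).
Notation tend := (tend omega).
Notation subst_iter := (subst_iter phi).
Notation supertiles := (supertiles phi lam omega).
Notation layout := (layout omega).
Notation overlap := (overlap omega).

Hypothesis om0 : forall i, 0 < omega 0 i.
Hypothesis lam1 : 1 < lam.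
Hypothesis eig : omega *m map_mx intr (incidence_mx phi) = lam *: omega.

Let lam0 : 0 < lam. Proof. exact: lt_trans lam1. Qed.
Let lamn0 n : 0 < lam ^+ n. Proof. exact: exprn_gt0. Qed.

(** It compares [T] with its translate by [t]; tiles are half-open here so that a boundary place
    belongs to a single tile. *)
Definition mismatch T t r := ~ exists x y,
  [/\ T x, T y, x = shift_tile t y & x.1 <= r < tend x].

Definition meets c d x := (x.1 <= d) && (c <= tend x).

Lemma sum_meeting t w c d : c <= d ->
  \sum_(x <- layout t w | meets c d x) omega 0 x.2 <= (d - c) + 2 * ommax omega.
Proof.
move=> cd; set M := ommax omega.
have M0 : 0 <= M by apply: sumr_ge0 => i _; exact: ltW.
apply: (@le_trans _ _ (\sum_(x <- layout t w) meet_length (c - M) (d + M) x.1 (tend x))).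
  rewrite big_mkcond /=; apply: ler_sum => x _.
  case: ifP => [/andP[h1 h2]|_]; last exact: meet_length_ge0.
  have := le_ommax om0 x.2; rewrite -/M => xM; have x0 := om0 x.2.
  by rewrite /tend in h2 *; rewrite meet_length_sub; lra.
rewrite sum_overlap_layout //; last by lra.
apply: le_trans (meet_length_le _ _ _) _; lra.
Qed.

Lemma size_meeting t w c d (i : 'I_k) : c <= d ->
  (size [seq x <- layout t w | meets c d x])%:R <= ((d - c) + 2 * ommax omega) / ommin omega.
Proof.
move=> cd; rewrite ler_pdivlMr ?(ommin_gt0 om0 i) //.
apply: le_trans (sum_meeting t w cd).
rewrite -big_filter; elim: [seq _ <- _ | _] => [|x s IH]; first by rewrite mul0r big_nil.
by rewrite big_cons -natr1 mulrDl mul1r addrC lerD // ommin_le.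
Qed.

Variable legal : tile R k -> tile R k -> Prop.
Variable steps : R -> Prop.
Hypothesis steps_legal : forall p l t g x y, x \in supertiles p (0, l) ->
  y \in supertiles p (0, l) -> steps g ->
  legal (shift_tile t x) (shift_tile (t + g) y).
Hypothesis legal_decay : forall eps, 0 < eps -> exists n, forall x y, legal x y ->
  discrepancy phi lam omega n x y <= eps * (lam ^+ n * overlap x y).

(** Mismatches are counted on a grid instead of measured, which is what averaging over finitely many
    times needs. Every pair of level-[n] supertiles is a legal overlap; its discrepancy gives the
    term [eps * m%:R], and the rounding errors give [K], which depends on none of [g], [T] and
    [m]. *)
Lemma mismatch_count eps : 0 < eps -> exists (n : nat) (L K : R), 0 < L /\
  forall g T m, steps g -> tiling_space phi lam omega T -> (0 < m)%N ->
  \sum_(j < m) `[< mismatch T (lam ^+ n * g) (j%:R * (L / m%:R)) >]%:R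
    <= eps * m%:R + K.
Proof.
move=> e0; have [n Hn] := @legal_decay (eps / 2) ltac:(lra).
pose M := ommax omega.
have M0 : 0 <= M by apply: sumr_ge0 => i _; exact: ltW.
(* With this length, [L / lam ^+ n] is [2 * M + 1], so the boundary term [2 * M] at most doubles the
   total overlap; this explains [eps / 2] above. *)
pose L := 2 * M * lam ^+ n + lam ^+ n.
pose S : nat := \max_i size (subst_iter n [:: i]).
pose E := (L / lam ^+ n - 0 + 2 * M) / ommin omega.
have L0 : 0 < L by rewrite /L ltr_wpDl // mulr_ge0 // ?mulr_ge0 // ltW.
exists n, L, ((E * S%:R) * (E * S%:R)); split => // g T m sg TT m0.
set t0 := lam ^+ n * g; set s := L / m%:R.
have s0 : 0 < s by rewrite divr_gt0 // ltr0n.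
have t00 := normr_ge0 t0.
(* The radius is such that both [r] and [r - t0] lie in the patch for all [r] between 0 and [L]. *)
have [p [i [t [ht1 ht2 patch]]]] := @tiling_patch _ _ _ _ _ om0 lam1 eig T (L + `|t0| + 1) TT ltac:(lra).
(* The patch is too long to come from a level below [n], so it splits into level-[n] supertiles. *)
have np : (n <= p)%N.
  rewrite leqNgt; apply/negP => pn.
  have : lam ^+ p <= lam ^+ n by rewrite ler_weXn2l ?(ltW lam1) ?(ltnW pn).
  have := le_ommax om0 i; rewrite -/M => iM pn'.
  have : lam ^+ p * omega 0 i <= lam ^+ n * M.
    by apply: ler_pM => //; exact: ltW.
  have : 0 <= lam ^+ n * M by rewrite mulr_ge0 // ltW.
  by have := lamn0 n; move: ht1 ht2; rewrite /L; lra.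
have i_gt0 := ommin_gt0 om0 i.
set w := subst_iter (p - n) [:: i].
pose tn := t / lam ^+ n.
have tnE : t = lam ^+ n * tn by rewrite mulrCA divff ?mulr1 // gt_eqF.
have WE : layout t (subst_iter p [:: i]) = flatten [seq supertiles n x | x <- layout tn w].
  by rewrite -(layout_supertiles eig) -tnE -subst_iter_add subnKC.
pose D := L / lam ^+ n.
pose E1 := [seq x <- layout tn w | meets 0 D x].
pose E2 := [seq x <- layout (tn + g) w | meets 0 D x].
have D0 : 0 <= D by rewrite divr_ge0 ?ltW.
have DL : lam ^+ n * D = L by rewrite mulrCA divff ?mulr1 // gt_eqF.
have jbound (j : 'I_m) : 0 <= j%:R * s < L.
  apply/andP; split; first by rewrite mulr_ge0 // ltW.
  rewrite mulrCA gtr_pMr // ltr_pdivrMr ?ltr0n // mul1r.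
  by rewrite ltr_nat.
have bad (j : 'I_m) : mismatch T t0 (j%:R * s) ->
    exists e1 e2 x y, [/\ e1 \in E1, e2 \in E2, x \in supertiles n e1,
      y \in supertiles n e2 & x != y /\
      Num.max x.1 y.1 <= j%:R * s < Num.min (tend x) (tend y)].
  move=> mis; have := jbound j; set r := j%:R * s => /andP[r0 rL].
  have n0 := normr_ge0 t0.
  have nt1 := ler_norm t0; have nt2 := ler_norm (- t0); rewrite normrN in nt2.
  have [x [xW Tx xr]] := patch r ltac:(lra).
  have [y [yW Ty yr]] := patch (r - t0) ltac:(lra).
  move: xW yW; rewrite WE => /flatten_mapP[e1 e1w xe1] /flatten_mapP[e2 e2w ye2].
  have ye2' : shift_tile t0 y \in supertiles n (shift_tile g e2).
    by rewrite supertiles_shift map_f.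
  have B1 := supertiles_bounds om0 eig xe1.
  have B2 := supertiles_bounds om0 eig ye2'.
  rewrite /tend /= in B2 yr.
  have cancel_le a b : lam ^+ n * a <= lam ^+ n * b -> a <= b by rewrite ler_pM2l.
  exists e1, (shift_tile g e2), x, (shift_tile t0 y); split => //.
  - rewrite mem_filter e1w andbT; apply/andP; split; apply: cancel_le.
      by rewrite DL; lra.
    by rewrite mulr0; lra.
  - rewrite mem_filter layout_shift map_f // andbT; apply/andP; split; apply: cancel_le.
      by rewrite DL /=; lra.
    by rewrite mulr0 /tend /=; lra.
  - split; last first.
      rewrite ge_max lt_min /tend /=; move: xr; rewrite /tend => xr.
      by apply/andP; split; apply/andP; split; lra.
    by apply/eqP => xy; apply: mis; exists x, y; split.
have ind_le (j : 'I_m) : `[< mismatch T t0 (j%:R * s) >]%:R <=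
    \sum_(e1 <- E1) \sum_(e2 <- E2) \sum_(x <- supertiles n e1)
      \sum_(y <- supertiles n e2 | x != y)
      (Num.max x.1 y.1 <= j%:R * s < Num.min (tend x) (tend y))%R%:R :> R.
  have [/asboolP/bad[e1 [e2 [x [y [e1E e2E xe1 ye2 [xy cov]]]]]]|_] := boolP `[< _ >];
    last by apply: sumr_ge0 => *; apply: sumr_ge0 => *; apply: sumr_ge0 => *;
      apply: sumr_ge0 => *; exact: ler0n.
  rewrite (big_rem e1) //= (big_rem e2) //= (big_rem x) //= (big_rem y) //= xy cov.
  rewrite -!addrA lerDl.
  by do ?[apply: addr_ge0]; do ?[apply: sumr_ge0 => *]; rewrite ?ler0n //.
apply: (@le_trans _ _ (\sum_(j < m) \sum_(e1 <- E1) \sum_(e2 <- E2)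
    \sum_(x <- supertiles n e1) \sum_(y <- supertiles n e2 | x != y)
      (Num.max x.1 y.1 <= j%:R * s < Num.min (tend x) (tend y))%R%:R)).
  exact: ler_sum.
have legal12 e1 e2 : e1 \in E1 -> e2 \in E2 -> legal e1 e2.
  rewrite !mem_filter => /andP[_ +] /andP[_].
  rewrite -[tn in layout tn w]add0r layout_shift => /mapP[x xw ->].
  rewrite -[tn + g]add0r layout_shift => /mapP[y yw ->].
  by apply: (@steps_legal (p - n) i) => //; rewrite /supertiles mulr0.
have ssize e1 t1 v : e1 \in [seq x <- layout t1 v | meets 0 D x] ->
    (size (supertiles n e1) <= S)%N.
  move=> _; have -> : size (supertiles n e1) = size (subst_iter n [:: e1.2]).
    rewrite /supertiles; elim: (subst_iter n [:: e1.2]) (_ * _) => //= j l IH r.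
    by rewrite IH.
  exact: (leq_bigmax e1.2).
have inner e1 e2 : e1 \in E1 -> e2 \in E2 ->
    \sum_(j < m) \sum_(x <- supertiles n e1) \sum_(y <- supertiles n e2 | x != y)
      (Num.max x.1 y.1 <= j%:R * s < Num.min (tend x) (tend y))%R%:R
    <= eps / 2 * lam ^+ n / s * overlap e1 e2 + S%:R * S%:R.
  move=> e1E e2E; rewrite exchange_big /=.
  apply: (@le_trans _ _ (\sum_(x <- supertiles n e1) \sum_(y <- supertiles n e2 | x != y)
      (overlap x y / s + 1))).
    apply: ler_sum => x _; rewrite exchange_big /=; apply: ler_sum => y _.
    exact: count_grid.
  apply: (@le_trans _ _ (discrepancy phi lam omega n e1 e2 / s + S%:R * S%:R)).
    under eq_bigr do rewrite big_split /=.
    rewrite big_split /=; apply: lerD.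
      by rewrite /discrepancy mulr_suml; apply: ler_sum => x _; rewrite mulr_suml.
    apply: (@le_trans _ _ (\sum_(x <- supertiles n e1) S%:R)).
      apply: ler_sum => x _; rewrite big_mkcond /=.
      apply: (@le_trans _ _ (\sum_(y <- supertiles n e2) 1)).
        by apply: ler_sum => y _; case: ifP => // _; exact: ler01.
      by rewrite big_const_seq count_predT iter_addr_0 ler_nat (ssize _ _ _ e2E).
    rewrite big_const_seq count_predT iter_addr_0 -[S%:R *+ _]mulr_natr.
    by rewrite ler_wpM2l ?ler0n // ler_nat (ssize _ _ _ e1E).
  rewrite lerD2r -[leRHS]mulrA [_^-1 * _]mulrC mulrA ler_pM2r ?invr_gt0 //.
  by rewrite -mulrA; apply: Hn; exact: legal12.
rewrite exchange_big /=.
apply: (@le_trans _ _ (\sum_(e1 <- E1) \sum_(e2 <- E2)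
    (eps / 2 * lam ^+ n / s * overlap e1 e2 + S%:R * S%:R))).
  rewrite big_seq [leRHS]big_seq; apply: ler_sum => e1 e1E.
  rewrite exchange_big /= big_seq [leRHS]big_seq; apply: ler_sum => e2 e2E.
  exact: inner.
under eq_bigr do rewrite big_split /=.
rewrite big_split /=; apply: lerD.
  under eq_bigr do rewrite -mulr_sumr.
  rewrite -mulr_sumr.
  apply: (@le_trans _ _ (eps / 2 * lam ^+ n / s * (2 * D))).
    apply: ler_wpM2l; first by rewrite !mulr_ge0 ?invr_ge0 ?(ltW e0) ?(ltW (lamn0 n)) ?(ltW s0).
    apply: (@le_trans _ _ (D - 0 + 2 * M)).
      apply: le_trans (sum_meeting tn w D0); rewrite /E1 big_filter.
      apply: ler_sum => e1 _; rewrite /E2 big_filter.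
      apply: (@le_trans _ _ (\sum_(x <- layout (tn + g) w) overlap e1 x)).
        rewrite big_mkcond /=; apply: ler_sum => x _.
        by case: ifP => // _; exact: overlap_ge0.
      have e1t : e1.1 <= tend e1 by rewrite lerDl ltW.
      rewrite (sum_overlap_layout om0) //; apply: le_trans (meet_length_le _ _ e1t) _.
      by rewrite /tend addrC addKr.
    have -> : D = 2 * M + 1.
      by rewrite /D /L mulrDl mulfK ?gt_eqF // divff ?gt_eqF.
    by lra.
  have -> : eps / 2 * lam ^+ n / s * (2 * D) = eps * (lam ^+ n * D) / s by field; rewrite gt_eqF.
  rewrite DL /s invf_div -mulrA [L * _]mulrC mulfVK ?gt_eqF //.
have szE t1 : (size [seq x <- layout t1 w | meets 0 D x])%:R <= E.
  exact: size_meeting.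
rewrite big_const_seq count_predT iter_addr_0 big_const_seq count_predT iter_addr_0.
rewrite -[_ *+ size E1]mulr_natr -[_ *+ size E2]mulr_natr.
have sE1 := szE tn; have sE2 := szE (tn + g); rewrite -/E1 in sE1; rewrite -/E2 in sE2.
have E0 : 0 <= E by apply: le_trans sE1; exact: ler0n.
have -> : S%:R * S%:R * (size E2)%:R * (size E1)%:R =
   (S%:R * (size E1)%:R) * (S%:R * (size E2)%:R) :> R by ring.
rewrite ![E * _]mulrC; apply: ler_pM; rewrite ?mulr_ge0 ?ler0n //.
  by rewrite ler_wpM2l ?ler0n.
by rewrite ler_wpM2l ?ler0n.
Qed.

End Mismatch.

Section TilingTopology.
Import numFieldNormedType.Exports.
Context {R : realType} {k : nat} (phi : 'I_k -> seq 'I_k) (lam : R)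
  (omega : 'rV[R]_k).
Implicit Types (t r s e : R) (x y : tile R k) (T : tiles omega) (U : set (tiles omega)).

Notation tend := (tend omega).
Notation Omega := (tiling_space phi lam omega).

Hypothesis om0 : forall i, 0 < omega 0 i.

Lemma interior_tile_support x : (tile_support omega x)^° = `]x.1, tend x[%classic.
Proof. by rewrite /tile_support interior_itv_bnd. Qed.

Lemma is_tiling_translate T t : is_tiling T -> is_tiling (translate T t).
Proof.
move=> tT; split.
  apply/seteqP; split => // r _.
  have [x Tx xr] := tiling_cover (r - t) tT.
  exists (shift_tile t x); first by exists x.
  by rewrite /tile_support /= in_itv /=; move: xr; rewrite /tend; lra.
move=> x y /translateE Tx /translateE Ty [r []].
rewrite !interior_tile_support /= !in_itv /= => xr yr.
have : shift_tile (- t) x = shift_tile (- t) y.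
  by apply: (tiling_disj om0 tT Tx Ty); move: xr yr; rewrite /tend /=; lra.
move=> [/addIr x1 x2].
by rewrite [x]surjective_pairing x1 x2 -surjective_pairing.
Qed.

Lemma tiling_space_translate T t : Omega T -> Omega (translate T t).
Proof.
move=> [tT pat]; split; first exact: is_tiling_translate.
move=> P finP PT.
have [m [i [u Pu]]] : exists m i u, translate P (- t) `<=`
    translate (supertile phi lam omega m i) u.
  apply: pat; first exact: finite_image.
  move=> x /translateE; rewrite opprK => /PT /translateE.
  by rewrite /shift_tile /= addrK -surjective_pairing.
exists m, i, (u + t); rewrite -translateD => x Px.
apply/translateE; apply: Pu; apply/translateE.
by rewrite opprK /shift_tile /= subrK -surjective_pairing.
Qed.

Lemma tiling_space_translateE T t : Omega (translate T t) <-> Omega T.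
Proof.
split; last exact: tiling_space_translate.
by move=> /(@tiling_space_translate _ (- t)); rewrite translateD subrr translate0.
Qed.

Lemma windowE r T x : 0 <= r -> window r T x <-> T x /\ x.1 <= r /\ - r <= tend x.
Proof.
move=> r0; have x0 := om0 x.2; split.
  move=> [Tx [s []]]; rewrite /tile_support /= !in_itv /= /tend => xs rs.
  by split=> //; lra.
rewrite /tend => -[Tx [x1 x2]]; split=> //.
exists (Num.max x.1 (- r)); rewrite /tile_support /= !in_itv /=.
by split; rewrite !maxEle; case: ifP; lra.
Qed.

Lemma window_translate r s r' T T' : 0 <= r' -> r' + `|s| <= r ->
  window r T = window r T' -> window r' (translate T s) = window r' (translate T' s).
Proof.
move=> r0 rr E; have s0 := normr_ge0 s.
have s1 := ler_norm s; have s2 := ler_norm (- s); rewrite normrN in s2.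
have r1 : 0 <= r by lra.
have main T1 T2 : window r T1 = window r T2 ->
    window r' (translate T1 s) `<=` window r' (translate T2 s).
  move=> E' x /(windowE _ _ r0)[/translateE T1x [x1 x2]].
  apply/(windowE _ _ r0); split=> //; apply/translateE.
  have : window r T1 (shift_tile (- s) x).
    by apply/(windowE _ _ r1); split=> //; move: x2; rewrite /tend /=; lra.
  by rewrite E' => -[].
by apply/seteqP; split; apply: main.
Qed.

Lemma eps_close_refl e T : 0 < e -> eps_close e T T.
Proof. by move=> e0; exists 0; rewrite ?normr0 // oppr0 translate0. Qed.

Lemma eps_close_translate e T s : `|s| < e -> eps_close e T (translate T s).
Proof. by move=> se; exists s => //; rewrite translateD subrr translate0. Qed.

Lemma open_tilesE U : open U = tiles_open U.
Proof. by []. Qed.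

Lemma open_translate U s : open U -> open [set T | U (translate T s)].
Proof.
rewrite !open_tilesE => oU T /= /oU[e e0 eU].
have s0 := normr_ge0 s; have e'0 : 0 < e^-1 + `|s| by rewrite ltr_pwDl ?invr_gt0.
exists (e^-1 + `|s|)^-1; first by rewrite invr_gt0.
move=> T' [t te wt]; apply: eU; exists t.
  by apply: lt_le_trans te _; rewrite -[leRHS]invrK lef_pV2 ?posrE ?invr_gt0 // lerDl.
rewrite translateD addrC -translateD; apply: (@window_translate (e^-1 + `|s|)) => //.
- by rewrite invr_ge0 ltW.
- by rewrite invrK in wt.
Qed.

Lemma open_eps_close e T0 : 0 < e -> open [set T | eps_close e T0 T].
Proof.
move=> e0; rewrite open_tilesE => T /= [t te wt].
have t0 := normr_ge0 t; have d0 : 0 < e - `|t| by lra.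
have c0 : 0 < e^-1 + `|t| by rewrite ltr_pwDl ?invr_gt0.
exists (Num.min (e - `|t|) (e^-1 + `|t|)^-1).
  by rewrite lt_min d0 invr_gt0.
set eta := Num.min _ _ => T' [t' te' wt'].
have eta0 : 0 < eta by rewrite lt_min d0 invr_gt0.
have e1 : eta <= e - `|t| by rewrite ge_min lexx.
have e2 : e^-1 + `|t| <= eta^-1.
  by rewrite -[leLHS]invrK lef_pV2 ?posrE ?invr_gt0 // ge_min lexx orbT.
exists (t + t'); first by apply: le_lt_trans (ler_normD _ _) _; lra.
rewrite -wt opprD addrC -translateD.
apply: (@window_translate eta^-1) => //; first by rewrite invr_ge0 ltW.
by rewrite normrN.
Qed.

Lemma open_exists (I : Type) (P : I -> Prop) (V : I -> set (tiles omega)) :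
  (forall i, open (V i)) -> open [set T | exists2 i, P i & V i T].
Proof.
move=> oV; rewrite open_tilesE => T /= [i Pi ViT].
have := oV i; rewrite open_tilesE => /(_ _ ViT)[e e0 eV].
by exists e => // T' /eV; exists i.
Qed.

(* Unlike [U], this open set is determined by the tiles in a bounded window. *)
Definition inner_open e U : set (tiles omega) :=
  [set T | exists2 T0, (forall T', Omega T' -> eps_close e T0 T' -> U T') &
    eps_close e T0 T].

Lemma open_inner_open e U : 0 < e -> open (inner_open e U).
Proof. by move=> e0; apply: open_exists => T0; exact: open_eps_close. Qed.

Lemma inner_open_window e U T T' : 0 < e ->
  window (e^-1 + e) T = window (e^-1 + e) T' -> inner_open e U T -> inner_open e U T'.
Proof.
move=> e0 E [T0 T0U [t te wt]]; exists T0 => //; exists t => //.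
rewrite -wt; apply/esym; apply: (@window_translate (e^-1 + e)) => //.
- by rewrite invr_ge0 ltW.
- by rewrite normrN lerD2l ltW.
Qed.

Lemma open_cover_inner_open U : open U ->
  Omega `&` U = \bigcup_n (Omega `&` inner_open (n.+1%:R^-1) U).
Proof.
move=> oU; apply/seteqP; split => T.
  move=> [OT UT]; rewrite open_tilesE in oU; have [e e0 eU] := oU _ UT.
  have [n ne] : exists n, n.+1%:R^-1 < e.
    exists (Num.bound e^-1).
    rewrite -[ltRHS]invrK ltf_pV2 ?posrE ?invr_gt0 //.
    by apply: lt_trans (unstable.ltr_bound _) _; rewrite ltr_nat.
  exists n => //; split => //; exists T; last exact: eps_close_refl.
  move=> T' _ TT'; apply: eU; apply: eps_close_le (ltW ne) TT'.
  by rewrite invr_gt0.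
by move=> [n _ [OT [T0 T0U T0T]]]; split => //; exact: T0U.
Qed.

End TilingTopology.

(** * Almost periodic sets of a measure-preserving flow *)

Section AlmostPeriodic.
Context d (X : measurableType d) (R : realType) (mu : probability X R).
Implicit Types (A B C : set X).

Notation normc := ComplexField.Normc.normc.

Lemma measurable_setY A B : measurable A -> measurable B -> measurable (A `+` B).
Proof. by move=> mA mB; apply: measurableU; exact: measurableD. Qed.

Lemma mu_setY_trans A B C : measurable A -> measurable B -> measurable C ->
  (mu (A `+` C) <= mu (A `+` B) + mu (B `+` C))%E.
Proof.
move=> mA mB mC.
have mAB := measurable_setY mA mB; have mBC := measurable_setY mB mC.
apply: (@le_trans _ _ (mu ((A `+` B) `|` (B `+` C)))); last exact: measureU2.
apply: le_measure; rewrite ?inE; [exact: measurable_setY|exact: measurableU|].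
by move=> x [[Ax Cx]|[Cx Ax]]; have [Bx|Bx] := pselect (B x);
  [right; left|left; left|left; right|right; right].
Qed.

Lemma decreasing_measure_small (D : nat -> set X) : (forall n, measurable (D n)) ->
  (forall n, D n.+1 `<=` D n) -> \bigcap_n D n = set0 ->
  forall eps : R, 0 < eps -> exists n, (mu (D n) < eps%:E)%E.
Proof.
move=> mD dD D0 eps e0.
have cv : mu (D n) @[n --> \oo] --> (0 : \bar R)%E.
  rewrite -[X in _ --> X](measure0 mu) -D0.
  apply: nonincreasing_cvg_mu => //.
  - by rewrite (le_lt_trans (probability_le1 mu (mD 0%N))) // ltry.
  - by rewrite D0.
  - by apply/nonincreasing_seqP => n; apply/subsetPset; exact: dD.
have e0' : ((0 : \bar R) < eps%:E)%E by rewrite lte_fin.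
have [n _ Hn] := cv _ (open_ereal_lt' e0').
by exists n; apply: (Hn n) => /=.
Qed.

Definition cis (x : R) : R[i] := (cos (2 * pi * x) +i* sin (2 * pi * x))%C.

(** A Bohr neighbourhood of 0 in the line, given by finitely many characters. *)
Definition bohr (bs : seq R) (del t : R) :=
  forall b, b \in bs -> normc (1 - cis (b * t)) < del.

Context (S : R -> X -> X).
Hypothesis mS : forall t, measurable_fun setT (S t).
Hypothesis muS : forall t A, measurable A -> mu (S t @^-1` A) = mu A.

Lemma measurable_preimageS t A : measurable A -> measurable (S t @^-1` A).
Proof. by move=> mA; rewrite -[X in measurable X]setTI; exact: mS. Qed.

Definition almost_periodic A := measurable A /\ forall eps : R, 0 < eps ->
  exists bs del, 0 < del /\
    forall t, bohr bs del t -> (mu (A `+` S t @^-1` A) <= eps%:E)%E.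

Lemma almost_periodic0 : almost_periodic set0.
Proof.
split=> // eps e0; exists [::], 1; split => // t _.
by rewrite preimage_set0 setYK measure0 lee_fin ltW.
Qed.

Lemma almost_periodicC A : almost_periodic A -> almost_periodic (~` A).
Proof.
move=> [mA apA]; split=> [|eps /apA[bs [del [d0 H]]]]; first exact: measurableC.
exists bs, del; split => // t /H; congr (_ <= _)%E; congr (mu _).
by apply/seteqP; split => x /=; have := pselect (A x); have := pselect (A (S t x)); tauto.
Qed.

Lemma almost_periodicU A B :
  almost_periodic A -> almost_periodic B -> almost_periodic (A `|` B).
Proof.
move=> [mA apA] [mB apB]; split=> [|eps e0]; first exact: measurableU.
have [|bs [del [d0 HA]]] := apA (eps / 2); first lra.
have [|cs [del' [d'0 HB]]] := apB (eps / 2); first lra.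
exists (bs ++ cs), (Num.min del del'); split=> [|t bt]; first by rewrite lt_min d0.
have bA : bohr bs del t.
  move=> b bb; have := bt b; rewrite mem_cat bb lt_min => /(_ isT) /andP[//].
have bB : bohr cs del' t.
  move=> b bb; have := bt b; rewrite mem_cat bb orbT lt_min => /(_ isT) /andP[//].
have mAY := measurable_setY mA (measurable_preimageS t mA).
have mBY := measurable_setY mB (measurable_preimageS t mB).
have -> : eps = eps / 2 + eps / 2 by lra.
rewrite EFinD; apply: le_trans (leeD (HA t bA) (HB t bB)).
apply: le_trans (measureU2 mu mAY mBY); apply: le_measure; rewrite ?inE.
- by apply: measurable_setY; [|apply: measurable_preimageS]; exact: measurableU.
- exact: measurableU.
- by move=> x /=; tauto.
Qed.

(** A finite union approximates the whole one in measure, and by invariance so do their preimages,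
    with an error that does not depend on [t]. *)
Lemma almost_periodic_bigcup (F : nat -> set X) :
  (forall n, almost_periodic (F n)) -> almost_periodic (\bigcup_n F n).
Proof.
move=> apF.
have mF n : measurable (F n) by case: (apF n).
have mA : measurable (\bigcup_n F n) by exact: bigcup_measurable.
split=> // eps e0; set A := \bigcup_n F n.
pose B n := \big[setU/set0]_(i < n) F i.
have apB n : almost_periodic (B n).
  rewrite /B; elim/big_ind: _ => //; first exact: almost_periodic0.
  exact: almost_periodicU.
have mB n : measurable (B n) by case: (apB n).
have BA n : B n `<=` A by rewrite /B -bigcup_mkord => x [i _ Fx]; exists i.
have sB n m : (n <= m)%N -> B n `<=` B m.
  by move=> nm; rewrite /B -!bigcup_mkord => x [i /= im Fx]; exists i => //=; lia.
have [n Hn] : exists n, (mu (A `\` B n) < (eps / 4)%:E)%E.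
  apply: (@decreasing_measure_small (fun n => A `\` B n)); last lra.
  - by move=> n; exact: measurableD.
  - by move=> n x [Ax Bx]; split => // Bx'; apply: Bx; exact: (sB n n.+1).
  - apply/seteqP; split => // x Dx; have [[i _ Fx] _] := Dx 0%N I.
    have [_ []] := Dx i.+1 I.
    by rewrite /B -bigcup_mkord; exists i => /=.
have mAB : measurable (A `\` B n) by exact: measurableD.
have [bs [del [d0 HB]]] := (apB n).2 (eps / 4) ltac:(lra).
exists bs, del; split => // t /HB Bt.
have mSA := measurable_preimageS t mA; have mSB := measurable_preimageS t (mB n).
have AB : (mu (A `+` B n) <= (eps / 4)%:E)%E.
  rewrite /setY (_ : B n `\` A = set0) ?setU0; first exact: ltW.
  by apply/seteqP; split => // x [/(BA n)].
have SAB : (mu (S t @^-1` B n `+` S t @^-1` A) <= (eps / 4)%:E)%E.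
  have -> : S t @^-1` B n `+` S t @^-1` A = S t @^-1` (A `+` B n).
    by apply/seteqP; split => x /=; tauto.
  by rewrite muS //; exact: measurable_setY.
have -> : eps = eps / 4 + (eps / 4 + eps / 4) + eps / 4 by lra.
apply: le_trans (mu_setY_trans mA mSB mSA) _.
rewrite EFinD leeD //.
apply: le_trans (mu_setY_trans mA (mB n) mSB) _.
by rewrite EFinD leeD // (le_trans Bt) // lee_fin; lra.
Qed.

(** The almost periodic sets form a sigma-algebra, so only generators have to be examined. *)
Lemma almost_periodic_generated (G : set (set X)) :
  (forall A, G A -> almost_periodic A) -> forall A, <<s G >> A -> almost_periodic A.
Proof.
move=> GA A; apply: (@smallest_sub _ _ _ almost_periodic) => //; split.
- exact: almost_periodic0.
- by move=> B apB; rewrite setTD; exact: almost_periodicC.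
- exact: almost_periodic_bigcup.
Qed.

End AlmostPeriodic.

(** * Trigonometric polynomials *)

Section Cis.
Context {R : realType}.
Implicit Types x y : R.
Notation normc := ComplexField.Normc.normc.
Notation cis := (@cis R).

Lemma cis0 : cis 0 = 1.
Proof. by rewrite /cis mulr0 cos0 sin0. Qed.

Lemma cisD x y : cis (x + y) = cis x * cis y.
Proof.
rewrite /cis mulrDr cosD sinD; apply/eqP; rewrite eq_complex /=.
by rewrite eqxx /= addrC.
Qed.

Lemma cisN x : cis (- x) = (cis x)^*%C.
Proof. by rewrite /cis mulrN cosN sinN. Qed.

Lemma normc_cis x : normc (cis x) = 1.
Proof. by rewrite /cis /= cos2Dsin2 sqrtr1. Qed.

Lemma cisX x n : cis x ^+ n = cis (n%:R * x).
Proof.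
elim: n => [|n IH]; first by rewrite mul0r cis0.
by rewrite exprS IH -cisD -natr1 mulrDl mul1r addrC.
Qed.

Lemma mul_conjc (z : R[i]) : z * z^*%C = (normc z ^+ 2)%:C%C.
Proof.
case: z => a b; rewrite /= sqr_sqrtr ?addr_ge0 ?sqr_ge0 //.
by apply/eqP; rewrite eq_complex /=; apply/andP; split; apply/eqP; ring.
Qed.

End Cis.

Section TrigonometricLists.
Context {R : realType}.
Implicit Types (t b : R) (L : seq (R * R)) (w : seq (R * R)).
Notation normc := ComplexField.Normc.normc.
Notation cis := (@cis R).

(* A list of pairs (coefficient, frequency) stands for a trigonometric
   polynomial. *)
Definition trig L t : R[i] := \sum_(x <- L) x.1%:C%C * cis (x.2 * t).

Definition trig_mul L L' : seq (R * R) := [seq (x.1 * y.1, x.2 + y.2) | x <- L, y <- L'].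

(** The mean value of [trig L] over the line. *)
Definition constant_term L : R := \sum_(x <- L | x.2 == 0) x.1.

Definition nonneg_coefs L := all (fun x : R * R => 0 <= x.1) L.

Lemma trig_mulE L L' t : trig (trig_mul L L') t = trig L t * trig L' t.
Proof.
rewrite /trig big_allpairs_dep /= mulr_suml; apply: eq_bigr => x _.
rewrite mulr_sumr; apply: eq_bigr => y _.
by rewrite /= rmorphM mulrDl cisD mulrACA.
Qed.

Lemma nonneg_coefs_mul L L' : nonneg_coefs L -> nonneg_coefs L' ->
  nonneg_coefs (trig_mul L L').
Proof.
move=> /allP L0 /allP L'0; apply/allP => _ /allpairsP[[x y] /= [xL yL ->]] /=.
by apply: mulr_ge0; [exact: L0 xL|exact: L'0 yL].
Qed.

(** Only an inequality: nonzero frequencies of the two factors may cancel and add to the constant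
    term, but never negatively. *)
Lemma constant_term_mul L L' : nonneg_coefs L -> nonneg_coefs L' ->
  constant_term L * constant_term L' <= constant_term (trig_mul L L').
Proof.
move=> /allP L0 /allP L'0.
rewrite /constant_term [leRHS]big_mkcond /= big_allpairs_dep /= [\sum_(x <- L | _) _]big_mkcond /=.
rewrite mulr_suml big_seq [leRHS]big_seq; apply: ler_sum => x xL.
rewrite [\sum_(x <- L' | _) _]big_mkcond mulr_sumr big_seq [leRHS]big_seq.
apply: ler_sum => y yL'.
have xy0 : 0 <= x.1 * y.1 by apply: mulr_ge0; [exact: L0 xL|exact: L'0 yL'].
have [/eqP->|_] := boolP (x.2 == 0); last by rewrite mul0r; case: ifP.
by rewrite add0r; case: ifP; rewrite ?mulr0.
Qed.

Definition fejer n b : seq (R * R) :=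
  [seq (n%:R^-1, (l%:R - l'%:R) * b) | l <- iota 0 n, l' <- iota 0 n].

Definition dirichlet n b t : R[i] := \sum_(l <- iota 0 n) cis (l%:R * b * t).

Lemma trig_fejer n b t :
  trig (fejer n b) t = (n%:R^-1 * normc (dirichlet n b t) ^+ 2)%:C%C.
Proof.
rewrite rmorphM /= -mul_conjc /trig /fejer big_allpairs_dep /= rmorph_sum /=.
rewrite [in RHS]mulr_suml mulr_sumr; apply: eq_bigr => l _.
rewrite !mulr_sumr; apply: eq_bigr => l' _; congr (_ * _).
rewrite -[(_ -i* _)%C]/((cis (l'%:R * b * t))^*%C) -cisN -cisD.
by congr cis; ring.
Qed.

Lemma fejer_nonneg n b : nonneg_coefs (fejer n b).
Proof. by apply/allP => _ /allpairsP[[l l'] /= [_ _ ->]] /=. Qed.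

Lemma fejer_constant n b : (0 < n)%N -> 1 <= constant_term (fejer n b).
Proof.
move=> n0; rewrite /constant_term big_mkcond /fejer big_allpairs_dep /=.
apply: (@le_trans _ _ (\sum_(l <- iota 0 n) n%:R^-1)).
  by rewrite big_const_seq count_predT size_iota iter_addr_0 -[_ *+ n]mulr_natr mulVf // pnatr_eq0 -lt0n.
rewrite big_seq [leRHS]big_seq; apply: ler_sum => l ln.
rewrite [leRHS](big_rem l) //= subrr mul0r eqxx lerDl; apply: sumr_ge0 => l' _.
by case: ifP => // _; rewrite invr_ge0.
Qed.

Lemma dirichlet_le n b t del : 0 < del -> del <= normc (1 - cis (b * t)) ->
  normc (dirichlet n b t) <= 2 / del.
Proof.
move=> d0 dle; set u := cis (b * t) in dle.
have DE : dirichlet n b t = \sum_(l < n) u ^+ l.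
  rewrite /dirichlet -[n in iota 0 n]subn0 big_mkord; apply: eq_bigr => l _.
  by rewrite cisX mulrA.
have E : (1 - u) * dirichlet n b t = 1 - u ^+ n.
  by rewrite DE -[LHS]opprK -mulNr opprB -subrX1 opprB.
rewrite ler_pdivlMr // mulrC.
apply: (@le_trans _ _ (normc (1 - u) * normc (dirichlet n b t))).
  by apply: ler_wpM2r => //; case: (dirichlet _ _ _) => *; exact: sqrtr_ge0.
rewrite -ComplexField.Normc.normcM E; apply: le_trans (le_normcD _ _) _.
by rewrite normcN ComplexField.Normc.normc1 cisX normc_cis; lra.
Qed.

(* Pairs (mass, time): a finitely supported probability measure on the line. *)
Definition weights w := all (fun x : R * R => 0 <= x.1) w /\ \sum_(x <- w) x.1 = 1.

Definition weights_mul w w' := trig_mul w w'.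

Definition kills w b := \sum_(x <- w) x.1%:C%C * cis (b * x.2) = 0.

Lemma weights_mulP w w' : weights w -> weights w' -> weights (weights_mul w w').
Proof.
move=> [w0 w1] [w'0 w'1]; split; first exact: nonneg_coefs_mul.
rewrite big_allpairs_dep /= -[RHS](mul1r 1) -{1}w1 mulr_suml; apply: eq_bigr => x _.
by rewrite -w'1 mulr_sumr.
Qed.

(** The product of weights is convolution of measures, under which Fourier transforms multiply. *)
Lemma kills_mul w w' b : kills w b \/ kills w' b -> kills (weights_mul w w') b.
Proof.
rewrite /kills => H; rewrite big_allpairs_dep /=.
transitivity ((\sum_(x <- w) x.1%:C%C * cis (b * x.2)) *
    (\sum_(x <- w') x.1%:C%C * cis (b * x.2))).
  rewrite mulr_suml; apply: eq_bigr => x _; rewrite mulr_sumr; apply: eq_bigr => y _.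
  by rewrite /= rmorphM mulrDr cisD mulrACA.
by case: H => ->; rewrite ?mul0r ?mulr0.
Qed.

(* Averaging over the two times [0] and [1 / (2 b)] kills the frequency [b]. *)
Lemma exists_kills (bs : seq R) : exists2 w, weights w &
  forall b, b \in bs -> b != 0 -> kills w b.
Proof.
elim: bs => [|b bs [w ww wk]].
  by exists [:: (1, 0)] => //; split; rewrite /= ?ler01 // big_seq1.
have [b0|b0] := eqVneq b 0.
  exists w => // c; rewrite inE => /orP[/eqP->|/wk//].
  by rewrite b0 eqxx.
exists (weights_mul [:: (2^-1, 0); (2^-1, (2 * b)^-1)] w).
  apply: weights_mulP => //; split; first by rewrite /= invr_ge0 ler0n.
  by rewrite !big_cons big_nil /=; lra.
move=> c; rewrite inE => /orP[/eqP->|cb] c0; apply: kills_mul; last by right; exact: wk.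
left; rewrite /kills !big_cons big_nil /= addr0 mulr0 cis0 -mulrDr.
have -> : b * (2 * b)^-1 = 2^-1 by field.
rewrite /cis mulrAC divff // mul1r cospi sinpi.
suff -> : 1 + (-1 +i* 0)%C = 0 :> R[i] by rewrite mulr0.
by apply/eqP; rewrite eq_complex /= subrr addr0 eqxx.
Qed.

Lemma average_trig w L : weights w ->
  (forall x, x \in L -> x.2 != 0 -> kills w x.2) ->
  \sum_(y <- w) y.1%:C%C * trig L y.2 = (constant_term L)%:C%C.
Proof.
move=> [_ w1] wk; rewrite /trig /constant_term rmorph_sum /= [RHS]big_mkcond.
under eq_bigr do rewrite mulr_sumr.
rewrite exchange_big /= big_seq [RHS]big_seq; apply: eq_bigr => x xL.
transitivity (x.1%:C%C * \sum_(y <- w) y.1%:C%C * cis (x.2 * y.2)).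
  by rewrite mulr_sumr; apply: eq_bigr => y _; ring.
case: eqVneq => [x0|x0]; last by rewrite wk // mulr0.
rewrite -[RHS]mulr1; congr (_ * _).
transitivity (\sum_(y <- w) y.1%:C%C); last by rewrite -rmorph_sum w1.
by apply: eq_bigr => y _; rewrite x0 mul0r cis0 mulr1.
Qed.

End TrigonometricLists.

(** * Eigenfunctions of a measure-preserving flow *)

Section ComplexL2.
Import numFieldNormedType.Exports.
Context d (X : measurableType d) (R : realType) (mu : probability X R).
Implicit Types (F G H : X -> R[i]) (c : R[i]).
Notation normc := ComplexField.Normc.normc.

Definition cmeasurable F := measurable_fun setT (fun x => complex.Re (F x)) /\
  measurable_fun setT (fun x => complex.Im (F x)).

Definition sqr_norm F : \bar R := (\int[mu]_x (normc (F x) ^+ 2)%:E)%E.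

Lemma normc_nonneg (z : R[i]) : 0 <= normc z.
Proof. by case: z => *; exact: sqrtr_ge0. Qed.

Lemma normc_sqr (z : R[i]) : normc z ^+ 2 = complex.Re z ^+ 2 + complex.Im z ^+ 2.
Proof. by case: z => a b /=; rewrite sqr_sqrtr // addr_ge0 ?sqr_ge0. Qed.

Lemma cmeasurable_normc F : cmeasurable F -> measurable_fun setT (fun x => normc (F x)).
Proof.
move=> [mR mI]; apply: (eq_measurable_fun ((@powR R ^~ 2^-1) \o (fun x =>
    (complex.Re (F x) ^+ 2 + complex.Im (F x) ^+ 2)))).
  by move=> x _; rewrite /comp powR12_sqrt ?addr_ge0 ?sqr_ge0 //; case: (F x).
apply: measurableT_comp => //.
by apply: measurable_funD; apply: measurable_funX.
Qed.

Lemma cmeasurable_sqr F : cmeasurable F ->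
  measurable_fun setT (fun x => (normc (F x) ^+ 2)%:E).
Proof.
by move=> mF; apply/measurable_EFinP; apply: measurable_funX; exact: cmeasurable_normc.
Qed.

Lemma cmeasurableD F G : cmeasurable F -> cmeasurable G -> cmeasurable (fun x => F x + G x).
Proof.
move=> [FR FI] [GR GI]; split.
  apply: (eq_measurable_fun (fun x => complex.Re (F x) + complex.Re (G x))).
    by move=> x _; case: (F x) => ? ?; case: (G x).
  exact: measurable_funD.
apply: (eq_measurable_fun (fun x => complex.Im (F x) + complex.Im (G x))).
  by move=> x _; case: (F x) => ? ?; case: (G x).
exact: measurable_funD.
Qed.

Lemma cmeasurableZ c F : cmeasurable F -> cmeasurable (fun x => c * F x).
Proof.
case: c => a b [FR FI]; split.
  apply: (eq_measurable_fun (fun x => a * complex.Re (F x) - b * complex.Im (F x))).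
    by move=> x _; case: (F x).
  by apply: measurable_funB; apply: measurable_funM => //; exact: measurable_cst.
apply: (eq_measurable_fun (fun x => a * complex.Im (F x) + b * complex.Re (F x))).
  by move=> x _; case: (F x).
by apply: measurable_funD; apply: measurable_funM => //; exact: measurable_cst.
Qed.

Lemma cmeasurable_cst c : cmeasurable (fun=> c).
Proof. by split; exact: measurable_cst. Qed.

Lemma cmeasurableB F G : cmeasurable F -> cmeasurable G -> cmeasurable (fun x => F x - G x).
Proof.
move=> mF mG; have := cmeasurableD mF (cmeasurableZ (-1) mG).
by congr cmeasurable; apply/funext => x; rewrite mulN1r.
Qed.

Lemma cmeasurable_sum (I : Type) (s : seq I) (f : I -> X -> R[i]) :
  (forall i, cmeasurable (f i)) -> cmeasurable (fun x => \sum_(i <- s) f i x).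
Proof.
move=> mf; elim: s => [|i s IH].
  have := cmeasurable_cst 0; congr cmeasurable.
  by apply/funext => x; rewrite big_nil.
have := cmeasurableD (mf i) IH; congr cmeasurable.
by apply/funext => x; rewrite big_cons.
Qed.

Lemma sqr_norm_ge0 F : (0 <= sqr_norm F)%E.
Proof. by apply: integral_ge0 => x _; rewrite lee_fin sqr_ge0. Qed.

Lemma Lnorm2E (f : X -> R) : (forall x, 0 <= f x) ->
  Lnorm mu 2%:E (fun x => (f x)%:E) = sqrte (\int[mu]_x (f x ^+ 2)%:E)%E.
Proof.
move=> f0; rewrite unlock poweR12_sqrt; last first.
  by apply: integral_ge0 => x _; exact: poweR_ge0.
congr sqrte; apply: eq_integral => x _.
by rewrite /= ger0_norm // powR_mulrn.
Qed.

Lemma L2normE F : L2norm mu F = sqrte (sqr_norm F).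
Proof. by apply: Lnorm2E => x; exact: normc_nonneg. Qed.

Lemma L2norm_le F (e : R) : 0 <= e -> (L2norm mu F <= e%:E)%E <->
  (sqr_norm F <= (e ^+ 2)%:E)%E.
Proof.
move=> e0; rewrite L2normE.
have -> : e%:E = sqrte (e ^+ 2)%:E by rewrite /= sqrtr_sqr ger0_norm.
by rewrite lee_sqrt // lee_fin sqr_ge0.
Qed.

Lemma L2norm_triangle F G : cmeasurable F -> cmeasurable G ->
  (L2norm mu (fun x => F x + G x)%R <= L2norm mu F + L2norm mu G)%E.
Proof.
move=> mF mG.
have := minkowski_EFin mu (cmeasurable_normc mF) (cmeasurable_normc mG) (ler1n R 2).
apply: le_trans.
rewrite L2normE Lnorm2E; last by move=> x; rewrite addr_ge0 ?normc_nonneg.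
rewrite lee_sqrt; last by apply: integral_ge0 => x _; rewrite lee_fin sqr_ge0.
apply: ge0_le_integral => //.
- by move=> x _; rewrite lee_fin sqr_ge0.
- by apply: cmeasurable_sqr; exact: cmeasurableD.
- apply/measurable_EFinP; apply: measurable_funX.
  by apply: measurable_funD; exact: cmeasurable_normc.
- move=> x _; rewrite lee_fin ler_sqr ?nnegrE ?addr_ge0 ?normc_nonneg //.
  exact: le_normcD.
Qed.

Lemma sqr_normZ c F : cmeasurable F ->
  sqr_norm (fun x => c * F x) = ((normc c ^+ 2)%:E * sqr_norm F)%E.
Proof.
move=> mF; rewrite /sqr_norm -ge0_integralZl_EFin ?sqr_ge0 //.
- by apply: eq_integral => x _; rewrite -EFinM ComplexField.Normc.normcM exprMn.
- by move=> x _; rewrite lee_fin sqr_ge0.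
- exact: cmeasurable_sqr.
Qed.

Lemma L2normZ c F : cmeasurable F ->
  L2norm mu (fun x => c * F x)%R = ((normc c)%:E * L2norm mu F)%E.
Proof.
move=> mF; rewrite !L2normE sqr_normZ // sqrteM ?lee_fin ?sqr_ge0 //.
by rewrite /= sqrtr_sqr ger0_norm ?normc_nonneg.
Qed.

Lemma L2norm_sum (I : Type) (s : seq I) (f : I -> X -> R[i]) (e : I -> R) :
  (forall i, cmeasurable (f i)) -> (forall i, (L2norm mu (f i) <= (e i)%:E)%E) ->
  (L2norm mu (fun x => \sum_(i <- s) f i x)%R <= (\sum_(i <- s) e i)%:E)%E.
Proof.
move=> mf fe; elim: s => [|i s IH].
  rewrite big_nil L2normE /sqr_norm; under eq_integral => x _.
    rewrite big_nil ComplexField.Normc.normc0 expr0n /=; over.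
  by rewrite integral0 sqrte0.
rewrite big_cons (_ : (fun x => _) = (fun x => f i x + \sum_(j <- s) f j x)); last first.
  by apply/funext => x; rewrite big_cons.
apply: le_trans (L2norm_triangle _ _) _ => //; first exact: cmeasurable_sum.
by rewrite EFinD leeD.
Qed.

Lemma L2norm_bounded F (C : R) : cmeasurable F -> (forall x, normc (F x) <= C) ->
  (L2norm mu F <= C%:E)%E.
Proof.
move=> mF FC; have C0 : 0 <= C by apply: le_trans (FC point); exact: normc_nonneg.
apply/(L2norm_le F C0); apply: (@le_trans _ _ (\int[mu]_x (C ^+ 2)%:E)%E).
  apply: ge0_le_integral => //.
  - by move=> x _; rewrite lee_fin sqr_ge0.
  - exact: cmeasurable_sqr.
  - by move=> x _; rewrite lee_fin ler_sqr ?nnegrE ?normc_nonneg.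
by rewrite integral_cst // [X in (_ * X)%E]probability_setT mule1.
Qed.

Lemma parallelogram F G : cmeasurable F -> cmeasurable G ->
  (sqr_norm (fun x => F x - G x)%R + sqr_norm (fun x => F x + G x)%R =
   2%:E * sqr_norm F + 2%:E * sqr_norm G)%E.
Proof.
move=> mF mG.
rewrite /sqr_norm -!ge0_integralZl_EFin //; try exact: cmeasurable_sqr.
rewrite -!ge0_integralD //; try exact: cmeasurable_sqr.
- apply: eq_integral => x _; rewrite -!EFinM -!EFinD !normc_sqr.
  by case: (F x) => a b; case: (G x) => a' b' /=; congr (_%:E); ring.
1,3: by move=> x _; rewrite -EFinM lee_fin mulr_ge0 // sqr_ge0.
1,2: by apply: measurable_funeM; exact: cmeasurable_sqr.
- by move=> x _; rewrite lee_fin sqr_ge0.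
- by apply: cmeasurable_sqr; exact: cmeasurableB.
- by move=> x _; rewrite lee_fin sqr_ge0.
- by apply: cmeasurable_sqr; exact: cmeasurableD.
- by move=> x _; rewrite lee_fin sqr_ge0.
- by move=> x _; rewrite lee_fin sqr_ge0.
Qed.

End ComplexL2.

(** * Limits of bounded, rapidly Cauchy sequences *)

Section Completeness.
Import numFieldNormedType.Exports.
Context d (X : measurableType d) (R : realType) (mu : probability X R).
Notation normc := ComplexField.Normc.normc.

Lemma summable_increments_cvg (u h : nat -> R) :
  (forall n, `|u n.+1 - u n| <= h n) ->
  has_ubound (range (series h)) -> cvgn u.
Proof.
move=> uh hb.
have h0 n : 0 <= h n by apply: le_trans (uh n).
have ch : cvgn (series h).
  by apply: nondecreasing_is_cvgn => //; apply: nondecreasing_series => n _ _.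
have cu : cvgn (series (telescope u)).
  apply: normed_cvg; apply: (series_le_cvg _ h0 _ ch) => n; [exact: normr_ge0|exact: uh].
have -> : u = series (telescope u) \+ cst (u 0).
  by rewrite telescopeK; apply/funext => n /=; rewrite subrK.
by apply: is_cvgD => //; exact: is_cvg_cst.
Qed.

Lemma normc_Re_le (z : R[i]) : `|complex.Re z| <= normc z.
Proof.
by rewrite -ler_sqr ?nnegrE ?normc_nonneg // normc_sqr -normrX ger0_norm ?sqr_ge0 // lerDl sqr_ge0.
Qed.

Lemma normc_Im_le (z : R[i]) : `|complex.Im z| <= normc z.
Proof.
by rewrite -ler_sqr ?nnegrE ?normc_nonneg // normc_sqr -normrX ger0_norm ?sqr_ge0 // lerDr sqr_ge0.
Qed.

Context (f : nat -> X -> R[i]).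
Hypothesis mf : forall n, cmeasurable (f n).
Hypothesis f1 : forall n x, normc (f n x) <= 1.
Hypothesis fast : forall n,
  (sqr_norm mu (fun x => f n.+1 x - f n x)%R <= (((2 ^ n.+1)%:R)^-2)%:E)%E.

Let h n x := normc (f n.+1 x - f n x).
Let H x : \bar R := (\sum_(0 <= n <oo) (h n x)%:E)%E.

Let mh n : measurable_fun setT (h n).
Proof. by apply: cmeasurable_normc; exact: cmeasurableB. Qed.

(** The inequality of arithmetic and geometric means with weight [q] turns the bound [q^-2] on the
    integral of the square into the bound [q^-1] on the integral. *)
Let int_h n : (\int[mu]_x (h n x)%:E <= (1 / (2 ^ n.+1)%:R)%:E)%E.
Proof.
set q : R := (2 ^ n.+1)%:R; have q0 : 0 < q by rewrite ltr0n expn_gt0.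
have le_h x : h n x <= 2^-1 * q^-1 + 2^-1 * q * h n x ^+ 2.
  rewrite -subr_ge0 (_ : _ - _ = 2^-1 * q * (h n x - q^-1) ^+ 2); last first.
    by field; rewrite gt_eqF.
  by apply: mulr_ge0; [apply: mulr_ge0 => //; exact: ltW|exact: sqr_ge0].
apply: (@le_trans _ _ (\int[mu]_x ((2^-1 * q^-1)%:E + (2^-1 * q)%:E * (h n x ^+ 2)%:E))%E).
  apply: ge0_le_integral => //.
  - by move=> x _; rewrite lee_fin normc_nonneg.
  - by apply/measurable_EFinP; exact: mh.
  - apply: emeasurable_funD; first exact: measurable_cst.
    by apply: measurable_funeM; apply/measurable_EFinP; apply: measurable_funX; exact: mh.
  - by move=> x _; rewrite -EFinM -EFinD lee_fin.
have mh2 : measurable_fun setT (fun x => (h n x ^+ 2)%:E).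
  by apply/measurable_EFinP; apply: measurable_funX; exact: mh.
rewrite ge0_integralD //; last 3 first.
- by move=> x _; rewrite lee_fin; apply: mulr_ge0 => //; rewrite invr_ge0 ltW.
- by move=> x _; rewrite -EFinM lee_fin; apply: mulr_ge0 (sqr_ge0 _); apply: mulr_ge0 => //; exact: ltW.
- exact: measurable_funeM.
rewrite integral_cst // [X in (_ * X)%E]probability_setT mule1.
rewrite ge0_integralZl_EFin // ?mulr_ge0 ?(ltW q0) //; last first.
  by move=> x _; rewrite lee_fin sqr_ge0.
have := fast n; rewrite -/q /sqr_norm => fn.
have q20 : 0 <= 2^-1 * q by apply: mulr_ge0 => //; exact: ltW.
apply: le_trans (leeD2l _ (lee_wpmul2l _ fn)) _; first by rewrite lee_fin.
rewrite -EFinM -EFinD lee_fin (_ : _ + _ = 1 / q) //; field.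
by rewrite gt_eqF.
Qed.

Let H0 x : (0 <= H x)%E.
Proof. by apply: nneseries_ge0 => n _ _; rewrite lee_fin normc_nonneg. Qed.

Let mH : measurable_fun setT H.
Proof.
apply: ge0_emeasurable_sum => [n x _ _|n _]; first by rewrite lee_fin normc_nonneg.
by apply/measurable_EFinP; exact: mh.
Qed.

Let intH : (\int[mu]_x H x <= 1)%E.
Proof.
rewrite integral_nneseries //.
- apply: le_trans (epsilon_trick0 xpredT (@ler01 R)).
  apply: lee_nneseries => [n _ _|n _]; last exact: int_h.
  by apply: integral_ge0 => x _; rewrite lee_fin normc_nonneg.
- by move=> n; apply/measurable_EFinP; exact: mh.
- by move=> n x _; rewrite lee_fin normc_nonneg.
Qed.

Let E := [set x | H x < +oo]%E.

Let mE : measurable E.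
Proof.
have := emeasurable_fun_infty_o measurableT mH +oo%E.
by rewrite setTI.
Qed.

Let aeE : {ae mu, forall x, E x}.
Proof.
have iH : mu.-integrable setT H.
  apply/integrableP; split => //.
  under eq_integral => x _ do rewrite gee0_abs //.
  by rewrite (le_lt_trans intH) // ltry.
apply: filterS (integrable_ae measurableT iH) => x /(_ I).
by rewrite /E /= ltey_eq => ->.
Qed.

Let partial_sums x : E x -> has_ubound (range (series (h ^~ x))).
Proof.
rewrite /E /= => Ex; exists (fine (H x)) => _ [n _ <-].
rewrite -lee_fin fineK; last by rewrite ge0_fin_numE.
rewrite /series /= -sumEFin.
by apply: nneseries_lim_ge => m _ _; rewrite lee_fin normc_nonneg.
Qed.

(** Cutting off outside the set of summable increments makes the sequence converge at every point,
    so that its limit is measurable. *)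
Let fE n x : R[i] := (\1_E x)%:C%C * f n x.

Let cvg_Re x : cvgn (fun n => complex.Re (fE n x)).
Proof.
rewrite /fE indicE; have [xE|xE] := boolP (x \in E); last first.
  under eq_fun => n do rewrite mul0r /=.
  exact: is_cvg_cst.
apply: (@summable_increments_cvg _ (h ^~ x)); last by apply: partial_sums; exact/set_mem.
move=> n; rewrite mul1r mul1r; apply: le_trans (normc_Re_le _).
by case: (f n.+1 x) => ? ?; case: (f n x).
Qed.

Let cvg_Im x : cvgn (fun n => complex.Im (fE n x)).
Proof.
rewrite /fE indicE; have [xE|xE] := boolP (x \in E); last first.
  under eq_fun => n do rewrite mul0r /=.
  exact: is_cvg_cst.
apply: (@summable_increments_cvg _ (h ^~ x)); last by apply: partial_sums; exact/set_mem.
move=> n; rewrite mul1r mul1r; apply: le_trans (normc_Im_le _).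
by case: (f n.+1 x) => ? ?; case: (f n x).
Qed.

Let g x : R[i] := (limn (fun n => complex.Re (fE n x)) +i* limn (fun n => complex.Im (fE n x)))%C.

Let mfE n : cmeasurable (fE n).
Proof.
have m1 : measurable_fun setT (\1_E : X -> R) by exact: measurable_indic.
case: (mf n) => mR mI; split.
  apply: (eq_measurable_fun (fun x => \1_E x * complex.Re (f n x))).
    by move=> x _; rewrite /fE; case: (f n x) => ? ?; rewrite /= mul0r subr0.
  exact: measurable_funM.
apply: (eq_measurable_fun (fun x => \1_E x * complex.Im (f n x))).
  by move=> x _; rewrite /fE; case: (f n x) => ? ?; rewrite /= mul0r addr0.
exact: measurable_funM.
Qed.

Let mg : cmeasurable g.
Proof.
split.
  apply: (@measurable_fun_cvg _ _ _ _ (fun n x => complex.Re (fE n x))).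
    by move=> m; case: (mfE m).
  by move=> x _; exact: cvg_Re.
apply: (@measurable_fun_cvg _ _ _ _ (fun n x => complex.Im (fE n x))).
  by move=> m; case: (mfE m).
by move=> x _; exact: cvg_Im.
Qed.

Let fE1 n x : normc (fE n x) <= 1.
Proof.
rewrite /fE ComplexField.Normc.normcM indicE; have [_|_] := boolP (x \in E).
  by rewrite ComplexField.Normc.normc1 mul1r.
by rewrite ComplexField.Normc.normc0 mul0r.
Qed.

Let cvg_sqr x (z : R[i]) : (fun n => normc (fE n x - z) ^+ 2) @ \oo --> normc (g x - z) ^+ 2.
Proof.
have cR : (fun n => complex.Re (fE n x) - complex.Re z) @ \oo --> complex.Re (g x) - complex.Re z.
  by apply: cvgB; [exact: cvg_Re|exact: cvg_cst].
have cI : (fun n => complex.Im (fE n x) - complex.Im z) @ \oo --> complex.Im (g x) - complex.Im z.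
  by apply: cvgB; [exact: cvg_Im|exact: cvg_cst].
have -> : (fun n => normc (fE n x - z) ^+ 2) =
    (fun n => (complex.Re (fE n x) - complex.Re z) * (complex.Re (fE n x) - complex.Re z)) \+
    (fun n => (complex.Im (fE n x) - complex.Im z) * (complex.Im (fE n x) - complex.Im z)).
  by apply/funext => n; rewrite normc_sqr /= -!expr2; case: (fE n x) => ? ?; case: z {cR cI}.
rewrite normc_sqr !expr2.
have -> : complex.Re (g x - z) = complex.Re (g x) - complex.Re z.
  by case: (g x) => ? ?; case: z {cR cI}.
have -> : complex.Im (g x - z) = complex.Im (g x) - complex.Im z.
  by case: (g x) => ? ?; case: z {cR cI}.
by apply: cvgD; apply: cvgM.
Qed.

Let g1 x : normc (g x) <= 1.
Proof.
rewrite -[leLHS]expr1 -(ler_pXn2r (ltn0Sn 1)) ?nnegrE ?normc_nonneg // expr1 expr1n.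
have := @cvg_sqr x 0; rewrite subr0 => cx.
rewrite -(cvg_lim _ cx) //; apply: limr_le; first by apply/cvg_ex; exists (normc (g x) ^+ 2).
by apply: nearW => n; rewrite subr0 exprn_ile1 // normc_nonneg.
Qed.

Lemma fast_Cauchy_cvg : exists g, [/\ cmeasurable g, forall x, normc (g x) <= 1 &
  forall eps : R, 0 < eps -> exists N, forall n, (N <= n)%N ->
    (L2norm mu (fun x => f n x - g x)%R <= eps%:E)%E].
Proof.
exists g; split => // eps eps0.
have mF n : measurable_fun setT (fun x => (normc (f n x - g x) ^+ 2)%:E).
  by apply: cmeasurable_sqr; exact: cmeasurableB.
(* The constant 4 bounds the square of a difference of two functions bounded by 1. *)
have [||||_ _] := @dominated_convergence _ _ _ mu setT measurableT
    (fun n x => (normc (f n x - g x) ^+ 2)%:E) (cst 0%E) (cst 4%:E) mF.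
- exact: measurable_cst.
- apply: filterS aeE => x Ex _; apply: cvg_EFin; first exact: nearW.
  have := @cvg_sqr x (g x); rewrite subrr ComplexField.Normc.normc0 expr0n /=.
  rewrite [X in X @ _](_ : _ = fun n => normc (f n x - g x) ^+ 2) //.
  by apply/funext => n; rewrite /fE indicE mem_set //= mul1r.
- exact: finite_measure_integrable_cst.
- apply: nearW => x n _; rewrite gee0_abs ?lee_fin ?sqr_ge0 //.
  have := le_normcD (f n x) (- g x); rewrite normcN => le2.
  have : normc (f n x - g x) <= 2.
    by apply: le_trans le2 _; rewrite (_ : 2 = 1 + 1) // lerD.
  have := normc_nonneg (f n x - g x); nra.
rewrite integral0 => /fine_cvgP[fin /cvgrPdist_lt /(_ (eps ^+ 2))].
rewrite exprn_gt0 // => /(_ isT) small; have [] := filterI fin small.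
move=> N _ NP; exists N => n /NP[/= fn]; rewrite sub0r normrN => lt_n.
apply/L2norm_le; first exact: ltW.
rewrite /sqr_norm -(fineK fn) lee_fin ltW //; apply: le_lt_trans lt_n.
exact: ler_norm.
Qed.

End Completeness.

(** * Eigenfunctions as norm-minimal averages *)

Section Eigenprojection.
Import numFieldNormedType.Exports.
Context d (X : measurableType d) (R : realType) (mu : probability X R).
Context (S : R -> X -> X).
Hypothesis SD : forall s t x, S (s + t) x = S s (S t x).
Hypothesis mS : forall t, measurable_fun setT (S t).
Hypothesis muS : forall t A, measurable A -> mu (S t @^-1` A) = mu A.
Implicit Types (F G : X -> R[i]) (w v : seq (R * R)).
Notation normc := ComplexField.Normc.normc.
Notation cis := (@cis R).

Lemma cmeasurable_flow t F : cmeasurable F -> cmeasurable (fun x => F (S t x)).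
Proof.
move=> [mR mI]; split.
  exact: (measurableT_comp mR (mS t)).
exact: (measurableT_comp mI (mS t)).
Qed.

Lemma sqr_norm_flow t F : cmeasurable F ->
  sqr_norm mu (fun x => F (S t x)) = sqr_norm mu F.
Proof.
move=> mF; rewrite /sqr_norm.
have := @ge0_integral_pushforward _ _ _ _ _ (S t) (mS t) mu setT
  (fun x => (normc (F x) ^+ 2)%:E) measurableT (cmeasurable_sqr mF).
rewrite preimage_setT => /(_ _)/esym; rewrite /comp => -> //; last first.
  by move=> x _; rewrite lee_fin sqr_ge0.
by apply: eq_measure_integral => A mA _; exact: muS.
Qed.

Lemma L2norm_flow t F : cmeasurable F -> L2norm mu (fun x => F (S t x)) = L2norm mu F.
Proof. by move=> mF; rewrite !L2normE sqr_norm_flow. Qed.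

Definition avg w b F x : R[i] :=
  \sum_(p <- w) (p.1%:C%C * cis (- (b * p.2))) * F (S p.2 x).

Lemma cmeasurable_avg w b F : cmeasurable F -> cmeasurable (avg w b F).
Proof.
by move=> mF; apply: cmeasurable_sum => p; apply: cmeasurableZ; exact: cmeasurable_flow.
Qed.

Lemma avg_mul w v b F : avg (weights_mul w v) b F = avg w b (avg v b F).
Proof.
apply/funext => x; rewrite /avg /weights_mul /trig_mul big_allpairs_dep.
apply: eq_bigr => p _; rewrite mulr_sumr; apply: eq_bigr => q _ /=.
rewrite addrC SD rmorphM (_ : - (b * (q.2 + p.2)) = - (b * p.2) + - (b * q.2)); last by ring.
by rewrite cisD; ring.
Qed.

Lemma avg1 t b F x : avg [:: (1, t)] b F x = cis (- (b * t)) * F (S t x).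
Proof. by rewrite /avg big_seq1 mul1r. Qed.

Lemma avgC w v b F : avg w b (avg v b F) = avg v b (avg w b F).
Proof.
apply/funext => x; rewrite /avg.
under eq_bigr do rewrite mulr_sumr; rewrite exchange_big /=.
apply: eq_bigr => p _; rewrite mulr_sumr; apply: eq_bigr => q _.
by rewrite -!SD [q.2 + _]addrC mulrCA.
Qed.

Let normc_coef (p : R * R) b : normc (p.1%:C%C * cis (- (b * p.2))) = `|p.1|.
Proof.
by rewrite ComplexField.Normc.normcM normc_cis mulr1 /= expr0n addr0 sqrtr_sqr.
Qed.

Lemma normc_avg_le w b F x : weights w -> (forall x, normc (F x) <= 1) ->
  normc (avg w b F x) <= 1.
Proof.
move=> [/allP w0 w1] F1; apply: (@le_trans _ _ (\sum_(p <- w) `|p.1|)).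
  rewrite /avg; elim: (w) => [|p u IH]; first by rewrite !big_nil ComplexField.Normc.normc0.
  rewrite !big_cons; apply: le_trans (le_normcD _ _) (lerD _ IH).
  by rewrite ComplexField.Normc.normcM normc_coef ler_piMr.
by rewrite (eq_big_seq (fun p : R * R => p.1)) ?w1 // => p /w0 p0; rewrite ger0_norm.
Qed.

Lemma L2norm_avg w b F (e : R) : weights w -> cmeasurable F ->
  (L2norm mu F <= e%:E)%E -> (L2norm mu (avg w b F) <= e%:E)%E.
Proof.
move=> [/allP w0 w1] mF Fe.
have -> : e = \sum_(p <- w) (`|p.1| * e).
  rewrite -mulr_suml (eq_big_seq (fun p : R * R => p.1)) ?w1 ?mul1r //.
  by move=> p /w0 p0; rewrite ger0_norm.
apply: L2norm_sum => p; first by apply: cmeasurableZ; exact: cmeasurable_flow.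
rewrite L2normZ ?normc_coef; last exact: cmeasurable_flow.
by rewrite L2norm_flow // EFinM lee_wpmul2l // lee_fin.
Qed.

Section NearMinimal.
Context (b : R) (F : X -> R[i]).
Hypothesis mF : cmeasurable F.
Hypothesis F1 : forall x, normc (F x) <= 1.

Let N w := fine (sqr_norm mu (avg w b F)).

Let sqr_le w : weights w -> (sqr_norm mu (avg w b F) <= 1%:E)%E.
Proof.
move=> ww; rewrite -(expr1n _ 2); apply/L2norm_le => //.
by apply: L2norm_bounded; [exact: cmeasurable_avg|move=> x; exact: normc_avg_le].
Qed.

Let NE w : weights w -> sqr_norm mu (avg w b F) = (N w)%:E.
Proof.
move=> ww; rewrite /N fineK // ge0_fin_numE ?sqr_norm_ge0 //.
by apply: le_lt_trans (sqr_le ww) _; rewrite ltry.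
Qed.

Let N0 w : 0 <= N w.
Proof. exact/fine_ge0/sqr_norm_ge0. Qed.

Let m := inf [set N w | w in weights].

Let weights1 (t : R) : weights [:: (1, t)].
Proof. by split; rewrite /= ?ler01 // big_seq1. Qed.

Let has_infN : has_inf [set N w | w in weights].
Proof.
split; first by exists (N [:: (1, 0)]); exists [:: (1, 0)].
by exists 0 => _ [w _ <-].
Qed.

Let m_le w : weights w -> m <= N w.
Proof. by move=> ww; apply: ge_inf; [case: has_infN|exists w]. Qed.

Let near_min (e : R) w := weights w /\ N w < m + e.

Let exists_near_min e : 0 < e -> exists w, near_min e w.
Proof.
move=> e0; have [_ [w ww <-] lt_w] := inf_adherent e0 has_infN.
by exists w.
Qed.

(** Averaging does not increase the norm, so near-minimality survives convolution with any [v]. *)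
Let near_min_mul e w v : near_min e w -> weights v -> near_min e (weights_mul v w).
Proof.
move=> [ww Nw] wv; split; first exact: weights_mulP.
apply: le_lt_trans Nw; rewrite -lee_fin -!NE //; last exact: weights_mulP.
rewrite avg_mul.
have : (L2norm mu (avg w b F) <= (Num.sqrt (N w))%:E)%E.
  by apply/L2norm_le; rewrite ?sqrtr_ge0 // sqr_sqrtr // NE.
move=> /(L2norm_avg b wv (cmeasurable_avg w b mF)) /L2norm_le.
by rewrite sqrtr_ge0 sqr_sqrtr // NE //; exact.
Qed.

Let half w w' : seq (R * R) := [seq (p.1 / 2, p.2) | p <- w ++ w'].

(** Half the sum of two averages is again an average, with squared norm at least [m]; the
    parallelogram law then bounds the difference. *)
Let near_min_close e w w' : near_min e w -> near_min e w' ->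
  (sqr_norm mu (fun x => avg w b F x - avg w' b F x)%R <= (4 * e)%:E)%E.
Proof.
move=> [ww Nw] [ww' Nw'].
have wh : weights (half w w').
  case: ww ww' => [/allP w0 w1] [/allP w'0 w'1]; split.
    apply/allP => _ /mapP[p + ->] /=; rewrite mem_cat => /orP[/w0|/w'0] p0;
    by rewrite mulr_ge0 // invr_ge0.
  rewrite big_map big_cat /= -!mulr_suml w1 w'1; lra.
have avgh x : avg w b F x + avg w' b F x = 2%:R * avg (half w w') b F x.
  rewrite /avg big_map big_cat /= mulrDr !mulr_sumr; congr (_ + _);
  apply: eq_bigr => p _; rewrite rmorphM /= !mulrA; congr (_ * _ * _).
    by rewrite fmorphV rmorph_nat /=; field.
  by rewrite fmorphV rmorph_nat /=; field.
have := parallelogram mu (cmeasurable_avg w b mF) (cmeasurable_avg w' b mF).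
rewrite (_ : (fun x => avg w b F x + avg w' b F x) = (fun x => 2%:R * avg (half w w') b F x)); last first.
  exact/funext.
rewrite sqr_normZ; last exact: cmeasurable_avg.
have -> : normc (2%:R : R[i]) = 2.
  by rewrite -(rmorph_nat (real_complex R) 2) /= expr0n addr0 sqrtr_sqr ger0_norm.
rewrite !NE // -!EFinM -EFinD.
case: (sqr_norm _ _) => [r| |] //=; rewrite -EFinD => -[E]; rewrite lee_fin.
by have := m_le wh; lra.
Qed.

(** A mean ergodic theorem in the manner of Alaoglu and Birkhoff: near-minimal averages are Cauchy,
    and their limit is invariant under the twisted translations since these preserve
    near-minimality. The freedom in [v] lets one set of weights serve several frequencies. *)
Lemma eigenprojection : exists g, [/\ cmeasurable g, forall x, normc (g x) <= 1,
  forall t, {ae mu, forall x, g (S t x) = cis (b * t) * g x} &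
  forall eps : R, 0 < eps -> exists2 w, weights w & forall v, weights v ->
    (L2norm mu (fun x => avg (weights_mul v w) b F x - g x)%R <= eps%:E)%E].
Proof.
(* Chosen so that [4 * e n] from [near_min_close] is the rate that [fast_Cauchy_cvg] asks for. *)
pose e n : R := ((2 ^ n.+2)%:R)^-2.
have e0 n : 0 < e n by rewrite invr_gt0 exprn_gt0 // ltr0n expn_gt0.
have eS n : 4 * e n = ((2 ^ n.+1)%:R)^-2.
  rewrite /e expnS natrM; field; rewrite pnatr_eq0 -lt0n expn_gt0 //.
have e_small (eta : R) : 0 < eta -> exists n, forall m', (n <= m')%N -> e m' <= eta.
  move=> eta0; exists (Num.bound eta^-1) => n le_n.
  rewrite -[leRHS]invrK lef_pV2 ?posrE ?invr_gt0 // ?exprn_gt0 ?ltr0n ?expn_gt0 //.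
  have : eta^-1 < n%:R.
    apply: lt_le_trans (archi_boundP _) _; first by rewrite invr_ge0 ltW.
    by rewrite ler_nat.
  move=> /ltW lt_n; apply: le_trans lt_n _; rewrite -natrX ler_nat.
  apply: leq_trans (ltnW (ltn_expl n (isT : (1 < 2)%N))) _.
  by rewrite -expnM leq_exp2l //; lia.
have /choice[w wP] : forall n, exists w, near_min (e n) w by move=> n; exact: exists_near_min.
have near_minW x y u : x <= y -> near_min x u -> near_min y u.
  by move=> xy [wu Nu]; split => //; apply: lt_le_trans Nu _; rewrite lerD2l.
have [||n|g [mg g1 cg]] := @fast_Cauchy_cvg _ _ _ mu (fun n => avg (w n) b F).
- by move=> n; exact: cmeasurable_avg.
- by move=> n x; apply: normc_avg_le => //; case: (wP n).
- rewrite -eS; apply: near_min_close (wP n); apply: near_minW (wP n.+1).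
  rewrite -(ler_pM2l (ltr0Sn R 3)) !eS lef_pV2 ?posrE ?exprn_gt0 ?ltr0n ?expn_gt0 //.
  by rewrite -!natrX ler_nat leq_exp2r // leq_exp2l.
(* With 16, the factor 4 of [near_min_close] gives [(eps / 2) ^+ 2]; the other half is the distance
   from [w n] to the limit. *)
have close_g u (eps : R) : 0 < eps -> near_min (eps ^+ 2 / 16) u ->
    (L2norm mu (fun x => avg u b F x - g x)%R <= eps%:E)%E.
  move=> eps0 nu; have e20 : 0 < eps ^+ 2 / 16 by rewrite divr_gt0 ?exprn_gt0.
  have [n1 n1P] := e_small _ e20.
  have [n2 n2P] := cg (eps / 2) (divr_gt0 eps0 (ltr0Sn _ 1)).
  pose n := maxn n1 n2.
  have nn : near_min (eps ^+ 2 / 16) (w n).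
    by apply: near_minW (wP n); apply: n1P; rewrite leq_maxl.
  have := near_min_close nu nn.
  rewrite (_ : 4 * (eps ^+ 2 / 16) = (eps / 2) ^+ 2); last by field.
  move=> /(L2norm_le _ _ (divr_ge0 (ltW eps0) (ler0n _ 2))) d1.
  have d2 := n2P n (leq_maxr _ _).
  have := L2norm_triangle mu (cmeasurableB (cmeasurable_avg u b mF) (cmeasurable_avg (w n) b mF))
    (cmeasurableB (cmeasurable_avg (w n) b mF) mg).
  rewrite (_ : (fun x => _) = (fun x => avg u b F x - g x)); last first.
    by apply/funext => x; rewrite addrA subrK.
  move=> le_t; apply: le_trans le_t _; rewrite [X in (_ <= X%:E)%E]splitr EFinD.
  exact: leeD.
exists g; split=> // [t|eps eps0]; last first.
  have [|u uP] := @exists_near_min (eps ^+ 2 / 16); first by rewrite divr_gt0 ?exprn_gt0.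
  exists u => [|v wv]; first by case: uP.
  by apply: close_g => //; exact: near_min_mul.
(* The defect of the eigenvalue equation. The average for [u] and its translate by [t] are both
   close to [g], which forces the norm of [G] to vanish. *)
pose G x := cis (- (b * t)) * g (S t x) - g x.
have mgt := cmeasurable_flow t mg.
have mG : cmeasurable G by apply: cmeasurableB => //; exact: cmeasurableZ.
have G0 : (L2norm mu G <= 0)%E.
  apply/lee_addgt0Pr => eps eps0; rewrite add0e.
  have e20 : 0 < eps / 2 by rewrite divr_gt0.
  have [|u uP] := @exists_near_min ((eps / 2) ^+ 2 / 16).
    by rewrite divr_gt0 ?exprn_gt0.
  have mu' := cmeasurable_avg u b mF.
  have d1 := close_g _ _ e20 uP.
  have d2 := close_g _ _ e20 (near_min_mul uP (weights1 t)).
  have mB := cmeasurableB mu' mg.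
  have mC := cmeasurableZ (- cis (- (b * t))) (cmeasurable_flow t mB).
  have mD := cmeasurableB (cmeasurable_avg (weights_mul [:: (1, t)] u) b mF) mg.
  have := L2norm_triangle mu mC mD.
  rewrite (_ : (fun x => _) = G); last first.
    apply/funext => x; rewrite avg_mul avg1 /G; ring.
  move=> le_t; apply: le_trans le_t _; rewrite [X in (_ <= X%:E)%E]splitr EFinD.
  apply: leeD => //; rewrite L2normZ ?normcN ?normc_cis ?mul1e; last exact: (cmeasurable_flow t mB).
  by rewrite (L2norm_flow t mB).
have sG : sqr_norm mu G = 0%E.
  apply/eqP; rewrite eq_le sqr_norm_ge0 andbT.
  by have /(L2norm_le _ _ (lexx (0 : R))) := G0; rewrite expr0n.
have := @ae_eq_integral_abs _ _ _ mu setT measurableT _ (cmeasurable_sqr mG).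
have -> : (\int[mu]_x `|(normc (G x) ^+ 2)%:E| = 0)%E.
  by rewrite -[RHS]sG; apply: eq_integral => x _; rewrite gee0_abs ?lee_fin ?sqr_ge0.
move=> [/(_ erefl) + _]; apply: filterS => x /(_ I) [/eqP].
rewrite expf_eq0 /= => /eqP/ComplexField.Normc.eq0_normc /eqP.
rewrite subr_eq0 => /eqP <-; rewrite mulrA -cisD subrr cis0 mul1r //.
Qed.

End NearMinimal.

End Eigenprojection.

(** * Concentration of products of Fejer kernels *)

Section FejerKernel.
Context {R : realType}.
Implicit Types (bs : seq R) (w v : seq (R * R)) (t b : R).
Notation normc := ComplexField.Normc.normc.
Notation cis := (@cis R).

Definition fejer_kernel n bs : seq (R * R) :=
  foldr (fun b L => trig_mul (fejer n b) L) [:: (1, 0)] bs.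

Definition kernel n bs t : R := \prod_(b <- bs) (n%:R^-1 * normc (dirichlet n b t) ^+ 2).

Let factor_ge0 n b t : 0 <= n%:R^-1 * normc (dirichlet n b t) ^+ 2.
Proof. by apply: mulr_ge0; rewrite ?invr_ge0 ?ler0n ?sqr_ge0. Qed.

Lemma kernel_ge0 n bs t : 0 <= kernel n bs t.
Proof. by apply: prodr_ge0 => b _; exact: factor_ge0. Qed.

Lemma trig_fejer_kernel n bs t : trig (fejer_kernel n bs) t = (kernel n bs t)%:C%C.
Proof.
rewrite /kernel; elim: bs => [|b bs IH] /=.
  by rewrite big_nil /trig big_seq1 /= mul0r cis0 mulr1.
by rewrite trig_mulE IH trig_fejer big_cons [in RHS]rmorphM.
Qed.

Lemma fejer_kernel_nonneg n bs : nonneg_coefs (fejer_kernel n bs).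
Proof.
elim: bs => [|b bs IH] /=; first by rewrite /nonneg_coefs /= ler01.
by apply: nonneg_coefs_mul => //; exact: fejer_nonneg.
Qed.

Lemma fejer_kernel_constant n bs : (0 < n)%N -> 1 <= constant_term (fejer_kernel n bs).
Proof.
move=> n0; elim: bs => [|b bs IH] /=.
  by rewrite /constant_term big_mkcond big_seq1 /= eqxx.
apply: le_trans (constant_term_mul (fejer_nonneg _ _) (fejer_kernel_nonneg _ _)).
rewrite -[leLHS](mulr1 1); apply: ler_pM => //; exact: fejer_constant.
Qed.

Lemma mean_kernel n bs w : weights w ->
  (forall x, x \in fejer_kernel n bs -> x.2 != 0 -> kills w x.2) ->
  \sum_(p <- w) p.1 * kernel n bs p.2 = constant_term (fejer_kernel n bs).
Proof.
move=> ww wk; apply: (@complexI R); rewrite -(average_trig ww wk) rmorph_sum /=.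
by apply: eq_bigr => p _; rewrite rmorphM trig_fejer_kernel.
Qed.

(* Averaging over [w] turns the kernels into their constant terms as soon as [w]
   kills all their nonzero frequencies. *)
Lemma kernel_concentrates bs (del eps : R) : 0 < del -> 0 < eps ->
  exists n w, [/\ weights w, 1 <= constant_term (fejer_kernel n bs) &
    forall v, weights v -> let u := weights_mul v w in
      \sum_(p <- u) p.1 * kernel n bs p.2 = constant_term (fejer_kernel n bs) /\
      \sum_(p <- u | ~~ `[<bohr bs del p.2>]) p.1 * kernel n bs p.2 <=
        eps * constant_term (fejer_kernel n bs)].
Proof.
move=> del0 eps0.
(* Bounds a Fejer factor whose character is at distance at least [del] from 1. *)
pose C (n : nat) : R := n%:R^-1 * (2 / del) ^+ 2.
have C0 n : 0 <= C n.
  by apply: mulr_ge0; [rewrite invr_ge0|exact: sqr_ge0].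
have [n n0 Cn] : exists2 n, (0 < n)%N & (size bs)%:R * C n <= eps.
  pose D : R := (size bs)%:R * (2 / del) ^+ 2 / eps.
  have D0 : 0 <= D by apply: divr_ge0 (ltW eps0); apply: mulr_ge0 => //; exact: sqr_ge0.
  exists (Num.bound D).+1 => //; have := archi_boundP D0; set N := Num.bound D => ltD.
  have ltD' : D <= N.+1%:R by rewrite (le_trans (ltW ltD)) // ler_nat.
  rewrite /C mulrCA ler_pdivrMl ?ltr0n // -ler_pdivrMr //.
(* Besides the full kernel, the kernels with one factor removed must have their means computed.
   [b :: rem b bs] is a permutation of [bs], whose kernel is the same function but another list. *)
pose freqs := [seq x.2 | x <- fejer_kernel n bs ++
  flatten [seq fejer_kernel n (rem b bs) ++ fejer_kernel n (b :: rem b bs) | b <- bs]].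
have [w ww wk] := exists_kills freqs.
exists n, w; split => //; first exact: fejer_kernel_constant.
move=> v wv u; have wu : weights u by exact: weights_mulP.
have uk b : b \in freqs -> b != 0 -> kills u b.
  by move=> bf b0; apply: kills_mul; right; exact: wk.
have mean : \sum_(p <- u) p.1 * kernel n bs p.2 = constant_term (fejer_kernel n bs).
  apply: mean_kernel => // x xL; apply: uk; apply/mapP; exists x => //.
  by rewrite mem_cat xL.
split => //.
(* Restoring the factor of [b] multiplies the constant term by at least 1. *)
have mean_rem b : b \in bs ->
    \sum_(p <- u) p.1 * kernel n (rem b bs) p.2 <= constant_term (fejer_kernel n bs).
  move=> bbs.
  have sub x : x \in fejer_kernel n (rem b bs) ++ fejer_kernel n (b :: rem b bs) -> x.2 \in freqs.
    move=> xL; apply/mapP; exists x => //; rewrite mem_cat; apply/orP; right.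
    by apply/flattenP; eexists; [apply/mapP; exists b; [exact: bbs|reflexivity]|].
  rewrite mean_kernel //; last by move=> x xL; apply: uk; apply: sub; rewrite mem_cat xL.
  rewrite -mean.
  have -> : \sum_(p <- u) p.1 * kernel n bs p.2 = \sum_(p <- u) p.1 * kernel n (b :: rem b bs) p.2.
    by apply: eq_bigr => p _; rewrite /kernel (perm_big _ (perm_to_rem bbs)).
  rewrite mean_kernel //; last by move=> x xL; apply: uk; apply: sub; rewrite mem_cat xL orbT.
  apply: le_trans (constant_term_mul (fejer_nonneg _ _) (fejer_kernel_nonneg _ _)).
  rewrite -[leLHS]mul1r ler_wpM2r ?fejer_constant //.
  by apply: le_trans ler01 _; exact: fejer_kernel_constant.
have u0 p : p \in u -> 0 <= p.1 by case: wu => /allP + _ => /[apply].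
(* Outside the Bohr set some factor is at most [C n]; summing over all [b] avoids choosing which. *)
apply: (@le_trans _ _ (\sum_(p <- u) \sum_(b <- bs) C n * (p.1 * kernel n (rem b bs) p.2))).
  rewrite big_mkcond /= big_seq [leRHS]big_seq; apply: ler_sum => p pu.
  have summand b : 0 <= C n * (p.1 * kernel n (rem b bs) p.2).
    by apply: mulr_ge0 => //; apply: mulr_ge0; [exact: u0|exact: kernel_ge0].
  case: ifPn => [/asboolP nb|_]; last by apply: sumr_ge0.
  have [b bbs bb] : exists2 b, b \in bs & del <= normc (1 - cis (b * p.2)).
    apply: contrapT => H; apply: nb => b bbs; rewrite ltNge; apply/negP => le_b.
    by apply: H; exists b.
  rewrite (perm_big _ (perm_to_rem bbs)) big_cons /= -[leLHS]addr0.
  apply: lerD; last by apply: sumr_ge0.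
  rewrite mulrCA ler_wpM2l ?u0 // /kernel (perm_big _ (perm_to_rem bbs)) big_cons.
  rewrite ler_wpM2r ?kernel_ge0 // ler_wpM2l ?invr_ge0 //.
  have := dirichlet_le n del0 bb; have := sqrtr_ge0.
  by move=> _ le2; rewrite ler_sqr ?nnegrE // ?(le_trans _ le2) ?normc_nonneg.
rewrite exchange_big /=.
apply: (@le_trans _ _ (\sum_(b <- bs) C n * constant_term (fejer_kernel n bs))).
  rewrite big_seq [leRHS]big_seq; apply: ler_sum => b bbs.
  by rewrite -mulr_sumr ler_wpM2l ?mean_rem.
rewrite big_const_seq count_predT iter_addr_0 -mulr_natl mulrA ler_wpM2r //.
by apply: le_trans ler01 _; exact: fejer_kernel_constant.
Qed.

End FejerKernel.

Section AlmostPeriodicApproximation.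
Import numFieldNormedType.Exports.
Context d (X : measurableType d) (R : realType) (mu : probability X R).
Context (S : R -> X -> X).
Hypothesis SD : forall s t x, S (s + t) x = S s (S t x).
Hypothesis mS : forall t, measurable_fun setT (S t).
Hypothesis muS : forall t A, measurable A -> mu (S t @^-1` A) = mu A.
Implicit Types (F G : X -> R[i]) (A : set X).
Notation normc := ComplexField.Normc.normc.
Notation cis := (@cis R).

Definition eigen F := L2 mu F /\ exists b, forall t,
  {ae mu, forall x, F (S t x) = cis (b * t) * F x}.

Definition spanned (E : set (X -> R[i])) F := exists n (c : 'I_n -> R[i]) (f : 'I_n -> X -> R[i]),
  (forall i, E (f i)) /\ F = fun x => \sum_(i < n) c i * f i x.

Definition approximable F := forall eps : R, 0 < eps ->
  exists2 G, spanned eigen G & (L2norm mu (fun x => F x - G x)%R <= eps%:E)%E.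

Definition cindic A x : R[i] := (\1_A x)%:C%C.

Lemma normc_real (r : R) : normc r%:C%C = `|r|.
Proof. by rewrite /= expr0n addr0 sqrtr_sqr. Qed.

Lemma cmeasurable_real (f : X -> R) : measurable_fun setT f -> cmeasurable (fun x => (f x)%:C%C).
Proof. by move=> mf; split => //; exact: measurable_cst. Qed.

Lemma cmeasurable_cindic A : measurable A -> cmeasurable (cindic A).
Proof. by move=> mA; apply: cmeasurable_real; exact: measurable_indic. Qed.

Lemma normc_cindic_le A x : normc (cindic A x) <= 1.
Proof. by rewrite normc_real ger0_norm // indicE lern1 leq_b1. Qed.

Lemma L2norm_cindicB A t (e : R) : measurable A -> 0 <= e ->
  (mu (A `+` S t @^-1` A) <= (e ^+ 2)%:E)%E ->
  (L2norm mu (fun x => cindic A (S t x) - cindic A x)%R <= e%:E)%E.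
Proof.
move=> mA e0 le_e; apply/(L2norm_le _ _ e0); apply: le_trans le_e.
have mB := measurable_setY mA (measurable_preimageS mS t mA).
rewrite -[in leRHS](setIT (_ `+` _)) -integral_indic // /sqr_norm le_eqVlt; apply/orP; left.
apply/eqP; apply: eq_integral => x _; congr (_%:E).
rewrite /cindic -rmorphB normc_real real_normK ?num_real // !indicE /setY in_setU !in_setD.
have -> : (x \in S t @^-1` A) = (S t x \in A) by apply/idP/idP; rewrite !inE.
by case: (x \in A); case: (S t x \in A) => /=; rewrite ?subrr ?subr0 ?sub0r ?sqrrN ?expr0n ?expr1n.
Qed.

Lemma bounded_L2 F (C : R) : cmeasurable F -> (forall x, normc (F x) <= C) -> L2 mu F.
Proof.
move=> mF FC; case: (mF) => ? ?; split=> //.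
by apply: le_lt_trans (L2norm_bounded mu mF FC) _; rewrite ltry.
Qed.

Lemma eigenprojections F : cmeasurable F -> (forall x, normc (F x) <= 1) ->
  exists g : R -> X -> R[i], (forall b, eigen (g b) /\ cmeasurable (g b)) /\
    forall (bs : seq R) (eps : R), 0 < eps -> exists2 w, weights w &
      forall b, b \in bs -> forall v, weights v ->
      (L2norm mu (fun x => avg S (weights_mul v w) b F x - g b x)%R <= eps%:E)%E.
Proof.
move=> mF F1.
have /choice[g gP] : forall b, exists g, [/\ cmeasurable g, forall x, normc (g x) <= 1,
    forall t, {ae mu, forall x, g (S t x) = cis (b * t) * g x} &
    forall eps : R, 0 < eps -> exists2 w, weights w & forall v, weights v ->
    (L2norm mu (fun x => avg S (weights_mul v w) b F x - g x)%R <= eps%:E)%E].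
  by move=> b; exact: eigenprojection.
exists g; split=> [b|bs eps eps0].
  have [mg g1 ge _] := gP b; split=> //; split; last by exists b.
  exact: bounded_L2 g1.
elim: bs => [|b bs [w ww wP]]; first by exists [:: (1, 0)] => //; split; rewrite /= ?ler01 // big_seq1.
have [_ _ _ /(_ eps eps0)[w' ww' w'P]] := gP b.
exists (weights_mul w' w); first exact: weights_mulP.
move=> c; rewrite inE => /orP[/eqP->|cbs] v wv.
  rewrite avg_mul // avg_mul // [avg S w' _ _]avgC // -!avg_mul //.
  apply: w'P; exact: weights_mulP.
by rewrite !avg_mul // -avg_mul // -avg_mul //; apply: wP => //; exact: weights_mulP.
Qed.

(** Averaging the translates of [F] against the kernel gives [kappa] times [F] up to an error [G],
    which is small by almost periodicity. Expanding the kernel into frequencies writes the same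
    average as a combination of averages [avg], each close to an eigenfunction. *)
Lemma approximable_cindic A : almost_periodic mu S A -> approximable (cindic A).
Proof.
move=> [mA apA] eps eps0; set F := cindic A.
have mF : cmeasurable F := cmeasurable_cindic mA.
have F1 x : normc (F x) <= 1 := normc_cindic_le A x.
pose e := eps / 3; have e0 : 0 < e by rewrite divr_gt0.
have [bs [del [del0 bohrA]]] := apA (e ^+ 2) (exprn_gt0 2 e0).
have [n [w [ww kappa1 conc]]] := kernel_concentrates bs del0 e0.
set L := fejer_kernel n bs in kappa1 conc; set kappa := constant_term L in kappa1 conc.
have kappa0 : 0 < kappa by exact: lt_le_trans ltr01 kappa1.
have [g [gE gP]] := eigenprojections mF F1.
pose M := \sum_(l <- L) `|l.1 / kappa|.
have M0 : 0 <= M by apply: sumr_ge0.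
(* The sign compensates the one in [avg]; the denominator [1 + M] is positive and absorbs the sum of
   the coefficients. *)
have [w' ww' w'P] := gP [seq - l.2 | l <- L] (e / (1 + M)) ltac:(by rewrite divr_gt0 // ltr_wpDr).
(* The convolution [u] inherits the properties of both [w] and [w'], as each is stable under
   convolution. *)
have [mean bad] := conc w' ww'; set u := weights_mul w' w in mean bad.
have wu : weights u by exact: weights_mulP.
have u0 p : p \in u -> 0 <= p.1 by case: wu => /allP + _ => /[apply].
pose l i := tnth (in_tuple L) i.
pose K := kernel n bs.
pose D t x := F (S t x) - F x.
have mD t : cmeasurable (D t) by apply: cmeasurableB => //; exact: cmeasurable_flow.
pose G x := \sum_(p <- u) (p.1 * K p.2)%:C%C * D p.2 x.
pose e' i := avg S u (- (l i).2) F.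
have me' i : cmeasurable (e' i) by exact: cmeasurable_avg.
pose H x := \sum_(i < size L) ((l i).1 / kappa)%:C%C * g (- (l i).2) x.
exists H; first by exists (size L), (fun i => ((l i).1 / kappa)%:C%C), (fun i => g (- (l i).2));
  split=> // i; case: (gE (- (l i).2)).
have sumE x : \sum_(i < size L) (l i).1%:C%C * e' i x = G x + kappa%:C%C * F x.
  rewrite /G -mean rmorph_sum /= mulr_suml -big_split /=.
  transitivity (\sum_(i < size L) \sum_(p <- u)
      (l i).1%:C%C * (p.1%:C%C * cis (- (- (l i).2 * p.2)) * F (S p.2 x))).
    by apply: eq_bigr => i _; rewrite mulr_sumr.
  rewrite exchange_big /=; apply: eq_bigr => p _.
  rewrite -mulrDr /D subrK rmorphM /= -trig_fejer_kernel /trig -/L [in RHS]big_tnth.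
  rewrite mulr_sumr mulr_suml; apply: eq_bigr => i _; rewrite -/(l i) mulNr opprK.
  by ring.
have FH : (fun x => F x - H x) = (fun x => (- kappa^-1)%:C%C * G x +
    \sum_(i < size L) ((l i).1 / kappa)%:C%C * (e' i x - g (- (l i).2) x)).
  apply/funext => x.
  have -> : \sum_(i < size L) ((l i).1 / kappa)%:C%C * (e' i x - g (- (l i).2) x) =
      \sum_(i < size L) ((l i).1 / kappa)%:C%C * e' i x - H x.
    by rewrite -sumrB; apply: eq_bigr => i _; rewrite mulrBr.
  rewrite addrA; congr (_ - _).
  have -> : \sum_(i < size L) ((l i).1 / kappa)%:C%C * e' i x =
      (kappa^-1)%:C%C * \sum_(i < size L) (l i).1%:C%C * e' i x.
    by rewrite mulr_sumr; apply: eq_bigr => i _; rewrite mulrA -rmorphM mulrC [kappa^-1 * _]mulrC mulrC.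
  rewrite sumE mulrDr mulrA -rmorphM mulVf ?gt_eqF // mul1r rmorphN mulNr addrA addNr add0r //.
have mG : cmeasurable G by apply: cmeasurable_sum => p; apply: cmeasurableZ.
have D1 t : (L2norm mu (D t) <= 1%:E)%E.
  apply: L2norm_bounded => // x; rewrite /D /F /cindic -rmorphB normc_real !indicE.
  by case: (_ \in _); case: (_ \in _); rewrite ?subrr ?subr0 ?sub0r ?normrN ?normr0 ?normr1.
(* A translate is within [e] of [F] at times in the Bohr set and within 1 always; the latter times
   carry little kernel mass. *)
pose c p : R := `|p.1 * K p.2| * (if `[<bohr bs del p.2>] then e else 1).
have leG : (L2norm mu G <= (2 * e * kappa)%:E)%E.
  apply: (@le_trans _ _ (\sum_(p <- u) c p)%:E).
    apply: L2norm_sum => p; first exact: cmeasurableZ.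
    rewrite L2normZ // normc_real /c EFinM lee_wpmul2l ?lee_fin //.
    case: asboolP => // bp; apply: L2norm_cindicB => //; first exact: ltW.
    exact: bohrA.
  rewrite lee_fin.
  apply: (@le_trans _ _ (\sum_(p <- u) (e * (p.1 * K p.2) +
      (if ~~ `[<bohr bs del p.2>] then p.1 * K p.2 else 0)))).
    rewrite big_seq [leRHS]big_seq; apply: ler_sum => p pu; rewrite /c.
    have pK : 0 <= p.1 * K p.2 by rewrite mulr_ge0 ?u0 ?kernel_ge0.
    rewrite ger0_norm //; case: ifP => _ /=; first by rewrite addr0 mulrC.
    by rewrite mulr1 lerDr mulr_ge0 // ltW.
  rewrite big_split /= -mulr_sumr mean -big_mkcond /=.
  by move: bad; rewrite -/K -/L -/kappa; lra.
have mB i : cmeasurable (fun x => e' i x - g (- (l i).2) x).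
  by apply: cmeasurableB => //; case: (gE (- (l i).2)).
rewrite FH; apply: le_trans (L2norm_triangle _ _ _) _; first exact: cmeasurableZ.
  by apply: cmeasurable_sum => i; exact: cmeasurableZ.
rewrite (_ : eps = 2 * e + e); last by rewrite /e; field.
rewrite EFinD; apply: leeD.
  rewrite L2normZ // normc_real normrN normfV gtr0_norm //.
  apply: (@le_trans _ _ ((kappa^-1)%:E * (2 * e * kappa)%:E)%E).
    by rewrite lee_wpmul2l // lee_fin invr_ge0 ltW.
  by rewrite -EFinM lee_fin mulrC mulfK // gt_eqF.
apply: (@le_trans _ _ (\sum_(i < size L) `|(l i).1 / kappa| * (e / (1 + M)))%:E).
  apply: L2norm_sum => i; first exact: cmeasurableZ.
  rewrite L2normZ // normc_real EFinM lee_wpmul2l ?lee_fin //.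
  rewrite /e' /u avg_mul // avgC // -avg_mul //; apply: w'P => //.
  by apply/mapP; exists (l i) => //; exact: mem_tnth.
rewrite -mulr_suml -(big_tnth _ _ _ xpredT (fun l : R * R => `|l.1 / kappa|)) -/M lee_fin.
by rewrite mulrCA ler_piMr ?(ltW e0) // ler_pdivrMr ?mul1r ?lerDr // ltr_wpDr.
Qed.

End AlmostPeriodicApproximation.

(** * From indicators to square integrable functions *)

Section Density.
Import HBSimple HBNNSimple.
Import numFieldNormedType.Exports.
Context d (X : measurableType d) (R : realType) (mu : probability X R).
Context (S : R -> X -> X).
Implicit Types (F G : X -> R[i]) (A : set X) (c : R[i]).
Notation normc := ComplexField.Normc.normc.
Notation approximable := (approximable mu S).
Notation spanned := (spanned (eigen mu S)).

Lemma eigen_cmeasurable F : eigen mu S F -> cmeasurable F.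
Proof. by case=> -[]. Qed.

Lemma spanned_cmeasurable F : spanned F -> cmeasurable F.
Proof.
move=> [n [c [f [fE ->]]]]; apply: cmeasurable_sum => i; apply: cmeasurableZ.
exact: eigen_cmeasurable.
Qed.

Lemma spannedD F G : spanned F -> spanned G -> spanned (fun x => F x + G x).
Proof.
move=> [m [c [f [fE ->]]]] [n [c' [f' [f'E ->]]]].
exists (m + n)%N, (fun i => match fintype.split i with inl j => c j | inr j => c' j end),
  (fun i => match fintype.split i with inl j => f j | inr j => f' j end); split.
  by move=> i; case: (fintype.split i).
apply/funext => x; rewrite big_split_ord /=; congr (_ + _); apply: eq_bigr => i _.
  by rewrite -[lshift n i]/(unsplit (inl i)) unsplitK.
by rewrite -[rshift m i]/(unsplit (inr i)) unsplitK.
Qed.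

Lemma spannedZ c F : spanned F -> spanned (fun x => c * F x).
Proof.
move=> [n [c' [f [fE ->]]]]; exists n, (fun i => c * c' i), f; split=> //.
by apply/funext => x; rewrite mulr_sumr; apply: eq_bigr => i _; rewrite mulrA.
Qed.

Lemma spanned0 : spanned (fun=> 0).
Proof.
by exists 0%N, (fun=> 0), (fun _ _ => 0); split; [case|apply/funext => x; rewrite big_ord0].
Qed.

Lemma approximableD F G : cmeasurable F -> cmeasurable G ->
  approximable F -> approximable G -> approximable (fun x => F x + G x).
Proof.
move=> mF mG aF aG eps eps0.
have [F' sF F'e] := aF (eps / 2) (divr_gt0 eps0 (ltr0Sn _ 1)).
have [G' sG G'e] := aG (eps / 2) (divr_gt0 eps0 (ltr0Sn _ 1)).
exists (fun x => F' x + G' x); first exact: spannedD.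
have := L2norm_triangle mu (cmeasurableB mF (spanned_cmeasurable sF))
  (cmeasurableB mG (spanned_cmeasurable sG)).
rewrite (_ : (fun x => _) = (fun x => F x + G x - (F' x + G' x))); last first.
  by apply/funext => x; ring.
move=> le_t; apply: le_trans le_t _; rewrite [X in (_ <= X%:E)%E]splitr EFinD.
exact: leeD.
Qed.

Lemma approximableZ c F : cmeasurable F -> approximable F -> approximable (fun x => c * F x).
Proof.
move=> mF aF eps eps0; have c1 : 0 < 1 + normc c by rewrite ltr_pwDl // normc_nonneg.
have [G sG Ge] := aF (eps / (1 + normc c)) (divr_gt0 eps0 c1).
exists (fun x => c * G x); first exact: spannedZ.
rewrite (_ : (fun x => _) = (fun x => c * (F x - G x))); last first.
  by apply/funext => x; ring.
rewrite L2normZ; last by apply: cmeasurableB => //; exact: spanned_cmeasurable.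
apply: (@le_trans _ _ ((normc c)%:E * (eps / (1 + normc c))%:E)%E).
  by rewrite lee_wpmul2l // lee_fin normc_nonneg.
rewrite -EFinM lee_fin mulrCA ler_piMr ?(ltW eps0) // ler_pdivrMr // mul1r lerDr //.
Qed.

Lemma approximable_sum (I : Type) (s : seq I) (f : I -> X -> R[i]) :
  (forall i, cmeasurable (f i) /\ approximable (f i)) ->
  approximable (fun x => \sum_(i <- s) f i x).
Proof.
move=> fP; elim: s => [|i s IH].
  move=> eps eps0; exists (fun=> 0); first exact: spanned0.
  rewrite (_ : (fun x => _) = fun=> 0); last by apply/funext => x; rewrite big_nil subrr.
  apply: (@le_trans _ _ 0%:E); last by rewrite lee_fin ltW.
  apply: L2norm_bounded => [|x]; first exact: cmeasurable_cst.
  by rewrite ComplexField.Normc.normc0.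
rewrite (_ : (fun x => _) = fun x => f i x + \sum_(j <- s) f j x); last first.
  by apply/funext => x; rewrite big_cons.
apply: approximableD => //; try by case: (fP i).
by apply: cmeasurable_sum => j; case: (fP j).
Qed.

Lemma approximable_lim F : cmeasurable F ->
  (forall eps : R, 0 < eps -> exists G, [/\ cmeasurable G, approximable G &
    (L2norm mu (fun x => F x - G x)%R <= eps%:E)%E]) -> approximable F.
Proof.
move=> mF lim_F eps eps0.
have [G [mG aG Ge]] := lim_F (eps / 2) (divr_gt0 eps0 (ltr0Sn _ 1)).
have [H sH He] := aG (eps / 2) (divr_gt0 eps0 (ltr0Sn _ 1)).
exists H => //.
have := L2norm_triangle mu (cmeasurableB mF mG) (cmeasurableB mG (spanned_cmeasurable sH)).
rewrite (_ : (fun x => _) = (fun x => F x - H x)); last by apply/funext => x; ring.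
move=> le_t; apply: le_trans le_t _; rewrite [X in (_ <= X%:E)%E]splitr EFinD.
exact: leeD.
Qed.

Hypothesis approx_indic : forall A, measurable A -> approximable (cindic R A).

Lemma approximable_nnsfun (h : {nnsfun X >-> R}) : approximable (fun x => (h x)%:C%C).
Proof.
rewrite (_ : (fun x => _) = (fun x => \sum_(y <- finmap.enum_fset (fset_set (range h)))
    y%:C%C * cindic R (h @^-1` [set y]) x)); last first.
  apply/funext => x; rewrite [in LHS]fimfunE fsbig_finite //= rmorph_sum /=.
  by apply: eq_bigr => y _; rewrite rmorphM.
apply: approximable_sum => y.
have mA : measurable (h @^-1` [set y]) by exact: measurable_funPTI.
have mI := cmeasurable_cindic R mA.
by split; [exact: cmeasurableZ|apply: approximableZ => //; exact: approx_indic].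
Qed.

Lemma approximable_nonneg (f : X -> R) : measurable_fun setT f -> (forall x, 0 <= f x) ->
  (\int[mu]_x (f x ^+ 2)%:E < +oo)%E -> approximable (fun x => (f x)%:C%C).
Proof.
move=> mf f0 fin_f; apply: approximable_lim => [|eps eps0]; first exact: cmeasurable_real.
have mfE : measurable_fun setT (EFin \o f) by exact/measurable_EFinP.
pose h := nnsfun_approx measurableT mfE.
have cvg_h x : (fun n => h n x) @ \oo --> f x.
  have := @cvg_nnsfun_approx _ _ _ _ measurableT _ mfE _ x I.
  by move=> /(_ _) /fine_cvgP[] // y _; rewrite lee_fin.
have h_le n x : h n x <= f x.
  rewrite -(cvg_lim _ (cvg_h x)) //; apply: nondecreasing_cvgn_le.
    by move=> m p mp; exact: (lefP _ _ (nd_nnsfun_approx measurableT mfE mp)).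
  by apply/cvg_ex; exists (f x).
have mh n : measurable_fun setT (h n) by [].
have mC n : cmeasurable (fun x => (h n x)%:C%C) by exact: cmeasurable_real.
have mf2 : measurable_fun setT (fun x => (f x ^+ 2)%:E).
  by apply/measurable_EFinP; apply: measurable_funX.
have [|||||_ _] := @dominated_convergence _ _ _ mu setT measurableT
    (fun n x => ((f x - h n x) ^+ 2)%:E) (cst 0%E) (fun x => (f x ^+ 2)%:E).
- by move=> n; apply/measurable_EFinP; apply: measurable_funX; exact: measurable_funB.
- exact: measurable_cst.
- apply: nearW => x _; apply: cvg_EFin; first exact: nearW.
  have c1 : (fun n => f x - h n x) @ \oo --> (0 : R).
    by rewrite -(subrr (f x)); apply: cvgB => //; exact: cvg_cst.
  have := cvgM c1 c1; rewrite mulr0; exact.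
- apply/integrableP; split => //.
  by under eq_integral => x _ do rewrite gee0_abs ?lee_fin ?sqr_ge0 //.
- apply: nearW => x n _; rewrite gee0_abs ?lee_fin ?sqr_ge0 //.
  by rewrite ler_sqr ?nnegrE ?subr_ge0 // lerBlDr lerDl.
rewrite integral0 => /fine_cvgP[fin /cvgrPdist_lt /(_ (eps ^+ 2))].
rewrite exprn_gt0 // => /(_ isT) small; have [] := filterI fin small.
move=> n _ /(_ n (leqnn n))[/= fn]; rewrite sub0r normrN => lt_n.
exists (fun x => (h n x)%:C%C); split => //; first exact: approximable_nnsfun.
apply/L2norm_le; first exact: ltW.
rewrite /sqr_norm (_ : (\int[mu]_x _)%E = (\int[mu]_x ((f x - h n x) ^+ 2)%:E)%E); last first.
  by apply: eq_integral => x _; rewrite -rmorphB normc_real real_normK ?num_real.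
by rewrite -(fineK fn) lee_fin ltW //; apply: le_lt_trans lt_n; exact: ler_norm.
Qed.

Lemma approximable_real (f : X -> R) : measurable_fun setT f ->
  (\int[mu]_x (f x ^+ 2)%:E < +oo)%E -> approximable (fun x => (f x)%:C%C).
Proof.
move=> mf fin_f.
have mf2 : measurable_fun setT (fun x => (f x ^+ 2)%:E).
  by apply/measurable_EFinP; apply: measurable_funX.
have fin (g : X -> R) : measurable_fun setT g -> (forall x, 0 <= g x) -> (forall x, g x <= `|f x|) ->
    (\int[mu]_x (g x ^+ 2)%:E < +oo)%E.
  move=> mg g0 gf; apply: le_lt_trans fin_f; apply: ge0_le_integral => //.
  - by move=> x _; rewrite lee_fin sqr_ge0.
  - by apply/measurable_EFinP; apply: measurable_funX.
  - by move=> x _; rewrite lee_fin -[leRHS]real_normK ?num_real // ler_sqr ?nnegrE.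
have mp := measurable_funrpos mf; have mn := measurable_funrneg mf.
have DE x : f^\+ x + f^\- x = `|f x| by move: (funrposDneg f) => /(congr1 (fun g : X -> R => g x)).
rewrite (_ : (fun x => _) = (fun x => (f^\+ x)%:C%C + (-1) * (f^\- x)%:C%C)); last first.
  apply/funext => x; rewrite mulN1r -rmorphB; congr (_%:C)%C.
  by move: (funrposBneg f) => /(congr1 (fun g : X -> R => g x)) <-.
have mpC := cmeasurable_real mp; have mnC := cmeasurable_real mn.
apply: approximableD => //; first exact: cmeasurableZ.
  apply: approximable_nonneg => //; apply: fin => // x.
  by rewrite -DE lerDl funrneg_ge0.
apply: approximableZ => //; apply: approximable_nonneg => //; apply: fin => // x.
by rewrite -DE lerDr funrpos_ge0.
Qed.

Lemma eigen_span_dense : span_dense mu [set F | eigen mu S F].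
Proof.
move=> F [mR mI fin_F] eps eps0.
have mF : cmeasurable F by [].
have fin : (sqr_norm mu F < +oo)%E.
  by move: fin_F; rewrite L2normE !ltey; apply: contra => /eqP ->.
have fin_part (f : X -> R) : measurable_fun setT f -> (forall x, `|f x| <= normc (F x)) ->
    (\int[mu]_x (f x ^+ 2)%:E < +oo)%E.
  move=> mf fF; apply: le_lt_trans fin; apply: ge0_le_integral => //.
  - by move=> x _; rewrite lee_fin sqr_ge0.
  - by apply/measurable_EFinP; apply: measurable_funX.
  - exact: cmeasurable_sqr.
  - by move=> x _; rewrite lee_fin -[leLHS]real_normK ?num_real // ler_sqr ?nnegrE // normc_nonneg.
have aF : approximable F.
  rewrite (_ : F = (fun x => (complex.Re (F x))%:C%C + 'i%C * (complex.Im (F x))%:C%C)); last first.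
    by apply/funext => x; exact: complexE.
  apply: approximableD.
  - exact: cmeasurable_real.
  - exact/cmeasurableZ/cmeasurable_real.
  - by apply: approximable_real => //; apply: fin_part => // x; exact: normc_Re_le.
  - apply: approximableZ; first exact: cmeasurable_real.
    by apply: approximable_real => //; apply: fin_part => // x; exact: normc_Im_le.
(* Half of [eps], since [span_dense] asks for a strict inequality. *)
have [|_ [n [c [f [fE ->]]]] le_e] := aF (eps / 2); first by rewrite divr_gt0.
exists n, c, f; split=> //; apply: le_lt_trans le_e _.
by rewrite lte_fin ltr_pdivrMr // ltr_pMr // ltr1n.
Qed.

End Density.

(** * The translation flow *)

Section CisNearInteger.
Context {R : realType}.
Implicit Types (x y theta : R).
Notation normc := ComplexField.Normc.normc.
Notation cis := (@cis R).

Lemma cis_int (m : int) : cis m%:~R = 1.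
Proof.
have cis1 : cis 1 = 1.
  by rewrite /cis mulr1 mulrC mulr_natr cos2pi sin2pi.
have cisn (n : nat) : cis n%:R = 1 by rewrite -[n%:R]mulr1 -cisX cis1 expr1n.
case: m => n; first exact: cisn.
by rewrite NegzE mulrNz cisN -[_%:~R]/(n.+1%:R) cisn rmorph1.
Qed.

Lemma cis_near_int theta : 0 < theta -> exists2 del, 0 < del &
  forall x, normc (1 - cis x) < del -> exists m : int, `|x - m%:~R| <= theta.
Proof.
move=> theta0; pose th := Num.min theta (4^-1).
have th0 : 0 < th by rewrite lt_min theta0 invr_gt0 ltr0n.
have th4 : th <= 4^-1 by rewrite ge_min lexx orbT.
have thle : th <= theta by rewrite ge_min lexx.
have pi0 := pi_gt0 R.
have in_pi y : 0 <= y <= 2^-1 -> 2 * pi * y \in `[0, pi].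
  move=> /andP[y0 y1]; rewrite in_itv /= !mulr_ge0 ?(ltW pi0) //=.
  by rewrite mulrC mulrA ler_piMl ?(ltW pi0) //; lra.
have cos1 : cos (2 * pi * th) < 1.
  have := @ltr_cos R 0 (2 * pi * th); rewrite cos0 => -> //.
  - by rewrite !mulr_gt0.
  - by rewrite in_itv /= lexx ltW.
  - by apply: in_pi; lra.
have E x : normc (1 - cis x) ^+ 2 = 2 - 2 * cos (2 * pi * x).
  by rewrite normc_sqr /cis /=; have := cos2Dsin2 (2 * pi * x); nra.
exists (Num.sqrt (2 - 2 * cos (2 * pi * th))); first by rewrite sqrtr_gt0; lra.
move=> x ltx; pose m := Num.floor x; pose r := x - m%:~R.
have /andP[m1 m2] := floor_itv x.
have r0 : 0 <= r by rewrite subr_ge0.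
have r1 : r < 1 by rewrite ltrBlDl -[1]/(1%:~R) -intrD.
have cisE : cis x = cis r.
  by rewrite -[x](subrK m%:~R) cisD cis_int mulr1.
have : normc (1 - cis r) ^+ 2 < 2 - 2 * cos (2 * pi * th).
  rewrite -cisE -[ltRHS]sqr_sqrtr; last by lra.
  by rewrite ltr_sqr ?nnegrE ?sqrtr_ge0 ?normc_nonneg.
rewrite E ltrD2l ltrN2 ltr_pM2l // => lt_cos.
have [rh|rh] := leP r 2^-1.
  exists m; rewrite -/r ger0_norm //; apply: le_trans thle; rewrite ltW //.
  by move: lt_cos; rewrite ltr_cos ?in_pi //; [rewrite ltr_pM2l // mulr_gt0|lra|lra].
exists (m + 1); rewrite intrD opprD addrA -/r ler0_norm; last by rewrite subr_le0 ltW.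
apply: le_trans thle; rewrite opprB ltW //.
have cos_r : cos (2 * pi * r) = cos (2 * pi * (1 - r)).
  rewrite -cosN -[in LHS](cosD2pi (- (2 * pi * r))); congr cos.
  by rewrite -mulr_natl; ring.
by move: lt_cos; rewrite cos_r ltr_cos ?in_pi //; [rewrite ltr_pM2l // mulr_gt0|lra|lra].
Qed.

End CisNearInteger.

Section BohrTranslations.
Context {R : realType} {k : nat} (phi : 'I_k -> seq 'I_k) (lam : R)
  (omega : 'rV[R]_k).
Implicit Types (t r : R) (z v : 'cV[int]_k).
Notation normc := ComplexField.Normc.normc.
Notation M := (incidence_mx phi).
Notation pos := (pos omega).
Hypothesis lam1 : 1 < lam.
Hypothesis eig : omega *m map_mx intr (incidence_mx phi) = lam *: omega.
Context (P : 'M[R[i]]_k) (d : 'I_k -> R[i]) (i0 : 'I_k).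
Let coord z i := (P *m map_mx intr z) i 0.
Hypothesis coordM : forall z i, coord (M *m z) i = d i * coord z i.
Hypothesis d_lt1 : forall i, i != i0 -> normc (d i) < 1.
Context (v : 'cV[int]_k) (c : 'I_k -> R).
Let V (j : 'I_k) := iter j (mulmx M) v.
Hypothesis c_stable : forall i, i != i0 -> \sum_j (c j)%:C%C * coord (V j) i = 0.
Hypothesis c_pos : \sum_j c j * pos (V j) = 1.
Context (T : R -> Prop) (N : nat).
Hypothesis T_sub : forall g h, T g -> T h -> T (g - h).
Hypothesis T_scale : forall n g, T g -> T (lam ^+ n * g).
Hypothesis T_v : T (lam ^+ N * pos v).

(* Kronecker-type statement: the combination [c] of the iterates of [v] has
   height 1 and vanishing contracted coordinates, so rounding [c j * t] yields
   a lattice point of height close to [t] with small contracted coordinates. *)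
Lemma bohr_small_translation n (del0 : R) : 0 < del0 -> exists bs del, 0 < del /\
  forall t, bohr bs del t -> exists2 z, small_translation omega P i0 T z &
    `|t - lam ^+ n * pos z| < del0.
Proof.
move=> del00.
have lam0 : 0 < lam by exact: lt_trans lam1.
have lamn0 m : 0 < lam ^+ m by exact: exprn_gt0.
pose A := \sum_i \sum_j normc (coord (V j) i).
pose B := lam ^+ (n + N) * \sum_j `|pos (V j)|.
have A0 : 0 <= A by apply: sumr_ge0 => i _; apply: sumr_ge0 => j _; exact: normc_nonneg.
have B0 : 0 <= B by apply: mulr_ge0; [exact: ltW|apply: sumr_ge0].
(* The rounding error: the first entry keeps the contracted coordinates below 1, the second keeps
   the position within [del0]. *)
pose theta := Num.min (1 + A)^-1 (del0 / (1 + B)).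
have A1 : 0 < 1 + A by rewrite ltr_wpDr.
have B1 : 0 < 1 + B by rewrite ltr_wpDr.
have theta0 : 0 < theta by rewrite lt_min invr_gt0 A1 divr_gt0.
have thA : theta * A <= 1.
  apply: (@le_trans _ _ ((1 + A)^-1 * A)); first by rewrite ler_wpM2r // ge_min lexx.
  by rewrite mulrC ler_pdivrMr // mul1r lerDr.
have thB : theta * B < del0.
  apply: (@le_lt_trans _ _ (del0 / (1 + B) * B)).
    by rewrite ler_wpM2r // ge_min lexx orbT.
  by rewrite mulrAC ltr_pdivrMr // ltr_pM2l // ltrDr.
have [del del0' near_int] := cis_near_int theta0.
(* Besides the requested scale [n], the exponent contains [N], because [T] is only known to contain
   [lam ^+ N * pos v]; [z0] uses iterates shifted by [N]. *)
pose beta j := c j / lam ^+ (n + N).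
exists [seq beta j | j <- enum 'I_k], del; split => // t bt.
have /choice[m mP] : forall j, exists m : int, `|beta j * t - m%:~R| <= theta.
  by move=> j; apply: near_int; apply: bt; apply: map_f; rewrite mem_enum.
pose z0 := \sum_j m j *: iter N (mulmx M) (V j).
have T0 : T 0 by rewrite -(subrr (lam ^+ N * pos v)); exact: T_sub.
have TD g h : T g -> T h -> T (g + h).
  by move=> Tg Th; rewrite -[h]opprK; apply: T_sub => //; rewrite -[- h]add0r; exact: T_sub.
have TZ (q : int) g : T g -> T (q%:~R * g).
  move=> Tg; have Tn (p : nat) : T (p%:R * g).
    by elim: p => [|p IH]; [rewrite mul0r|rewrite -natr1 mulrDl mul1r; exact: TD].
  case: q => p; first exact: Tn.
  by rewrite NegzE mulrNz mulNr -[- _]add0r; apply: T_sub => //; exact: Tn.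
have posZ (q : int) z : pos (q *: z) = q%:~R * pos z.
  by rewrite /pos mulr_sumr; apply: eq_bigr => i _; rewrite mxE intrM mulrCA.
have pos0 : pos 0 = 0.
  by rewrite /pos big1 // => i _; rewrite mxE mulr0.
have pos_sum : pos z0 = lam ^+ N * \sum_j (m j)%:~R * pos (V j).
  rewrite mulr_sumr /z0.
  rewrite (big_morph pos (posD omega) pos0); apply: eq_bigr => j _.
  by rewrite posZ (posM eig) mulrCA.
have coordD z z' i : coord (z + z') i = coord z i + coord z' i.
  by rewrite /coord map_mxD mulmxDr mxE.
have coord0 i : coord 0 i = 0.
  by rewrite /coord map_mx0 mulmx0 mxE.
have coordZ (q : int) z i : coord (q *: z) i = q%:~R * coord z i.
  by rewrite /coord map_mxZ -scalemxAr mxE.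
have coord_iter p z i : coord (iter p (mulmx M) z) i = d i ^+ p * coord z i.
  by elim: p => [|p IH]; rewrite ?mul1r //= coordM IH mulrA -exprS.
have coord_sum i : coord z0 i = d i ^+ N * \sum_j (m j)%:~R * coord (V j) i.
  rewrite mulr_sumr /z0 (big_morph (coord ^~ i) (fun z z' => coordD z z' i) (coord0 i)).
  by apply: eq_bigr => j _; rewrite coordZ coord_iter mulrCA.
exists z0.
  split=> [|i ii0].
    rewrite pos_sum mulr_sumr.
    elim/big_ind: _ => // j _; rewrite mulrCA; apply: TZ.
    by rewrite /V (posM eig) mulrCA; exact: T_scale.
  rewrite -/(coord z0 i) coord_sum ComplexField.Normc.normcM.
  have dN : normc (d i ^+ N) <= 1.
    elim: (N) => [|p IH]; first by rewrite expr0 ComplexField.Normc.normc1.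
    by rewrite exprS ComplexField.Normc.normcM mulr_ile1 ?normc_nonneg // ltW // d_lt1.
  (* Subtracting a multiple of the vanishing combination [c_stable] leaves only rounding errors as
     coefficients. *)
  have -> : \sum_j (m j)%:~R * coord (V j) i =
      \sum_j ((m j)%:~R - beta j * t)%:C%C * coord (V j) i.
    under [RHS]eq_bigr => j _ do rewrite rmorphB mulrBl rmorph_int.
    rewrite sumrB -[LHS]subr0; congr (_ - _).
    transitivity ((t / lam ^+ (n + N))%:C%C * \sum_j (c j)%:C%C * coord (V j) i).
      by rewrite c_stable // mulr0.
    rewrite mulr_sumr; apply: eq_bigr => j _.
    by rewrite mulrA -rmorphM; congr (_%:C%C * _); rewrite /beta; ring.
  apply: le_trans thA; rewrite -[leRHS]mul1r; apply: ler_pM => //; try exact: normc_nonneg.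
  apply: (@le_trans _ _ (\sum_j theta * normc (coord (V j) i))); last first.
    rewrite -mulr_sumr ler_wpM2l ?(ltW theta0) // /A [leRHS](bigD1 i) //= lerDl.
    by apply: sumr_ge0 => l _; apply: sumr_ge0 => j _; exact: normc_nonneg.
  elim/big_ind2: _ => [|x1 x2 y1 y2 h1 h2|j _].
  - by rewrite ComplexField.Normc.normc0.
  - by apply: le_trans (le_normcD _ _) _; exact: lerD.
  - rewrite ComplexField.Normc.normcM ler_wpM2r ?normc_nonneg //.
    by rewrite /= expr0n addr0 sqrtr_sqr distrC.
have -> : t - lam ^+ n * pos z0 = lam ^+ (n + N) * \sum_j (beta j * t - (m j)%:~R) * pos (V j).
  under eq_bigr do rewrite mulrBl; rewrite sumrB mulrBr; congr (_ - _); last first.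
    by rewrite pos_sum mulrA -exprD.
  transitivity (t * \sum_j c j * pos (V j)); first by rewrite c_pos mulr1.
  rewrite !mulr_sumr; apply: eq_bigr => j _; rewrite /beta.
  by field; rewrite gt_eqF.
apply: le_lt_trans thB; rewrite normrM gtr0_norm // /B mulrCA ler_pM2l // mulr_sumr.
apply: le_trans (ler_norm_sum _ _ _) _; apply: ler_sum => j _.
by rewrite normrM ler_wpM2r.
Qed.

End BohrTranslations.

Section TilingFlow.
Import numFieldNormedType.Exports.
Context {R : realType} {k : nat} (phi : 'I_k -> seq 'I_k) (lam : R)
  (omega : 'rV[R]_k).
Notation X := (borel_tiles phi lam omega).
Notation Omega := (tiling_space phi lam omega).
Context (mu : probability X R).
Implicit Types (t r s e q : R) (x y : tile R k) (T : X) (A B : set X) (U V : set (tiles omega)).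
Notation tend := (tend omega).
Notation mismatch := (@mismatch R k omega).

Hypothesis om0 : forall i, 0 < omega 0 i.
Hypothesis mu_inv : translation_invariant mu.

Definition flow t T : X := translate T (- t).

Lemma flowE t T x : flow t T x <-> (T : tiles omega) (shift_tile t x).
Proof. by rewrite -[t in shift_tile t x]opprK; exact: (@translateE R k omega). Qed.

Lemma flow0 T : flow 0 T = T.
Proof. by rewrite /flow oppr0 translate0. Qed.

Lemma flowD s t T : flow (s + t) T = flow s (flow t T).
Proof. by rewrite /flow translateD -opprD addrC. Qed.

Lemma flow_Omega t T : Omega (flow t T) <-> Omega T.
Proof. exact: tiling_space_translateE. Qed.

Lemma measurable_open U : open U -> measurable (Omega `&` U : set X).
Proof. by move=> oU; apply: sub_sigma_algebra; exists U. Qed.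

Lemma measurable_flow t : measurable_fun setT (flow t).
Proof.
apply: (@measurability _ _ X X setT (flow t) (tiling_space_open phi lam omega)) => //.
move=> _ [_ [U oU <-] <-].
rewrite setTI (_ : _ @^-1` _ = Omega `&` [set T | U (translate T (- t))]).
  apply: measurable_open; exact: (open_translate om0 oU).
by apply/seteqP; split => T /= [/flow_Omega].
Qed.

Lemma mu_flow t A : measurable A -> mu (flow t @^-1` A) = mu A.
Proof. exact: mu_inv. Qed.

(* By invariance, the number of visits to [B] at the times [tau] has mean [m * mu B]. *)
Lemma mu_le_count B m (tau : 'I_m -> R) (c : R) : measurable B -> B `<=` Omega -> 0 <= c ->
  (forall T, Omega T -> \sum_j `[< B (flow (tau j) T) >]%:R <= c) ->
  (m%:R%:E * mu B <= c%:E)%E.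
Proof.
move=> mB BO c0 count.
have mF j : measurable (flow (tau j) @^-1` B).
  exact: (measurable_preimageS measurable_flow).
have -> : (m%:R%:E * mu B = \sum_(j < m) mu (flow (tau j) @^-1` B))%E.
  under eq_bigr do rewrite mu_flow //.
  rewrite -(fineK (fin_num_measure mu B mB)) sumEFin -EFinM.
  by rewrite sumr_const card_ord mulr_natl.
have -> : (\sum_(j < m) mu (flow (tau j) @^-1` B) =
    \int[mu]_T \sum_(j < m) (\1_(flow (tau j) @^-1` B) T)%:E)%E.
  rewrite ge0_integral_sum //.
  - by apply: eq_bigr => j _; rewrite integral_indic // setIT.
  - by move=> j; apply/measurable_EFinP; exact: measurable_indic.
apply: (@le_trans _ _ (\int[mu]_T c%:E)%E); last first.
  by rewrite integral_cst // [X in (_ * X)%E]probability_setT mule1.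
apply: ge0_le_integral => //.
- by move=> T _; apply: sume_ge0 => j _; rewrite lee_fin.
- by apply: emeasurable_sum => j; apply/measurable_EFinP; exact: measurable_indic.
move=> T _; rewrite sumEFin lee_fin.
have indE j : \1_(flow (tau j) @^-1` B) T = `[< B (flow (tau j) T) >]%:R :> R.
  by rewrite indicE; congr (_%:R); congr nat_of_bool; apply/idP/idP; rewrite inE => /asboolP.
under eq_bigr do rewrite indE.
have [OT|nO] := pselect (Omega T); first exact: count.
rewrite big1 // => j _; case: asboolP => // /BO /flow_Omega; contradiction.
Qed.

(** A point of an open set stays in it under all small translations, so the part of [A] lost along
    any sequence of times tending to 0 shrinks to nothing. The part gained is the part lost under
    the opposite translation. *)
Lemma open_flow_continuous V (eps : R) : open V -> 0 < eps -> exists2 del, 0 < del &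
  forall s, `|s| < del ->
  (mu ((Omega `&` V : set X) `+` flow s @^-1` (Omega `&` V)) <= eps%:E)%E.
Proof.
move=> oV eps0; set A := Omega `&` V : set X.
have mA : measurable A by exact: measurable_open.
have mSA s : measurable (flow s @^-1` A).
  exact: (measurable_preimageS measurable_flow).
have e20 : 0 < eps / 2 by rewrite divr_gt0.
have [del del0 small] : exists2 del, 0 < del & forall s, `|s| < del ->
    (mu (A `\` flow s @^-1` A) <= (eps / 2)%:E)%E.
  apply: contrapT => no_del.
  have /choice[s sP] : forall n : nat, exists s, `|s| < n.+1%:R^-1 /\
      ~ (mu (A `\` flow s @^-1` A) <= (eps / 2)%:E)%E.
    move=> n; apply: contrapT => no_s; apply: no_del.
    exists n.+1%:R^-1; first by rewrite invr_gt0.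
    by move=> s sn; apply: contrapT => big; apply: no_s; exists s.
  pose D n := \bigcup_(m in [set m | (n <= m)%N]) (A `\` flow (s m) @^-1` A).
  have mD n : measurable (D n).
    by apply: bigcup_measurable => m _; exact: measurableD.
  have [||n Dn] := @decreasing_measure_small _ _ _ mu D mD _ _ (eps / 2) e20.
  - by move=> n T [m /= nm AT]; exists m => //=; exact: ltnW.
  - apply/seteqP; split=> // T TD.
    have [_ _ [[OT VT] _]] := TD 0%N I.
    move: (oV); rewrite open_tilesE => /(_ _ VT)[e e0 eV].
    have [n ne] : exists n, n.+1%:R^-1 < e.
      exists (Num.bound e^-1).
      rewrite -[ltRHS]invrK ltf_pV2 ?posrE ?invr_gt0 //.
      by apply: lt_trans (unstable.ltr_bound _) _; rewrite ltr_nat.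
    have [m /= nm [_]] := TD n I; apply; split; first exact/flow_Omega.
    apply: eV; apply: eps_close_translate; rewrite normrN.
    apply: lt_trans (sP m).1 _; apply: le_lt_trans ne.
    by rewrite lef_pV2 ?posrE // ler_nat.
  - apply: (sP n).2; apply: ltW; apply: le_lt_trans Dn.
    apply: le_measure; rewrite ?inE //; first exact: measurableD.
    by move=> T TA; exists n => /=.
exists del => // s sdel.
apply: (@le_trans _ _ (mu (A `\` flow s @^-1` A) + mu (flow s @^-1` A `\` A))%E).
  by apply: measureU2; exact: measurableD.
rewrite [eps]splitr EFinD leeD ?small //.
have -> : flow s @^-1` A `\` A = flow s @^-1` (A `\` flow (- s) @^-1` A).
  by apply/seteqP; split => T /= [AT]; rewrite -flowD addNr flow0.
by rewrite mu_flow ?small ?normrN //; exact: measurableD.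
Qed.

Lemma mismatch_flow T q t r : mismatch (flow q T) t r <-> mismatch T t (r + q).
Proof.
suff E : (exists x y, [/\ flow q T x, flow q T y, x = shift_tile t y & x.1 <= r < tend x]) <->
    (exists x y, [/\ (T : tiles omega) x, (T : tiles omega) y, x = shift_tile t y & x.1 <= r + q < tend x]).
  by rewrite /mismatch; split => H /E.
split=> [[x [y [/flowE Tx /flowE Ty E /andP[r1 r2]]]]|
    [x [y [Tx Ty E /andP[r1 r2]]]]]; subst x.
  exists (shift_tile q (shift_tile t y)), (shift_tile q y).
  split=> //.
    by rewrite /shift_tile /= addrAC.
  by move: r1 r2; rewrite /shift_tile /tend /= => *; apply/andP; split; lra.
exists (shift_tile t (shift_tile (- q) y)), (shift_tile (- q) y).
split=> //.
- by apply/flowE; rewrite /shift_tile /= addrAC addrNK.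
- by apply/flowE; rewrite /shift_tile /= addrNK -surjective_pairing.
- by move: r1 r2; rewrite /shift_tile /tend /= => *; apply/andP; split; lra.
Qed.

(** A tiling has no second tile over [r], so a common tile there would be [x]. The sign of [- t] is
    that of [flow]. *)
Lemma mismatch_differ T t r x : Omega T -> x.1 <= r < tend x ->
  ~ ((T : tiles omega) x <-> flow t T x) -> mismatch T (- t) r.
Proof.
move=> OT /andP[xr rx] dif [x1 [y1 [Tx1 Ty1 E /andP[x1r rx1]]]]; apply: dif.
have OtT : Omega (flow t T) by apply/flow_Omega.
have tx1 : flow t T x1.
  apply/flowE; rewrite E /shift_tile /= addrNK.
  by rewrite -surjective_pairing.
have lt1 : x.1 < tend x1 by exact: le_lt_trans rx1.
have lt2 : x1.1 < tend x by exact: le_lt_trans rx.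
split=> Tx.
  by rewrite (tiling_disj om0 OT.1 Tx Tx1 lt1 lt2).
by rewrite (tiling_disj om0 OtT.1 Tx tx1 lt1 lt2).
Qed.

(** Membership depends on a bounded window, so it changes only if some tile there does; a grid of
    half the least tile length meets every such tile. *)
Lemma mismatch_inner_open e U : 0 < e -> exists (Q : nat) (q : nat -> R),
  forall T t, Omega T -> ~ (inner_open phi lam e U T <-> inner_open phi lam e U (flow t T)) ->
  exists2 i, (i < Q)%N & mismatch T (- t) (q i).
Proof.
move=> e0; pose r := e^-1 + e; pose M := ommax omega; pose m := ommin omega / 2.
have r0 : 0 <= r by rewrite addr_ge0 ?invr_ge0 // ltW.
exists (Num.bound ((2 * r + M) / m)).+2, (fun i => - (r + M) + i%:R * m) => T t OT dif.
have OtT : Omega (flow t T) by apply/flow_Omega.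
have [x [xr rx] difx] : exists2 x : tile R k, x.1 <= r /\ - r <= tend x &
    ~ ((T : tiles omega) x <-> flow t T x).
  apply: contrapT => same; apply: dif.
  suff E : @window R k omega r T = @window R k omega r (flow t T).
    by split; [exact: (inner_open_window om0 e0 E)|exact: (inner_open_window om0 e0 (esym E))].
  apply/seteqP; split => x /(windowE om0 _ _ r0)[Tx [x1 x2]]; apply/(windowE om0 _ _ r0);
    split=> //; apply: contrapT => nTx; apply: same; exists x => //; tauto.
have m0 : 0 < m by apply: divr_gt0 => //; exact: ommin_gt0 om0 x.2.
have mx : m < omega 0 x.2 by have := ommin_le om0 x.2; move: m0; rewrite /m; lra.
have Mx : omega 0 x.2 <= M by exact: le_ommax.
have xM : 0 <= x.1 + (r + M) by move: rx; rewrite /tend; lra.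
(* The first grid point strictly to the right of the left end of [x]; it is less than a tile length
   away. *)
pose i := (Num.truncn ((x.1 + (r + M)) / m)).+1.
have /andP[i1 i2] : i.-1%:R <= (x.1 + (r + M)) / m < i%:R.
  by apply: truncn_itv; rewrite divr_ge0 // ltW.
rewrite ler_pdivlMr // in i1; rewrite ltr_pdivrMr // in i2.
have iE : i%:R = i.-1%:R + 1 :> R by rewrite natr1.
exists i.
  have := archi_boundP (_ : 0 <= (2 * r + M) / m); set N := Num.bound _.
  have M0 : 0 <= M by apply: le_trans Mx; exact: ltW.
  move=> /(_ (divr_ge0 (addr_ge0 (mulr_ge0 (ler0n _ 2) r0) M0) (ltW m0))).
  rewrite ltr_pdivrMr // => ltN.
  rewrite -(ltr_nat R) iE -[N.+2%:R]natr1 ltrD2r.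
  rewrite -(ltr_pM2r m0); apply: le_lt_trans i1 _.
  rewrite -natr1 mulrDl mul1r; lra.
apply: (@mismatch_differ _ _ _ x) => //; apply/andP; split; first by lra.
rewrite /tend iE mulrDl mul1r; lra.
Qed.

Context (steps : R -> Prop).
Hypothesis steps_opp : forall g, steps g -> steps (- g).
Hypothesis count_mismatch : forall eps, 0 < eps -> exists (n : nat) (L K : R), 0 < L /\
  forall g (T : tiles omega) m, steps g -> Omega T -> (0 < m)%N ->
  \sum_(j < m) `[< mismatch T (lam ^+ n * g) (j%:R * (L / m%:R)) >]%:R <= eps * m%:R + K.
Hypothesis bohr_steps : forall n del0, 0 < del0 -> exists bs del, 0 < del /\
  forall t, bohr bs del t -> exists2 g, steps g & `|t - lam ^+ n * g| < del0.

(** A change of membership produces a mismatch at one of [Q] places. Counting these along a grid of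
    times, and averaging with invariance, bounds the measure of the change uniformly in [g]. *)
Lemma steps_inner_open e U (eps : R) : 0 < e -> 0 < eps -> exists n, forall g, steps g ->
  (mu ((Omega `&` inner_open phi lam e U : set X) `+`
    flow (lam ^+ n * g) @^-1` (Omega `&` inner_open phi lam e U)) <= eps%:E)%E.
Proof.
move=> e0 eps0; have [Q [q QP]] := mismatch_inner_open U e0.
have Q1 : 0 < 1 + Q%:R :> R by rewrite ltr_wpDr.
have [n [L [K [L0 cnt]]]] := count_mismatch (divr_gt0 (divr_gt0 eps0 (ltr0Sn _ 1)) Q1).
exists n => g sg; set A : set X := _ `&` _; set t := lam ^+ n * g.
have mA : measurable A by apply: measurable_open; exact: open_inner_open.
have mB : measurable (A `+` flow t @^-1` A).
  apply: measurable_setY => //; exact: (measurable_preimageS measurable_flow).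
set B := A `+` _ in mB *.
have BO : B `<=` Omega by move=> T [[[]//]|[[/flow_Omega]]].
have K0 : 0 <= `|K| by [].
(* The grid is refined until the constant errors, one [K] for each of the [Q] places, take at most
   half of [eps * m%:R]. *)
have [m mpos mP] : exists2 m, (0 < m)%N & Q%:R * `|K| <= eps / 2 * m%:R.
  have D0 : 0 <= Q%:R * `|K| / (eps / 2).
    by apply: divr_ge0; [exact: mulr_ge0|apply: divr_ge0 => //; exact: ltW].
  exists (Num.bound (Q%:R * `|K| / (eps / 2))).+1 => //.
  have := archi_boundP D0; rewrite ltr_pdivrMr ?divr_gt0 // => /ltW le1.
  apply: le_trans le1 _; rewrite mulrC; apply: ler_wpM2l; last by rewrite ler_nat.
  by apply: divr_ge0 => //; exact: ltW.
have cnt_B T : Omega T ->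
    \sum_(j < m) `[< B (flow (j%:R * (L / m%:R)) T) >]%:R <= eps * m%:R.
  move=> OT.
  apply: (@le_trans _ _ (\sum_(j < m) \sum_(i < Q)
      `[< mismatch (flow (q i) T) (lam ^+ n * - g) (j%:R * (L / m%:R)) >]%:R)).
    apply: ler_sum => j _; set tau := j%:R * _.
    case: asboolP => [BT|_]; last by apply: sumr_ge0.
    have [||i iQ mm] := QP (flow tau T) t; first exact/flow_Omega.
      by case: BT => [[[OA IA] nA]|[[OA IA] nA]] eqv; apply: nA; split;
        [do 2!apply/flow_Omega|exact/eqv|exact/flow_Omega|exact/eqv].
    rewrite (bigD1 (Ordinal iQ)) //= asboolT ?lerDl ?sumr_ge0 //.
    by move: mm => /mismatch_flow mm; apply/mismatch_flow; rewrite addrC mulrN.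
  rewrite exchange_big /=.
  apply: (@le_trans _ _ (\sum_(i < Q) (eps / 2 / (1 + Q%:R) * m%:R + `|K|))).
    apply: ler_sum => i _; apply: le_trans (cnt (- g) (flow (q i) T) m _ _ _) _ => //.
    - exact: steps_opp.
    - exact/flow_Omega.
    - by rewrite lerD2l ler_norm.
  rewrite sumr_const card_ord -[leLHS]mulr_natl mulrDr.
  rewrite (_ : eps * m%:R = eps / 2 * m%:R + eps / 2 * m%:R); last by rewrite -mulrDl -splitr.
  rewrite lerD //.
  rewrite mulrA ler_wpM2r // mulrCA ler_piMr ?divr_ge0 ?(ltW eps0) //.
  by rewrite ler_pdivrMr // mul1r lerDr.
have m0 : 0 < m%:R :> R by rewrite ltr0n.
have := mu_le_count mB BO _ cnt_B.
rewrite mulr_ge0 ?(ltW eps0) // => /(_ isT).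
rewrite -(fineK (fin_num_measure mu B mB)) -EFinM !lee_fin mulrC ler_pM2r //.
Qed.

Lemma almost_periodic_inner_open e U : 0 < e ->
  almost_periodic mu flow (Omega `&` inner_open phi lam e U).
Proof.
move=> e0; set A : set X := _ `&` _; have oU : open (inner_open phi lam e U) by exact: open_inner_open.
have mA : measurable (A : set X) by exact: measurable_open.
have mS t : measurable (flow t @^-1` A) by exact: (measurable_preimageS measurable_flow).
split=> // eps eps0; have e20 : 0 < eps / 2 by rewrite divr_gt0.
have [n nP] := steps_inner_open U e0 e20.
have [del0 del00 cont] := open_flow_continuous oU e20.
have [bs [del [d0 bP]]] := bohr_steps n del00.
exists bs, del; split=> // t /bP[g sg near_t].
apply: le_trans (mu_setY_trans mu mA (mS (lam ^+ n * g)) (mS t)) _.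
rewrite [eps]splitr EFinD leeD ?nP //.
have -> : flow (lam ^+ n * g) @^-1` A `+` flow t @^-1` A =
    flow (lam ^+ n * g) @^-1` (A `+` flow (t - lam ^+ n * g) @^-1` A).
  by apply/seteqP; split => T /=; rewrite -!flowD subrK.
by rewrite mu_flow ?cont //; apply: measurable_setY.
Qed.

Lemma almost_periodic_measurable A : measurable A -> almost_periodic mu flow A.
Proof.
apply: (almost_periodic_generated measurable_flow mu_flow) => _ [U oU <-].
rewrite (open_cover_inner_open phi lam oU).
apply: (almost_periodic_bigcup measurable_flow mu_flow) => n.
by apply: almost_periodic_inner_open; rewrite invr_gt0.
Qed.

End TilingFlow.

Lemma left_eigenvector_eq0 (F : numFieldType) (k : nat) (A : 'M[int]_k)
    (u : 'rV[F]_k) (l : F) (v : 'cV[int]_k) :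
  irreducible_poly (char_poly (map_mx intr A : 'M[rat]_k)) ->
  u *m map_mx intr A = l *: u -> v != 0 -> u *m map_mx intr v = 0 -> u = 0.
Proof.
case: k A u v => [|n'] A u v; first by move=> *; apply/rowP; case.
by move=> irr ul v0 uv; exact: left_eigen_eq0 irr _ _ _ _ ul v0 uv.
Qed.

(** * Assembly of the proof *)

Section Assembly.
Context {R : realType} {k : nat} (phi : 'I_k -> seq 'I_k) (lam : R)
  (omega : 'rV[R]_k).
Notation M := (incidence_mx phi).
Hypothesis om0 : forall i, 0 < omega 0 i.
Hypothesis lam1 : 1 < lam.
Hypothesis eig : omega *m map_mx intr M = lam *: omega.

Lemma abelianization_iter n u :
  abelianization (subst_iter phi n u) = iter n (mulmx M) (abelianization u).
Proof. by elim: n => //= n <-; rewrite -abelianization_extend. Qed.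

Lemma iter_mulmxE n (v : 'cV[int]_k) : iter n (mulmx M) v = M ^+ n *m v.
Proof. by elim: n => [|n IH]; rewrite ?mul1mx //= IH exprS; exact: mulmxA. Qed.

Lemma pos_letter a : pos omega (abelianization [:: a]) = omega 0 a.
Proof. by rewrite -wlen_pos /wlen big_seq1. Qed.

Lemma primitive_letters : primitive_subst phi ->
  exists N, (forall b j, j \in subst_iter phi N [:: b]) /\
    forall j, exists i, j \in phi i.
Proof.
move=> [N N0 pos_M]; exists N.
have letters b j : j \in subst_iter phi N [:: b].
  rewrite -has_pred1 has_count -ltz_nat.
  have -> : (count_mem j (subst_iter phi N [:: b]))%:Z = (M ^+ N) j b.
    have := congr1 (fun z : 'cV[int]_k => z j 0) (abelianization_iter N [:: b]).
    rewrite iter_mulmxE !mxE => ->.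
    rewrite (bigD1 b) //= big1 => [|i ib]; rewrite !mxE /=.
      by rewrite eqxx mulr1 addr0.
    by rewrite eq_sym (negbTE ib) mulr0.
  exact: pos_M.
split=> // j; case: N N0 letters {pos_M} => // N _ /(_ j j) /flattenP[_ /mapP[i _ ->] ji].
by exists i.
Qed.

(** A relation between the two lengths is an integer vector annihilated by [omega]; by
    irreducibility only the zero vector is. *)
Lemma length_ratio_irrational a b (p q : int) : a != b ->
  irreducible_poly (char_poly (map_mx intr M : 'M[rat]_k)) ->
  p%:~R * omega 0 a = q%:~R * omega 0 b -> p = 0.
Proof.
move=> ab irr pq; apply: contraTeq (om0 a) => p0.
pose v : 'cV[int]_k := \col_i (p * (i == a)%:Z - q * (i == b)%:Z).
suff -> : omega = 0 by rewrite mxE ltxx.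
have v0 : v != 0.
  apply/eqP => /(congr1 (fun z : 'cV[int]_k => z a 0)); rewrite !mxE eqxx (negbTE ab).
  by rewrite mulr1 mulr0 subr0; apply/eqP.
have ov : omega *m map_mx intr v = 0.
  apply/rowP => z; rewrite ord1 -/(0 : 'I_1) -posE mxE /pos.
  under eq_bigr => i _ do rewrite mxE intrB !intrM mulrBr.
  rewrite sumrB (bigD1 a) //= big1 => [|i ia]; last by rewrite (negbTE ia) !mulr0.
  rewrite (bigD1 b) //= big1 => [|i ib]; last by rewrite (negbTE ib) !mulr0.
  by rewrite !eqxx !mulr1 !addr0 mulrC pq mulrC subrr.
exact: left_eigenvector_eq0 irr eig v0 ov.
Qed.

Context (mu : probability (borel_tiles phi lam omega) R).
Hypothesis mu_inv : translation_invariant mu.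
Hypothesis irr : irreducible_poly (char_poly (map_mx intr M : 'M[rat]_k)).
Hypothesis lam_Pisot : Pisot_number lam.

(** Stated with agreements in place of the balanced pair algorithm, so that it also applies with the
    two letters interchanged. *)
Lemma rotation_pure_discrete a b : primitive_subst phi ->
  omega 0 a < omega 0 b -> agree phi lam omega (0, a) (0, b) ->
  agree phi lam omega (omega 0 a, b) (0, b) ->
  agree phi lam omega (omega 0 a, b) (omega 0 b, a) ->
  pure_discrete_spectrum mu.
Proof.
move=> prim om_ab F1 F2 F3.
have [N [letters occurs]] := primitive_letters prim.
have ab : a != b by apply: contraTneq om_ab => ->; rewrite ltxx.
have ab_agree (p q : int) : agree phi lam omega (0, b) (p%:~R * omega 0 a + q%:~R * omega 0 b, b).
  have := @rotation_agree _ _ _ _ _ om0 lam1 eig a b om_ab F1 F2 F3 p q 0.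
  by rewrite add0r.
have ab_small : forall eps : R, 0 < eps ->
    exists p q : int, 0 < p%:~R * omega 0 a + q%:~R * omega 0 b < eps.
  apply: two_generated_dense => // p q; exact: length_ratio_irrational.
pose T := translation lam omega a b N.
have T_agree := @supertile_translation_agree _ _ _ _ _ om0 lam1 eig a b N (letters b)
  occurs ab_agree ab_small.
pose v : 'cV[int]_k := abelianization [:: a].
have v0 : v != 0.
  apply/eqP => /(congr1 (fun z : 'cV[int]_k => z a 0)); rewrite !mxE /= eqxx.
  by move/eqP.
have [P [d [i0 [s [c [Punit coordM d_lt1 coord_pos [c_stable c_pos]]]]]]] :=
  Pisot_splitting irr lam_Pisot (conj om0 eig) v0.
have T_scale : forall n g, T g -> T (lam ^+ n * g) by move=> n g; exact: translation_scale.
have T_sub : forall g h, T g -> T h -> T (g - h) by move=> g h; exact: translation_sub.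
have T_v : T (lam ^+ N * pos omega v).
  by exists 0%N, 1, 0; rewrite pos_letter mul1r mul0r addr0.
(* The positions of small translations; their multiples by [lam ^+ n] approximate all times of a
   Bohr set. *)
pose steps g := exists2 z, small_translation omega P i0 T z & g = pos omega z.
have pos0 : pos omega 0 = 0 by rewrite -[X in pos _ X](subrr v) posB subrr.
have T0 : T 0 by rewrite -(subrr (lam ^+ N * pos omega v)); exact: T_sub.
have steps_opp g : steps g -> steps (- g).
  move=> [z [Tz cz] ->]; exists (- z); last by rewrite -[- z]add0r posB pos0 sub0r.
  split; first by rewrite -[- z]add0r posB pos0; exact: T_sub.
  by move=> i ii0; rewrite map_mxN mulmxN mxE normcN; exact: cz.
have steps_legal p l t g x y : x \in supertiles phi lam omega p (0, l) ->
    y \in supertiles phi lam omega p (0, l) -> steps g ->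
    legal phi lam omega P i0 T (shift_tile t x) (shift_tile (t + g) y).
  by move=> xp yp [z zs ->]; exists p, l, t, z, x, y.
have decay := legal_discrepancy om0 lam1 eig Punit coordM d_lt1 coord_pos T_scale T_agree.
have count := mismatch_count om0 lam1 eig steps_legal decay.
have bohr_steps n del0 : 0 < del0 -> exists bs del, 0 < del /\
    forall t, bohr bs del t -> exists2 g, steps g & `|t - lam ^+ n * g| < del0.
  move=> del00; have [bs [del [d0 H]]] := bohr_small_translation lam1 eig coordM d_lt1
    c_stable c_pos T_sub T_scale T_v n del00.
  by exists bs, del; split=> // t /H[z zs zt]; exists (pos omega z) => //; exists z.
have ap A : measurable A -> approximable mu (@flow _ _ phi lam omega) (cindic R A).
  move=> mA; apply: approximable_cindic.
  - exact: flowD.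
  - exact: measurable_flow.
  - exact: mu_flow.
  - exact: (almost_periodic_measurable om0 mu_inv steps_opp count bohr_steps).
move=> F F2' eps eps0.
have [n [cf [f [fE fF]]]] := eigen_span_dense ap F2' eps0.
exists n, cf, f; split=> // i; have [fL2 [be fb]] := fE i.
split=> //; exists be => t; apply: filterS (fb t) => x.
by rewrite /flow /cis mulrA.
Qed.

End Assembly.

Theorem corollary3p3 (R : realType) (k : nat) (phi : 'I_k -> seq 'I_k)
    (lam : R) (omega : 'rV[R]_k)
    (mu : probability (borel_tiles phi lam omega) R) (a b : 'I_k) :
  Pisot_subst R phi ->
  irreducible_poly (char_poly (map_mx intr (incidence_mx phi) : 'M[rat]_k)) ->
  PF_eigenvalue phi lam ->
  positive_left_eigenvector phi lam omega ->
  aperiodic phi lam omega ->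
  mu (tiling_space phi lam omega) = 1%E ->
  translation_invariant mu ->
  a != b ->
  terminates_with_coincidence phi ([:: a; b], [:: b; a]) ->
  pure_discrete_spectrum mu.
Proof.
move=> [prim [lam' PF' Pisot']] irr PF [om0 eig] _ _ mu_inv ab term.
have lam'E := PF_eigenvalue_uniq PF' PF; rewrite lam'E in Pisot'.
have lam1 : 1 < lam by case: Pisot'.
have swap : perm_eq [:: a; b] [:: b; a] by exact/permPl/(perm_catC [:: a] [:: b]).
have pair x y : x \in layout omega 0 [:: a; b] -> y \in layout omega 0 [:: b; a] ->
    agree phi lam omega x y.
  by move=> xl yl c d cd *; exact: (terminates_coincide om0 lam1 eig swap term xl yl).
have G1 : agree phi lam omega (0, a) (0, b) by apply: pair; rewrite /= !inE eqxx.
have G2 : agree phi lam omega (omega 0 a, b) (0, b).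
  by apply: pair; rewrite /= add0r !inE eqxx ?orbT.
have G3 : agree phi lam omega (omega 0 a, b) (omega 0 b, a).
  by apply: pair; rewrite /= add0r !inE eqxx ?orbT.
have G4 : agree phi lam omega (0, a) (omega 0 b, a).
  by apply: pair; rewrite /= ?add0r !inE eqxx ?orbT.
(* The longer tile plays the circle and the shorter length the rotation angle; equal lengths are
   excluded by irreducibility. *)
case: (ltgtP (omega 0 a) (omega 0 b)) => [lt_ab|lt_ba|eq_ab].
- exact: (rotation_pure_discrete om0 lam1 eig mu_inv irr Pisot' prim lt_ab).
- apply: (rotation_pure_discrete om0 lam1 eig mu_inv irr Pisot' prim lt_ba);
    exact: agree_sym.
- have := @length_ratio_irrational _ _ _ _ _ om0 eig a b 1 1 ab irr.
  by rewrite eq_ab => /(_ erefl) /eqP.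
Qed.
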